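(* The inverse 2-maxian problem on a tree with $n$ vertices under the Chebyshev norm, i.e. with cost function $\max_{e\in E} c_e x_e$, can be solved in $O(n\log n)$ time.
   Context: Let $T=(V,E)$ be a tree with $|V|=n$, vertex weights $w_i\ge 0$ ($v_i \in V$) and edge lengths $\ell_e\ge 0$ ($e\in E$). A point of $T$ is a vertex or a point in the interior of an edge; $d$ is the shortest-path distance and $P(u,v)$ the path joining $u$ and $v$. A set $X=\{x_1,x_2\}$ of two points of $T$ is a 2-maxian of $T$ if it maximizes $F(X)=\sum_{i=1}^n w_i\max\{d(v_i,x_1),d(v_i,x_2)\}$ over all sets of two points of $T$. Inverse 2-maxian problem: given two prespecified leaves $a,b$ of $T$, modification bounds $\bar x_e\ge 0$ and unit modification costs $c_e\ge 0$ for $e\in E$, choose modifications $x_e$ with $0\le x_e\le \bar x_e$ and set new lengths $\tilde\ell_e=\ell_e+x_e$ for $e\in P(a,b)$ and $\tilde\ell_e=\ell_e-x_e$ for $e\notin P(a,b)$. The new lengths must be non-negative, and $\{a,b\}$ must be a 2-maxian of $T$ with respect to the lengths $\tilde\ell$. The goal is to minimize the given cost function of $x$. To solve the problem means to compute an optimal solution or report infeasibility. Running time is counted in elementary operations (arithmetic operations and comparisons) on the input numbers. *)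

(* Defs.v *)
From HB Require Import structures.
From mathcomp Require Import all_boot all_order all_algebra.
Set Implicit Arguments.
Unset Strict Implicit.
Unset Printing Implicit Defensive.
Import Order.TTheory GRing.Theory Num.Theory.
Local Open Scope ring_scope.

(* The orientation (src, dst) of an edge is immaterial. *)
Record problem (R : realFieldType) := Problem {
  nv : nat;
  ne : nat;
  src : 'I_ne -> 'I_nv;
  dst : 'I_ne -> 'I_nv;
  weight : 'I_nv -> R;
  len : 'I_ne -> R;
  bound : 'I_ne -> R;
  cost : 'I_ne -> R;
  leaf_a : 'I_nv;
  leaf_b : 'I_nv }.

Section Problem.
Variables (R : realFieldType) (I : problem R).
Local Notation V := 'I_(nv I).
Local Notation E := 'I_(ne I).
Implicit Types (u v : V) (e : E) (l x : E -> R).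

Definition adj : rel V := fun u v =>
  [exists e : E, ((src e, dst e) == (u, v)) || ((src e, dst e) == (v, u))].

Definition is_tree : Prop :=
  [/\ forall e, src e != dst e,
      forall e f : E, [set src e; dst e] = [set src f; dst f] -> e = f,
      forall u v, connect adj u v
    & forall c : seq V, ucycleb adj c -> (size c <= 2)%N].

Definition is_leaf v : bool := #|[set e : E | v \in [set src e; dst e]]| == 1%N.

Definition valid : Prop :=
  [/\ is_tree,
      (forall v, 0 <= weight v) /\ (forall e : E, 0 <= len e),
      (forall e : E, 0 <= bound e) /\ (forall e : E, 0 <= cost e)
    & [/\ is_leaf (leaf_a I), is_leaf (leaf_b I) & leaf_a I != leaf_b I]].

(* As in path.v, the path x_0, ..., x_k is given by its start x_0 and the tail
   [:: x_1; ...; x_k]. *)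
Definition simple_path u v (p : seq V) : bool :=
  [&& path adj u p, uniq (u :: p) & last u p == v].

Definition edges_of u (p : seq V) : {set E} :=
  [set e | ((src e, dst e) \in zip (u :: p) p)
        || ((dst e, src e) \in zip (u :: p) p)].

(* In a tree the union ranges over exactly one path. *)
Definition P u v : {set E} :=
  \bigcup_(p : (nv I).-bseq V | simple_path u v p) edges_of u p.

(* Shortest-path distance.  For l >= 0 no simple path is longer than the total
   edge length, so this default value does not affect the minimum. *)
Definition dist l u v : R :=
  \big[Num.min/(\sum_(e : E) l e)]_(p : (nv I).-bseq V | simple_path u v p)
    \sum_(e in edges_of u p) l e.

(* Inner e s is the point in the interior of e at distance s from src e. *)
Inductive point : Type :=
| Vertex of V
| Inner of E & R.

Definition is_point l (y : point) : bool :=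
  match y with Vertex _ => true | Inner e s => 0 < s < l e end.

Definition pdist l v (y : point) : R :=
  match y with
  | Vertex u => dist l v u
  | Inner e s => Num.min (dist l v (src e) + s) (dist l v (dst e) + (l e - s))
  end.

Definition F l (y1 y2 : point) : R :=
  \sum_(v : V) weight v * Num.max (pdist l v y1) (pdist l v y2).

Definition is_2maxian l (y1 y2 : point) : Prop :=
  [/\ is_point l y1, is_point l y2, y1 <> y2
    & forall z1 z2 : point, is_point l z1 -> is_point l z2 -> z1 <> z2 ->
        F l z1 z2 <= F l y1 y2].

Definition new_len x : E -> R := fun e =>
  if e \in P (leaf_a I) (leaf_b I) then len e + x e else len e - x e.

Definition feasible x : Prop :=
  [/\ forall e, 0 <= x e <= bound e,
      forall e, 0 <= new_len x e
    & is_2maxian (new_len x) (Vertex (leaf_a I)) (Vertex (leaf_b I))].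

(* The terms are nonnegative for every feasible x. *)
Definition chebyshev_cost x : R := \big[Num.max/0]_(e : E) (cost e * x e).

Definition optimal x : Prop :=
  feasible x /\ forall y, feasible y -> chebyshev_cost x <= chebyshev_cost y.

End Problem.

(* Model of computation: a real RAM, presented as a WHILE language.  The memory
   consists of integer arrays and arrays of numbers, a scalar variable being a
   cell of an array.  Every operation, constant, memory access, comparison and
   control step costs 1, for integers (indices) as well as for numbers.
   Numbers only admit field operations and comparison: there is no rounding
   and no conversion to integers, and a program contains no constants other
   than natural numbers.  Integers admit no multiplication. *)

Inductive iexp : Type :=
| ICst of nat
| IGet of nat & iexp              (* array, index *)
| IAdd of iexp & iexp
| ISub of iexp & iexp             (* truncated *)
| IHalf of iexp.

Inductive rexp : Type :=
| RCst of nat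
| RGet of nat & iexp
| RAdd of rexp & rexp
| RSub of rexp & rexp
| RMul of rexp & rexp
| RDiv of rexp & rexp.            (* division by 0 returns 0 *)

Inductive bexp : Type :=
| ILe of iexp & iexp
| RLe of rexp & rexp
| BNot of bexp
| BAnd of bexp & bexp.

Inductive cmd : Type :=
| Skip
| ISet of nat & iexp & iexp       (* array, index, value *)
| RSet of nat & iexp & rexp
| Seq of cmd & cmd
| If of bexp & cmd & cmd
| While of bexp & cmd.

Record store (R : Type) := Store {
  ints : nat -> nat -> nat;       (* array, index *)
  nums : nat -> nat -> R }.

Definition upd (T : Type) (m : nat -> nat -> T) (A i : nat) (z : T) :=
  fun B j : nat => if (B == A) && (j == i) then z else m B j.

Fixpoint ieval (R : Type) (s : store R) (e : iexp) : nat :=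
  match e with
  | ICst k => k
  | IGet A i => ints s A (ieval s i)
  | IAdd e1 e2 => (ieval s e1 + ieval s e2)%N
  | ISub e1 e2 => (ieval s e1 - ieval s e2)%N
  | IHalf e1 => (ieval s e1)./2
  end.

Fixpoint reval (R : realFieldType) (s : store R) (e : rexp) : R :=
  match e with
  | RCst k => k%:R
  | RGet A i => nums s A (ieval s i)
  | RAdd e1 e2 => reval s e1 + reval s e2
  | RSub e1 e2 => reval s e1 - reval s e2
  | RMul e1 e2 => reval s e1 * reval s e2
  | RDiv e1 e2 => reval s e1 / reval s e2
  end.

Fixpoint beval (R : realFieldType) (s : store R) (b : bexp) : bool :=
  match b with
  | ILe e1 e2 => (ieval s e1 <= ieval s e2)%N
  | RLe e1 e2 => reval s e1 <= reval s e2
  | BNot b1 => ~~ beval s b1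
  | BAnd b1 b2 => beval s b1 && beval s b2
  end.

Fixpoint icost (e : iexp) : nat :=
  match e with
  | ICst _ => 1
  | IGet _ e1 | IHalf e1 => (icost e1).+1
  | IAdd e1 e2 | ISub e1 e2 => (icost e1 + icost e2).+1
  end.

Fixpoint rcost (e : rexp) : nat :=
  match e with
  | RCst _ => 1
  | RGet _ i => (icost i).+1
  | RAdd e1 e2 | RSub e1 e2 | RMul e1 e2 | RDiv e1 e2 =>
      (rcost e1 + rcost e2).+1
  end.

Fixpoint bcost (b : bexp) : nat :=
  match b with
  | ILe e1 e2 => (icost e1 + icost e2).+1
  | RLe e1 e2 => (rcost e1 + rcost e2).+1
  | BNot b1 => (bcost b1).+1
  | BAnd b1 b2 => (bcost b1 + bcost b2).+1
  end.

(* exec c s t s' : started in s, c terminates in s' after t steps. *)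
Inductive exec (R : realFieldType) : cmd -> store R -> nat -> store R -> Prop :=
| ExSkip s : exec Skip s 1 s
| ExISet s A i e :
    exec (ISet A i e) s (icost i + icost e).+1
      (Store (upd (ints s) A (ieval s i) (ieval s e)) (nums s))
| ExRSet s A i e :
    exec (RSet A i e) s (icost i + rcost e).+1
      (Store (ints s) (upd (nums s) A (ieval s i) (reval s e)))
| ExSeq s s1 s2 c1 c2 t1 t2 :
    exec c1 s t1 s1 -> exec c2 s1 t2 s2 -> exec (Seq c1 c2) s (t1 + t2)%N s2
| ExIf s s1 b c1 c2 t :
    exec (if beval s b then c1 else c2) s t s1 ->
    exec (If b c1 c2) s (bcost b + t).+1 s1
| ExWhileF s b c :
    ~~ beval s b -> exec (While b c) s (bcost b).+1 s
| ExWhileT s s1 s2 b c t1 t2 :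
    beval s b -> exec c s t1 s1 -> exec (While b c) s1 t2 s2 ->
    exec (While b c) s (bcost b + t1 + t2).+1 s2.

Definition array_of (n : nat) (T : Type) (z : T) (f : 'I_n -> T) (i : nat) : T :=
  if insub i is Some j then f j else z.

(* Input: integer array 0 holds n, |E|, a, b, and integer arrays 1 and 2 hold
   the end vertices of the edges; number arrays 0 to 3 hold w, l, the bounds
   and the unit costs.  All other cells are 0. *)
Definition input (R : realFieldType) (I : problem R) : store R :=
  Store
    (fun A i => match A with
     | 0 => nth 0%N [:: nv I; ne I; nat_of_ord (leaf_a I); nat_of_ord (leaf_b I)] i
     | 1 => array_of 0%N (fun e : 'I_(ne I) => nat_of_ord (src e)) i
     | 2 => array_of 0%N (fun e : 'I_(ne I) => nat_of_ord (dst e)) i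
     | _ => 0%N
     end)
    (fun A i => match A with
     | 0 => array_of 0 (@weight R I) i
     | 1 => array_of 0 (@len R I) i
     | 2 => array_of 0 (@bound R I) i
     | 3 => array_of 0 (@cost R I) i
     | _ => 0
     end).

(* Output: cell 0 of integer array 3 is 0 if the problem is infeasible;
   otherwise it is 1 and number array 4 holds an optimal solution. *)
Definition correct_output (R : realFieldType) (I : problem R) (s : store R) : Prop :=
  (ints s 3 0 = 0%N /\ forall x : 'I_(ne I) -> R, ~ feasible x) \/
  (ints s 3 0 = 1%N /\ optimal (fun e : 'I_(ne I) => nums s 4 e)).

Definition solves_in_time (c : cmd) (T : nat -> nat) : Prop :=
  forall (R : realFieldType) (I : problem R), valid I ->
    exists (t : nat) (s : store R),
      [/\ exec c (input I) t s, correct_output I s & (t <= T (nv I))%N].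

(* Main.v *)
(* Let S be the set of vertices of positive weight, and call g farthest from r
   if d(r, u) <= d(r, g) for all vertices u.  By the four-point condition {a, b}
   is a 2-maxian iff a and b are farthest from each other, or a is farthest from
   every vertex of S, or b is.  In the tree rooted at b let r be the lowest
   common ancestor of S: b is farthest from every vertex of S iff it is farthest
   from r; likewise for a.  So there are four conditions of the form
   "g is farthest from r".

   Such a condition is monotone: for a cost bound t the best choice is to move
   the lengths as far as t permits on the edges of P(a, b) that lie on P(r, g)
   and on the edges that lie on neither path, and to leave all others alone.
   These lengths are affine in t between consecutive breakpoints c_e * cap_e.
   After sorting the breakpoints, the least t is found by a binary search with a
   linear time test, followed by an interpolation between two breakpoints. *)
Require Import Defs.
From mathcomp Require Import all_boot all_order all_algebra.
From mathcomp Require Import zify ring lra.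
Set Implicit Arguments.
Unset Strict Implicit.
Unset Printing Implicit Defensive.
Import Order.TTheory GRing.Theory Num.Theory.
Local Open Scope nat_scope.

(* Integer arrays.  [CONST] holds n, |E|, n - 1, the logarithm of n rounded up,
   and |E| + 1; these are the counts of the loops. *)
Local Notation INPUT := 0.
Local Notation SRC := 1.
Local Notation DST := 2.
Local Notation ANSWER := 3.
Local Notation CONST := 4.
Local Notation DEG := 5.
Local Notation PAR := 6.
Local Notation PE := 7.
Local Notation ORD := 8.
Local Notation CTR := 9.
Local Notation CTR2 := 10.
Local Notation ROOT := 11.
Local Notation GOAL := 12.
Local Notation QT := 13.
Local Notation TV := 14.
Local Notation TP := 15.
Local Notation ONP := 16.
Local Notation INP := 17.
Local Notation CNT := 18.
Local Notation GATE := 19.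
Local Notation OK := 20.
Local Notation LO := 21.
Local Notation HI := 22.
Local Notation LEFT := 23.
Local Notation MID := 24.
Local Notation RIGHT := 25.
Local Notation STOP := 26.
Local Notation WIDTH := 27.
Local Notation LOG := 31.
Local Notation FOUND := 32.
Local Notation BROOT := 33.
Local Notation BGOAL := 34.
Local Notation HALF := 35.
Local Notation FLAG := 36.
Local Notation FLAGS := 37.
Local Notation GATES := 38.
Local Notation EMPTY := 39.

(* Arrays of numbers, which are numbered independently of the integer arrays. *)
Local Notation WEIGHT := 0.
Local Notation LEN := 1.
Local Notation BOUND := 2.
Local Notation COST := 3.
Local Notation SOLUTION := 4.
Local Notation CAP := 5.
Local Notation XS := 6.
Local Notation YS := 7.
Local Notation THR := 8.
Local Notation DEP := 9.
Local Notation DEPLO := 10.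
Local Notation TLO := 11.
Local Notation THI := 12.
Local Notation CAND := 13.
Local Notation SHIFT := 14.
Local Notation RES := 15.
Local Notation BEST := 16.

Local Notation LEAFA := (IGet INPUT (ICst 2)).
Local Notation LEAFB := (IGet INPUT (ICst 3)).

(** * Counted loops *)

(** The vertex r depends on the tree and the weights alone, so it is known before any length is
    chosen. One modification serves all rivals u of g at once: in d(r, g) - d(r, u) every edge of
    P(r, g) has a non-negative coefficient and every other edge a non-positive one, whatever u is.
    The two halves of the first case use the same path, so the larger of their thresholds settles
    it; the cheapest of the three cases wins. If no weight is positive, r does not exist, but
    threshold 0 suffices. All reasoning about paths goes through a rooted tree: edges correspond to
    non-root vertices, and an edge lies on P(u, v) iff exactly one of u and v is below it, so
    distances are compared edge by edge. For the running time, programs are restricted to loops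
    whose counts are fixed in advance. Execution then becomes a function, and the cost is read off
    the nesting of the loops. The price is that no loop may end depending on the data and there is
    no recursion: rooting peels leaves from a queue, a merging pass is one loop over the output
    positions, and the binary search has a fixed number of rounds. *)

Inductive prog : Type :=
| PI of nat & iexp & iexp
| PR of nat & iexp & rexp
| PSeq of prog & prog
| PIf of bexp & prog & prog
| PSkip
| PFor of nat & nat & prog.       (* counter array, index of the count in [CONST] *)

Fixpoint compile (p : prog) : cmd :=
  match p with
  | PI A i e => ISet A i e
  | PR A i e => RSet A i e
  | PSeq p q => Seq (compile p) (compile q)
  | PIf b p q => If b (compile p) (compile q)
  | PSkip => Skip
  | PFor A k p =>
      Seq (ISet A (ICst 0) (ICst 0))
        (While (BNot (ILe (IGet CONST (ICst k)) (IGet A (ICst 0))))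
           (Seq (compile p)
              (ISet A (ICst 0) (IAdd (IGet A (ICst 0)) (ICst 1)))))
  end.

Definition seti R (A i z : nat) (s : store R) : store R :=
  Store (upd (ints s) A i z) (nums s).

Definition setr R (A i : nat) (z : R) (s : store R) : store R :=
  Store (ints s) (upd (nums s) A i z).

Fixpoint run (R : realFieldType) (p : prog) (s : store R) : store R :=
  match p with
  | PI A i e => seti A (ieval s i) (ieval s e) s
  | PR A i e => setr A (ieval s i) (reval s e) s
  | PSeq p q => run q (run p s)
  | PIf b p q => if beval s b then run p s else run q s
  | PSkip => s
  | PFor A k p =>
      iter (ints s CONST k)
        (fun s' => let s1 := run p s' in seti A 0 (ints s1 A 0 + 1) s1)
        (seti A 0 0 s)
  end.

Fixpoint iwrites (p : prog) : seq nat :=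
  match p with
  | PI A _ _ => [:: A]
  | PSeq p q | PIf _ p q => iwrites p ++ iwrites q
  | PFor A _ p => A :: iwrites p
  | _ => [::]
  end.

Fixpoint rwrites (p : prog) : seq nat :=
  match p with
  | PR A _ _ => [:: A]
  | PSeq p q | PIf _ p q => rwrites p ++ rwrites q
  | PFor _ _ p => rwrites p
  | _ => [::]
  end.

Fixpoint well_formed (p : prog) : bool :=
  match p with
  | PSeq p q | PIf _ p q => well_formed p && well_formed q
  | PFor A _ p =>
      [&& well_formed p, A != CONST, A \notin iwrites p & CONST \notin iwrites p]
  | _ => true
  end.

(** Frame rule. Whether an array is written is decided on the syntax, so its premise is mostly
    settled by computation. *)
Lemma ints_run (R : realFieldType) p (s : store R) A j :
  A \notin iwrites p -> ints (run p s) A j = ints s A j.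
Proof.
elim: p s => [B i e|B i e|p IHp q IHq|b p IHp q IHq||B k p IHp] s //=.
- by rewrite /upd inE => /negbTE ->.
- by rewrite mem_cat negb_or => /andP[Ap Aq]; rewrite IHq ?IHp.
- by rewrite mem_cat negb_or => /andP[Ap Aq]; case: ifP; rewrite ?IHq ?IHp.
- rewrite inE negb_or => /andP[AB Ap].
  elim: (ints s CONST k) => [|m IHm]; rewrite /= /upd (negbTE AB) //=.
  by rewrite IHp.
Qed.

Lemma nums_run (R : realFieldType) p (s : store R) A j :
  A \notin rwrites p -> nums (run p s) A j = nums s A j.
Proof.
elim: p s => [B i e|B i e|p IHp q IHq|b p IHp q IHq||B k p IHp] s //=.
- by rewrite /upd inE => /negbTE ->.
- by rewrite mem_cat negb_or => /andP[Ap Aq]; rewrite IHq ?IHp.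
- by rewrite mem_cat negb_or => /andP[Ap Aq]; case: ifP; rewrite ?IHq ?IHp.
- move=> Ap; elim: (ints s CONST k) => [|m IHm] //=.
  by rewrite IHp.
Qed.

Lemma run_for (R : realFieldType) (Inv : nat -> store R -> Prop) A k p (s : store R) :
  well_formed (PFor A k p) ->
  Inv 0 (seti A 0 0 s) ->
  (forall i s' s1, i < ints s CONST k -> ints s' A 0 = i ->
     (forall B j, B \notin iwrites (PFor A k p) -> ints s' B j = ints s B j) ->
     (forall B j, B \notin rwrites p -> nums s' B j = nums s B j) ->
     Inv i s' -> s1 = run p s' -> Inv i.+1 (seti A 0 i.+1 s1)) ->
  Inv (ints s CONST k) (run (PFor A k p) s).
Proof.
case/and4P=> _ AC Ap Cp Inv0 InvS /=.
set N := ints s CONST k in InvS *.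
set f := (fun s' => _).
suff H i : i <= N -> let s' := iter i f (seti A 0 0 s) in
  [/\ Inv i s', ints s' A 0 = i,
     (forall B j, B \notin A :: iwrites p -> ints s' B j = ints s B j) &
     (forall B j, B \notin rwrites p -> nums s' B j = nums s B j)].
  by have [] := H N (leqnn N).
elim: i => [_|i IHi iN].
  split => //= [|B j]; first by rewrite /upd !eqxx.
  by rewrite inE negb_or /upd => /andP[/negbTE-> _].
have [I1 I2 I3 I4] := IHi (ltnW iN).
rewrite iterS; set s' := iter i f _ in I1 I2 I3 I4 *.
have fE : f s' = seti A 0 i.+1 (run p s').
  by rewrite /f /= ints_run // I2 addn1.
rewrite fE; split.
- by apply: InvS; last reflexivity.
- by rewrite /= /upd !eqxx.
- move=> B j HB; have := HB; rewrite inE negb_or => /andP[BA Bp].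
  by rewrite /= /upd (negbTE BA) /= ints_run // I3.
- by move=> B j HB; rewrite /= nums_run // I4.
Qed.

(* Counts with index 3 are logarithmic, all others are linear. *)
Fixpoint lin_depth (p : prog) : nat :=
  match p with
  | PSeq p q | PIf _ p q => maxn (lin_depth p) (lin_depth q)
  | PFor _ k p => lin_depth p + (k != 3)
  | _ => 0
  end.

Fixpoint log_depth (p : prog) : nat :=
  match p with
  | PSeq p q | PIf _ p q => maxn (log_depth p) (log_depth q)
  | PFor _ k p => log_depth p + (k == 3)
  | _ => 0
  end.

(** The 23 of a loop consists of 13 per round (6 for the guard, 6 for the increment, 1 for the
    control step) and 10 paid once (3 for clearing the counter, 7 for the failing test). *)
Fixpoint cost_factor (p : prog) : nat :=
  match p with
  | PI A i e => (icost i + icost e).+1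
  | PR A i e => (icost i + rcost e).+1
  | PSeq p q => cost_factor p + cost_factor q
  | PIf b p q => (bcost b + cost_factor p + cost_factor q).+1
  | PSkip => 1
  | PFor A k p => cost_factor p + 23
  end.

(** As [n] and [l] are positive, the parts of a sequence or branch can be charged at the maximal
    depth. Since [CONST] is never written, the bounds on the counts persist. *)
Lemma exec_compile (R : realFieldType) p (s : store R) (n l : nat) :
  well_formed p -> 0 < n -> 0 < l -> CONST \notin iwrites p ->
  (forall k, ints s CONST k <= if k == 3 then l else n) ->
  exists2 t, exec (compile p) s t (run p s) &
    t <= cost_factor p * (n ^ lin_depth p * l ^ log_depth p).
Proof.
move=> + n0 l0.
have W0 a b : 0 < n ^ a * l ^ b by rewrite muln_gt0 !expn_gt0 n0 l0.
have Wm a b c d : n ^ a * l ^ b <= n ^ maxn a c * l ^ maxn b d.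
  by apply: leq_mul; rewrite leq_pexp2l // leq_maxl.
have Wr a b c d : n ^ c * l ^ d <= n ^ maxn a c * l ^ maxn b d.
  by apply: leq_mul; rewrite leq_pexp2l // leq_maxr.
elim: p s => [B i e|B i e|p IHp q IHq|b p IHp q IHq||B k p IHp] s /=.
- by move=> _ _ _; eexists; [exact: ExISet|rewrite !expn0 !muln1].
- by move=> _ _ _; eexists; [exact: ExRSet|rewrite !expn0 !muln1].
- case/andP=> wp wq; rewrite mem_cat negb_or => /andP[Cp Cq] Cs.
  have [t1 e1 T1] := IHp s wp Cp Cs.
  have [k|t2 e2 T2] := IHq (run p s) wq Cq; first by rewrite ints_run.
  exists (t1 + t2); first exact: ExSeq e1 e2.
  rewrite mulnDl; apply: leq_add.
    by apply: leq_trans T1 _; rewrite leq_mul2l Wm orbT.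
  by apply: leq_trans T2 _; rewrite leq_mul2l Wr orbT.
- case/andP=> wp wq; rewrite mem_cat negb_or => /andP[Cp Cq] Cs.
  have [t1 e1 T1] := IHp s wp Cp Cs.
  have [t2 e2 T2] := IHq s wq Cq Cs.
  set W := n ^ maxn _ _ * _.
  have {}T1 : t1 <= cost_factor p * W.
    by apply: leq_trans T1 _; rewrite leq_mul2l Wm orbT.
  have {}T2 : t2 <= cost_factor q * W.
    by apply: leq_trans T2 _; rewrite leq_mul2l Wr orbT.
  have HW : 0 < W by exact: W0.
  exists (bcost b + (if beval s b then t1 else t2)).+1.
    by apply: ExIf; case: ifP.
  have : bcost b <= bcost b * W by rewrite leq_pmulr.
  by case: ifP => _; nia.
- by move=> _ _ _; exists 1; [exact: ExSkip|].
case/and4P=> wp BC Bp Cp; rewrite inE negb_or => /andP[_ _] Cs.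
set N := ints s CONST k.
pose f (s' : store R) := let s1 := run p s' in seti B 0 (ints s1 B 0 + 1) s1.
rewrite -/f.
pose b := BNot (ILe (IGet CONST (ICst k)) (IGet B (ICst 0))).
pose c := Seq (compile p) (ISet B (ICst 0) (IAdd (IGet B (ICst 0)) (ICst 1))).
set W := n ^ lin_depth p * l ^ log_depth p in IHp.
pose T := cost_factor p * W.
have loop m (s' : store R) : (forall j, ints s' CONST j = ints s CONST j) ->
    ints s' B 0 + m = N ->
    exists2 t, exec (While b c) s' t (iter m f s') & t <= m * (T + 13) + 7.
  elim: m s' => [|m IHm] s' Cs' Bs'.
    exists (bcost b).+1 => //; apply: ExWhileF.
    by rewrite /= Cs' negbK -/N -Bs' addn0.
  have [|t1 e1 T1] := IHp s' wp Cp.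
    by move=> j; rewrite Cs'.
  have fE : f s' = seti B 0 (ints s' B 0 + 1) (run p s').
    by rewrite /f /= ints_run.
  have [||t2 e2 T2] := IHm (f s').
  + by move=> j; rewrite fE /= /upd eq_sym (negbTE BC) /= ints_run.
  + by rewrite fE /= /upd !eqxx /= addn1 addSnnS.
  exists (bcost b + (t1 + 6) + t2).+1.
    rewrite iterSr; apply: ExWhileT e2.
      by rewrite /= Cs' -/N -Bs' -ltnNge addnS ltnS leq_addr.
    by apply: ExSeq e1 _; exact: ExISet.
  have -> : bcost b = 6 by [].
  by move: T1 T2; rewrite -/T; lia.
have [||t e Tt] := loop N (seti B 0 0 s).
- by move=> j; rewrite /= /upd eq_sym (negbTE BC).
- by rewrite /= /upd !eqxx.
exists (3 + t).
  by apply: ExSeq e; exact: ExISet.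
have HN : N <= if k == 3 then l else n by exact: Cs.
have -> : n ^ (lin_depth p + (k != 3)) * l ^ (log_depth p + (k == 3))
   = W * (if k == 3 then l else n).
  rewrite /W; case: (k == 3); rewrite /= addn0 addn1 expnS; ring.
have M0 : 0 < (if k == 3 then l else n) by case: ifP.
have HW : 0 < W by exact: W0.
move: (if _ then l else n) HN M0 Tt => M HN M0 Tt.
have H1 : N * (T + 13) <= M * (cost_factor p * W + 13) by rewrite leq_mul2r HN orbT.
have : 23 <= 10 + 13 * 1 by [].
have : 0 < M * W by rewrite muln_gt0 M0.
have : M <= M * W by rewrite leq_pmulr.
move: H1 Tt; set X := M * W.
rewrite mulnDr mulnCA -/X mulnDl mulnC (mulnC W) -/X. lia.
Qed.

(** * Rooted trees *)

Section Tree.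
Variables (R : realFieldType) (I : problem R).
Local Notation V := 'I_(nv I).
Local Notation E := 'I_(ne I).
Implicit Types (u v c g r : V) (e : E).

Definition ends e u v := ((src e, dst e) == (u, v)) || ((src e, dst e) == (v, u)).

(** The last field makes [pe] a bijection from the non-root vertices to the edges, so a statement
    about edges becomes one about their lower ends. [rank] need not be the depth; it only has to
    decrease towards the root. *)
Record rooted (r : V) := Rooted {
  par : V -> V;
  pe : V -> E;
  rank : V -> nat;
  _ : par r = r;
  _ : forall v, v != r -> rank (par v) < rank v;
  _ : forall v, v != r -> ends (pe v) v (par v);
  _ : forall e, exists2 v, v != r & pe v = e }.

Lemma endsC e u v : ends e u v = ends e v u.
Proof. by rewrite /ends orbC. Qed.

Lemma adjP u v : reflect (exists e, ends e u v) (adj u v).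
Proof. exact: existsP. Qed.

Lemma adjC u v : adj u v = adj v u.
Proof. by apply/existsP/existsP => -[e]; exists e; rewrite orbC. Qed.

Lemma ends_set e u v : ends e u v -> [set src e; dst e] = [set u; v].
Proof. by case/orP => /eqP[-> ->] //; rewrite setUC. Qed.

Hypothesis valid_I : valid I.

(** The parent of [v] is a neighbour with a shorter walk to [r]. An edge joining no vertex to its
    parent would close a cycle with the parent edges between its ends. *)
Lemma rooted_exists r : inhabited (rooted r).
Proof.
have [[loopless simple conn acyclic] _ _ [leaf _ _]] := valid_I.
(* [e0] is only the default value in the choice [f] of parent edges. *)
have [e0 _] : exists e : E, leaf_a I \in [set src e; dst e].
  by have [e He] := card1P leaf; exists e; have := He e; rewrite !inE eqxx.
pose walk k v := [exists p : k.-tuple V, path (@adj _ I) v p && (last v p == r)].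
have walkP v : exists k, walk k v.
  have /connectP[p Hp Ep] := conn v r.
  by exists (size p); apply/existsP; exists (in_tuple p); rewrite /= Hp Ep eqxx.
pose rk v := ex_minn (walkP v).
have next v : v != r -> exists u, adj v u && (rk u < rk v).
  move=> vr; rewrite /rk; case: ex_minnP => k /existsP[[p /= Sp] /andP[]].
  case: p Sp => [_ _ /eqP /= Ev|x p Sp /= /andP[vx xp] lp min].
    by rewrite Ev eqxx in vr.
  exists x; rewrite vx /=; case: ex_minnP => j _ minj.
  have k0 : 0 < k by rewrite -(eqP Sp).
  have {}Sp : size p == k.-1 by rewrite -(eqP Sp).
  rewrite -(prednK k0) ltnS; apply: minj.
  by apply/existsP; exists (Tuple Sp); rewrite /= xp lp.

pose p v := if v == r then r else odflt r [pick u | adj v u && (rk u < rk v)].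
have pP v : v != r -> adj v (p v) && (rk (p v) < rk v).
  move=> vr; rewrite /p (negbTE vr); case: pickP => //= H.
  by have [u Hu] := next v vr; have := H u; rewrite Hu.
pose f v := odflt e0 [pick e | ends e v (p v)].
have fP v : v != r -> ends (f v) v (p v).
  move=> vr; rewrite /f; case: pickP => //= H.
  by have /andP[/adjP[e He] _] := pP v vr; have := H e; rewrite He.
have pr : p r = r by rewrite /p eqxx.
have endsI e u v : u != r -> p u = v -> ends e u v -> f u = e.
  move=> ur Ep He; apply: simple.
  by rewrite (ends_set (fP u ur)) (ends_set He) Ep.
pose tadj : rel V := fun u v => (u != r) && (p u == v) || (v != r) && (p v == u).
have tadjC : symmetric tadj by move=> u v; rewrite /tadj orbC.
have tadjS : subrel tadj (@adj _ I).
  move=> u v /orP[] /andP[ur /eqP<-]; last rewrite adjC.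
    by have /andP[] := pP u ur.
  by have /andP[] := pP v ur.
have toroot v : connect tadj v r.
  elim: {v}(rk v) {-2}v (leqnn (rk v)) => [|m IHm] v Hv.
    have [->//|vr] := eqVneq v r.
    by have /andP[_] := pP v vr; move: Hv; rewrite leqn0 => /eqP->.
  have [->//|vr] := eqVneq v r.
  have /andP[_ Hr] := pP v vr.
  apply: connect_trans (IHm (p v) _); last by rewrite -ltnS; apply: leq_trans Hr Hv.
  by apply: connect1; rewrite /tadj vr eqxx.
apply: (inhabits (@Rooted r p f rk _ _ _ _)) => //.
  by move=> v vr; have /andP[] := pP v vr.
move=> e; have He : ends e (src e) (dst e) by rewrite /ends eqxx.
have [/orP[/andP[ur /eqP E1]|/andP[ur /eqP E1]]|] := boolP (tadj (src e) (dst e)).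
- by exists (src e) => //; apply: (endsI _ _ _ ur E1).
- by exists (dst e) => //; apply: (endsI _ _ _ ur E1); rewrite endsC.
move=> Nt; exfalso.
have /connectP[q Hq Eq] : connect tadj (src e) (dst e).
  apply: connect_trans (toroot _) _.
  by rewrite (sym_connect_sym tadjC).
case/shortenP: Hq Eq => q' Hq' Uq _ Eq.
have /acyclic : ucycleb (@adj _ I) (src e :: q').
  rewrite /ucycleb Uq andbT /= rcons_path (sub_path tadjS Hq') -Eq /=.
  by rewrite adjC; apply/adjP; exists e.
(* Cycles with at most two vertices are not excluded by acyclicity: with one vertex, [e] would be a
   loop, and with two, it would join a vertex to its parent, against [Nt]. *)
case: q' Hq' Eq {Uq} => [_ /= E1|x [|y q'] //=].
  by have := loopless e; rewrite E1 eqxx.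
by rewrite andbT => Hx Ex; rewrite Ex Hx in Nt.
Qed.

Section Rooted.
Variables (r : V) (T : rooted r).
Implicit Type d : V.

Definition anc c v := fconnect (par T) v c.

Lemma par_root : par T r = r. Proof. by case: T. Qed.

Lemma rank_par v : v != r -> rank T (par T v) < rank T v.
Proof. by case: T => * /=; auto. Qed.

Lemma pe_ends v : v != r -> ends (pe T v) v (par T v).
Proof. by case: T => * /=; auto. Qed.

Lemma pe_surj e : exists2 v, v != r & pe T v = e.
Proof. by case: T => * /=; auto. Qed.

Lemma pe_inj c d : c != r -> d != r -> pe T c = pe T d -> c = d.
Proof.
move=> cr dr Ecd; have := pe_ends cr; rewrite Ecd => H1.
have H2 := pe_ends dr; apply/eqP/negPn/negP => cd.
have := ends_set H1; rewrite (ends_set H2) => E2.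
have : c \in [set d; par T d] by rewrite E2 !inE eqxx.
rewrite !inE (negbTE cd) /= => /eqP Ec.
have : d \in [set c; par T c] by rewrite -E2 !inE eqxx.
rewrite !inE eq_sym (negbTE cd) /= => /eqP Ed.
have := rank_par cr; have := rank_par dr.
by rewrite -Ec -Ed => /ltn_trans H /H; rewrite ltnn.
Qed.

Lemma ancxx v : anc v v. Proof. exact: connect0. Qed.

Lemma anc_root c : anc c r = (c == r).
Proof.
apply/idP/eqP => [|->]; last exact: ancxx.
by case/iter_findex; rewrite iter_fix // par_root.
Qed.

Lemma anc_par c v : anc c v = (c == v) || anc c (par T v).
Proof.
apply/idP/orP => [/connectP[[|x p] /= Hp ->]|[/eqP->|]]; first by left.
- by case/andP: Hp => /eqP <- Hp; right; apply/connectP; exists p.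
- exact: ancxx.
- by apply: connect_trans; apply: connect1; rewrite /= eqxx.
Qed.

Lemma anc_rank c v : anc c v -> rank T c <= rank T v.
Proof.
move=> /connectP[p + ->] {c}; elim: p v => //= x p IH v /andP[/eqP <- Hp].
apply: leq_trans (IH _ Hp) _.
by have [->|/rank_par/ltnW //] := eqVneq v r; rewrite par_root.
Qed.

Lemma anc_parF v : v != r -> anc v (par T v) = false.
Proof.
by move=> vr; apply/negP => /anc_rank; rewrite leqNgt rank_par.
Qed.

Lemma anc_r v : anc r v.
Proof.
elim: {v}(rank T v) {-2}v (leqnn (rank T v)) => [|m IHm] v Hv.
  have [->|vr] := eqVneq v r; first exact: ancxx.
  by have := rank_par vr; move: Hv; rewrite leqn0 => /eqP ->.
have [->|vr] := eqVneq v r; first exact: ancxx.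
rewrite anc_par IHm ?orbT //.
by rewrite -ltnS; apply: leq_trans (rank_par vr) Hv.
Qed.

Lemma anc_trans : transitive anc.
Proof. by move=> u c v Hcu Huv; apply: connect_trans Huv Hcu. Qed.

Lemma anc_total c d v : anc c v -> anc d v -> anc c d || anc d c.
Proof.
elim: {v}(rank T v) {-2}v (leqnn (rank T v)) => [|m IHm] v Hv.
  have [->|vr] := eqVneq v r.
    by rewrite !anc_root => /eqP-> _; rewrite anc_r.
  by have := rank_par vr; move: Hv; rewrite leqn0 => /eqP ->.
have [->|vr] := eqVneq v r.
  by rewrite !anc_root => /eqP-> _; rewrite anc_r.
rewrite anc_par => /orP[/eqP->->|Hc]; first by rewrite orbT.
rewrite anc_par => /orP[/eqP->|Hd]; first by rewrite [anc c v]anc_par Hc orbT.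
apply: IHm Hc Hd; rewrite -ltnS; exact: leq_trans (rank_par vr) Hv.
Qed.

(** The parent edge of [c] is the only edge that leaves the subtree below [c]. *)
Lemma anc_ends c e u v : c != r -> ends e u v ->
  anc c u (+) anc c v = (e == pe T c).
Proof.
move=> cr; have [x xr <-] := pe_surj e.
wlog: u v / u = x /\ v = par T x.
  move=> H He; case/orP: (He) (pe_ends xr) => /eqP[E1 E2];
    rewrite /ends E1 E2 => /orP[] /eqP[Eu Ev].
  - exact: H.
  - by rewrite addbC; apply: H; rewrite // endsC.
  - by rewrite addbC; apply: H; rewrite // endsC.
  - exact: H.
case=> -> -> _; rewrite [anc c x]anc_par.
have -> : (pe T x == pe T c) = (c == x).
  by apply/eqP/eqP => [/pe_inj-> //|->].
by case: eqP => [->|_]; rewrite ?addbb // anc_parF.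
Qed.

Lemma edges_of_cons e u x p :
  e \in edges_of u (x :: p) = ends e u x || (e \in edges_of x p).
Proof.
rewrite /edges_of !in_set /= !in_cons /ends !xpair_eqE.
rewrite [(dst e == u) && _]andbC.
by do !case: (_ == _); do ?case: (_ \in _).
Qed.

Lemma edges_of_mem e u (p : seq V) : e \in edges_of u p ->
  src e \in u :: p /\ dst e \in u :: p.
Proof.
elim: p u => [|x p IH] u; first by rewrite inE.
rewrite edges_of_cons => /orP[|/IH[H1 H2]].
  by case/orP => /eqP[-> ->]; rewrite !inE !eqxx ?orbT.
by rewrite inE H1 inE H2 !orbT.
Qed.

(* A simple path uses every edge at most once, so only the parity of the
   number of crossings matters. *)
Lemma edges_of_anc c u p : c != r -> path (@adj _ I) u p -> uniq (u :: p) ->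
  (pe T c \in edges_of u p) = anc c u (+) anc c (last u p).
Proof.
move=> cr; elim: p u => [|x p IH] u /=; first by rewrite addbb !inE.
case/andP=> /adjP[e He] Hp /andP[ux Up].
have <- : (anc c u (+) anc c x) (+) (anc c x (+) anc c (last x p)) =
    anc c u (+) anc c (last x p) by rewrite -addbA addKb.
rewrite edges_of_cons -(IH x) // (anc_ends cr He).
have [Ee|nee] := eqVneq; last first.
  suff -> : ends (pe T c) u x = false by [].
  apply: contraNF nee => He'; have [[_ simple _ _] _ _ _] := valid_I.
  by rewrite (simple e (pe T c)) // (ends_set He) (ends_set He').
rewrite -Ee He /=; apply/esym/negP => /edges_of_mem[Hs Hd].
by case/orP: He Hs Hd => /eqP[-> ->]; rewrite (negbTE ux).
Qed.

Lemma simple_pathW u v : exists p : (nv I).-bseq V, simple_path u v p.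
Proof.
have [[_ _ conn _] _ _ _] := valid_I.
have /connectP[p Hp ->] := conn u v; case/shortenP: Hp => q Hq Uq _.
have Sq : size q <= nv I.
  have /card_uniqP Cq := Uq.
  by have := max_card (mem (u :: q)); rewrite Cq card_ord; apply: ltnW.
by exists (Bseq Sq); apply/and3P; split.
Qed.

Lemma edges_of_simple u v p c : c != r -> simple_path u v p ->
  (pe T c \in edges_of u p) = anc c u (+) anc c v.
Proof. by move=> cr /and3P[Hp Up /eqP <-]; apply: edges_of_anc. Qed.

(** This replaces paths by membership in subtrees: an edge separates [u] from [v] iff exactly one of
    them is below it. *)
Lemma mem_P c u v : c != r -> (pe T c \in P u v) = anc c u (+) anc c v.
Proof.
move=> cr; apply/bigcupP/idP => [[p Hp]|H].
  by rewrite (edges_of_simple _ Hp).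
by have [p Hp] := simple_pathW u v; exists p; rewrite // (edges_of_simple _ Hp).
Qed.

Lemma edges_of_P u v p : simple_path u v p -> edges_of u p = P u v.
Proof.
move=> Hp; apply/setP => e; have [c cr <-] := pe_surj e.
by rewrite (edges_of_simple _ Hp) // mem_P.
Qed.

End Rooted.

(** * Tree distances *)

Local Open Scope ring_scope.

(** The edges common to both paths are run through back and forth, and cancel. *)
Lemma P_xor e u v w : (e \in P u w) = (e \in P u v) (+) (e \in P v w).
Proof.
have [T] := rooted_exists u; have [c cr <-] := pe_surj T e.
by rewrite !mem_P // -addbA addKb.
Qed.

Lemma PC u v : P u v = P v u.
Proof.
apply/setP => e; have [T] := rooted_exists u; have [c cr <-] := pe_surj T e.
by rewrite !mem_P // addbC.
Qed.

Lemma P_self u : P u u = set0.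
Proof.
apply/setP => e; have [T] := rooted_exists u; have [c cr <-] := pe_surj T e.
by rewrite !mem_P // addbb inE.
Qed.

Section Distance.
Variable l : E -> R.
Hypothesis l_ge0 : forall e, 0 <= l e.

Lemma distE u v : dist l u v = \sum_(e in P u v) l e.
Proof.
have [p0 Hp0] := simple_pathW u v.
have [T] := rooted_exists u.
rewrite /dist (eq_bigr (fun _ => \sum_(e in P u v) l e)); last first.
  by move=> p Hp; rewrite (edges_of_P T Hp).
rewrite (bigD1 p0) //=; apply/min_idPl.
apply: (big_rec (fun y => \sum_(e in P u v) l e <= y)) => [|p x _ Hx]; last by rewrite le_min lexx.
by rewrite [leRHS](bigID (mem (P u v))) /= lerDl sumr_ge0.
Qed.

Lemma dist_sum u v : dist l u v = \sum_e (e \in P u v)%:R * l e.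
Proof.
rewrite distE big_mkcond; apply: eq_bigr => e _.
by case: ifP => _; rewrite ?mul1r ?mul0r.
Qed.

Lemma distC u v : dist l u v = dist l v u.
Proof. by rewrite !distE PC. Qed.

Lemma dist_self u : dist l u u = 0.
Proof. by rewrite distE P_self big_set0. Qed.

Lemma dist_ge0 u v : 0 <= dist l u v.
Proof. by rewrite distE sumr_ge0. Qed.

Lemma dist_split u v w : [disjoint P u v & P v w] ->
  dist l u w = dist l u v + dist l v w.
Proof.
move=> D; rewrite !dist_sum -big_split; apply: eq_bigr => e _ /=.
rewrite (P_xor e u v w); have := disjointFr D (x := e).
by case: (e \in P u v) => [->|] //; rewrite /= ?mul0r ?addr0 ?add0r.
Qed.

Lemma dist_triangle u v w : dist l u w <= dist l u v + dist l v w.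
Proof.
rewrite !dist_sum -big_split; apply: ler_sum => e _ /=.
rewrite (P_xor e u v w) -mulrDl ler_wpM2r //.
by do !case: (_ \in _) => /=; lra.
Qed.

Lemma dist_par r (T : rooted r) v : v != r ->
  dist l r v = dist l r (par T v) + l (pe T v).
Proof.
move=> vr; rewrite !dist_sum (bigD1 (pe T v)) //= [in RHS](bigD1 (pe T v)) //=.
rewrite !mem_P // !anc_root (negbTE vr) /= ancxx anc_parF // mul1r mul0r add0r.
rewrite addrC; congr (_ + _); apply: eq_bigr => e; have [c cr <-] := pe_surj T e.
move=> Hc; rewrite !mem_P // !anc_root (negbTE cr) [anc T c v]anc_par.
by case: (c =P v) Hc => [->|//]; rewrite eqxx.
Qed.

Lemma four_point x y z w :
  dist l x y + dist l z w <=
  Num.max (dist l x z + dist l y w) (dist l x w + dist l y z).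
Proof.
have [T] := rooted_exists x.
(* The Gromov product at [x]: the length common to the paths from [x] to [u] and to [v]. The claim
   becomes the ultrametric inequality that [m z w] is at least the minimum of [m y z] and
   [m y w]. *)
pose m u v : R := \sum_e ((e \in P x u) && (e \in P x v))%:R * l e.
have dE u v : dist l u v = dist l x u + dist l x v - 2 * m u v.
  rewrite !dist_sum mulr_sumr -big_split -sumrB; apply: eq_bigr => e _ /=.
  rewrite (P_xor e u x v) (PC u).
  by case: (e \in P x u); case: (e \in P x v) => /=; ring.
have m_le u v u' v' : (forall c, anc T c u -> anc T c v -> anc T c u' && anc T c v') ->
    m u v <= m u' v'.
  move=> H; apply: ler_sum => e _; have [c cr <-] := pe_surj T e.
  rewrite !mem_P // !anc_root (negbTE cr) /=.
  case: (boolP (anc T c u && anc T c v)) => [/andP[Hu Hv]|_].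
    by rewrite H.
  by rewrite mul0r mulr_ge0.
(* The common ancestors of (y,z) and those of (y,w) both form a chain above y. *)
have : (m y z <= m z w) || (m y w <= m z w).
  have [|] := boolP [forall c, anc T c y && anc T c z ==> anc T c w].
    move/forallP => H; apply/orP; left; apply: m_le => c Hy Hz.
    by rewrite Hz; apply: implyP (H c) _; rewrite Hy.
  rewrite negb_forall => /existsP[c]; rewrite negb_imply => /andP[/andP[cy cz] cw].
  apply/orP; right; apply: m_le => d dy dw; rewrite dw andbT.
  have /orP[cd|dc] := anc_total cy dy; last exact: anc_trans dc cz.
  by rewrite (anc_trans cd dw) in cw.
rewrite (dE z w) (dE y w) (dE y z) le_max => /orP[H|H]; apply/orP; [right|left]; lra.
Qed.

End Distance.
End Tree.

(** * Optimality criterion *)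

Section Criterion.
Local Open Scope ring_scope.
Variables (R : realFieldType) (I : problem R).
Hypothesis valid_I : valid I.
Local Notation V := 'I_(nv I).
Local Notation E := 'I_(ne I).
Local Notation a := (leaf_a I).
Local Notation b := (leaf_b I).
Implicit Types (u v r g : V) (e : E) (Q : {set E}).

Definition far (l : E -> R) r g := forall u, dist l r u <= dist l r g.

(* [r] is the vertex nearest to [g] in the subtree spanned by the vertices of
   positive weight. *)
Definition gate r g :=
  (forall v, 0 < weight v -> [disjoint P v r & P r g]) /\
  (forall u, exists2 v, 0 < weight v & [disjoint P v r & P r u]).

Section Lengths.
Variable l : E -> R.
Hypothesis l_ge0 : forall e, 0 <= l e.
Local Notation d := (dist l).

(** From every weighted [v] the path to [g] passes through [r], which gives one direction by the
    triangle inequality. Conversely each [u] is reached through [r] from some weighted [v], and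
    [d v r] cancels. As [gate] does not mention lengths, this applies to all modified lengths. *)
Lemma far_gate r g : gate r g ->
  (forall v, 0 < weight v -> far l v g) <-> far l r g.
Proof.
case=> G1 G2; split=> H.
  move=> u; have [v wv D] := G2 u; have := H v wv u.
  by rewrite (dist_split valid_I l_ge0 D) (dist_split valid_I l_ge0 (G1 v wv)) lerD2l.
move=> v wv u; rewrite (dist_split valid_I l_ge0 (G1 v wv)).
by apply: le_trans (dist_triangle valid_I l_ge0 v r u) _; rewrite lerD2l.
Qed.

(** The four-point condition bounds [d v u + d x y] by [d v x + d u y] or by [d v y + d u x], and
    neither [d u y] nor [d u x] exceeds [d x y]. *)
Lemma diameter_ecc x y : far l x y -> far l y x ->
  forall u v, d v u <= Num.max (d v x) (d v y).
Proof.
move=> fx fy u v; have := four_point valid_I l_ge0 v u x y.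
have := fx u; have := fy u; rewrite !le_max.
rewrite (distC valid_I l_ge0 y x) (distC valid_I l_ge0 y u) (distC valid_I l_ge0 x u).
by move=> H1 H2 /orP[] H3; apply/orP; [left|right]; lra.
Qed.

(** If [z] is not farthest from some weighted [v], then [d v z < d v y], and the four-point
    condition for [u], [z], [v], [y] yields [d u z <= d y z] or [d u z < d u y] for every [u]. Used
    for both orders of the two leaves, the strict alternatives exclude each other, so neither leaf
    has a vertex farther away than the other leaf. *)
Lemma ecc_cases :
  (forall v, 0 < weight v -> forall u, d v u <= Num.max (d v a) (d v b)) <->
  [\/ far l a b /\ far l b a, forall v, 0 < weight v -> far l v a
    | forall v, 0 < weight v -> far l v b].
Proof.
have C := distC valid_I l_ge0.
split; last first.
  case=> [[f1 f2] v _ u|H v wv u|H v wv u]; first exact: diameter_ecc.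
    by rewrite le_max H.
  by rewrite le_max H // orbT.
move=> H.
have far_or y z v : 0 < weight v ->
    (forall u, d v u <= Num.max (d v y) (d v z)) -> d v z < d v y ->
    forall u, (d u z <= d y z) \/ (d u z < d u y).
  move=> wv Hv lt u; have := four_point valid_I l_ge0 u z v y.
  have := Hv u; rewrite (max_l (ltW lt)) (C v u) (C z v) (C z y) le_max => H1.
  by case/orP => H2; [left|right]; lra.
have notfar y z : (forall v, 0 < weight v -> forall u, d v u <= Num.max (d v y) (d v z)) ->
    (forall v, 0 < weight v -> far l v z) \/
    forall u, (d u z <= d y z) \/ (d u z < d u y).
  move=> Hyz; have [/forallP Hz|/forallPn[v]] :=
    boolP [forall v, (0 < weight v) ==> [forall u, d v u <= d v z]].
    by left=> v wv u; have := Hz v; rewrite wv => /forallP.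
  rewrite negb_imply => /andP[wv /forallPn[u Hu]]; right.
  apply: (far_or _ _ v) => //; first exact: Hyz.
  rewrite ltNge; apply: contra Hu => Hu.
  by have := Hyz v wv u; rewrite (max_r Hu).
have H' v : 0 < weight v -> forall u, d v u <= Num.max (d v b) (d v a).
  by move=> wv u; rewrite maxC; apply: H.
have [|Ha] := notfar _ _ H'; first by constructor 2.
have [|Hb] := notfar _ _ H; first by constructor 3.
have Hab u : d u a <= d a b /\ d u b <= d a b.
  by have := Ha u; have := Hb u; rewrite (C b a) => -[] ? [] ?; split; lra.
by constructor 1; split=> u; have [] := Hab u; rewrite ?(C a u) ?(C b u) ?(C b a).
Qed.

(** Seen from [v], one end of an edge is farther than the other by the full length of the edge, so
    an interior point never beats that end. *)
Lemma pdist_le v m y : (forall u, d v u <= m) -> is_point l y -> pdist l v y <= m.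
Proof.
move=> H; case: y => [u _|e s /=]; first exact: H.
case/andP=> s0 s1; rewrite ge_min.
have [T] := rooted_exists valid_I v.
have Hab : d v (dst e) = d v (src e) + l e \/ d v (src e) = d v (dst e) + l e.
  have [c cr Ec] := pe_surj T e; have := pe_ends T cr; rewrite Ec.
  have := dist_par valid_I l_ge0 T cr; rewrite Ec => Hc.
  by case/orP => /eqP[-> ->]; [right|left].
have := H (src e); have := H (dst e).
by case: Hab => -> H1 H2; apply/orP; [left|right]; lra.
Qed.

(** The ends of a longest path attain the eccentricity of all vertices simultaneously. An optimal
    pair must match this sum, hence match it term by term wherever the weight is positive. *)
Lemma maxian_ecc :
  is_2maxian l (Vertex a) (Vertex b) <->
  forall v, 0 < weight v -> forall u, d v u <= Num.max (d v a) (d v b).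
Proof.
have [_ [w_ge0 _] _ [_ _ ab]] := valid_I.
split; last first.
  move=> H; split=> // [[/eqP]|z1 z2 p1 p2 _]; first exact/negP.
  apply: ler_sum => v _.
  have := w_ge0 v; rewrite le_eqVlt => /orP[/eqP <-|wv]; first by rewrite !mul0r.
  by rewrite ler_wpM2l // ge_max !(pdist_le (H v wv)).
case=> _ _ _ opt v wv u.
pose D (p : V * V) := d p.1 p.2.
(* The maximum is taken over distinct pairs because a 2-maxian competes with sets of two points
   only; if all distances are 0, the unrestricted maximum could be attained at [x = y]. *)
case: (@arg_maxP _ _ _ (a, b) (fun p => p.1 != p.2) D ab) => -[x y] /= xy Dmax.
have far_xy z t : z != t -> d z t <= d x y by move=> zt; apply: (Dmax (z, t)).
have fx : far l x y.
  move=> z; have [<-|zx] := eqVneq x z; last exact: far_xy.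
  by rewrite (dist_self valid_I) // dist_ge0.
have fy : far l y x.
  move=> z; rewrite (distC valid_I l_ge0 y x).
  have [<-|zx] := eqVneq y z; last exact: far_xy.
  by rewrite (dist_self valid_I) // dist_ge0.
have ecc := diameter_ecc fx fy.
have Hxy : Vertex x <> Vertex y by case=> /eqP; exact/negP.
have := opt (Vertex x) (Vertex y) isT isT Hxy.
rewrite /F -subr_le0 -sumrB => Hs.
have Ht w : 0 <= weight w * Num.max (d w x) (d w y) - weight w * Num.max (d w a) (d w b).
  by rewrite subr_ge0 ler_wpM2l // ge_max !ecc.
have /eqP : \sum_w (weight w * Num.max (d w x) (d w y) -
    weight w * Num.max (d w a) (d w b)) = 0.
  by apply/eqP; rewrite eq_le Hs sumr_ge0.
rewrite psumr_eq0 // => /allP /(_ v); rewrite mem_index_enum => /(_ isT) /=.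
rewrite subr_eq0 => /eqP /(mulfI (lt0r_neq0 wv)) <-; exact: ecc.
Qed.

End Lengths.

(** * Modifications of bounded cost *)

Definition cap e : R :=
  if e \in P a b then bound e else Num.min (bound e) (len e).

(* The lengths are pushed as far as the cost threshold [t] allows on the edges
   where this helps the target [g] of the path [Q = P r g] to be farthest from
   [r], and left alone on the others. *)
Definition shift Q (t : R) e : R :=
  if (e \in P a b) == (e \in Q) then
    if cost e * cap e <= t then cap e else t / cost e
  else 0.

Definition admissible (x : E -> R) :=
  (forall e, 0 <= x e <= bound e) /\ (forall e, 0 <= new_len x e).

Definition reaches r g (t : R) := far (new_len (shift (P r g) t)) r g.

Let w_ge0 v : 0 <= weight v. Proof. by have [_ [H _] _ _] := valid_I. Qed.
Let len_ge0 e : 0 <= len e. Proof. by have [_ [_ H] _ _] := valid_I. Qed.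
Let bound_ge0 e : 0 <= bound e. Proof. by have [_ _ [H _] _] := valid_I. Qed.
Let cost_ge0 e : 0 <= cost e. Proof. by have [_ _ [_ H] _] := valid_I. Qed.

Lemma cap_ge0 e : 0 <= cap e.
Proof. by rewrite /cap; case: ifP; rewrite ?le_min ?bound_ge0 ?len_ge0. Qed.

Lemma cap_admissible (x : E -> R) e :
  (0 <= x e <= cap e) = (0 <= x e <= bound e) && (0 <= new_len x e).
Proof.
rewrite /cap /new_len; case: ifP => _; last by rewrite le_min subr_ge0 andbA.
by case/boolP: (0 <= x e) => //= H; rewrite addr_ge0 // andbT.
Qed.

Lemma shift_bounds Q t e : 0 <= t -> 0 <= shift Q t e <= cap e.
Proof.
move=> t0; have c0 := cap_ge0 e.
rewrite /shift; case: ifP => _; last by rewrite lexx.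
case: (leP (cost e * cap e) t) => [_|H]; first by rewrite c0 lexx.
(* The quotient is used only above the threshold, where the cost cannot vanish; division by 0 never
   occurs. *)
have cp : 0 < cost e.
  by rewrite lt_def cost_ge0 andbT; apply: contraTneq H => ->; rewrite mul0r -leNgt.
by rewrite divr_ge0 //= ler_pdivrMr // mulrC ltW.
Qed.

Lemma shift_admissible Q t : 0 <= t -> admissible (shift Q t).
Proof.
by move=> t0; split=> e; have := shift_bounds Q e t0; rewrite cap_admissible => /andP[].
Qed.

Lemma shift_cost Q t e : 0 <= t -> cost e * shift Q t e <= t.
Proof.
move=> t0; rewrite /shift; case: ifP => _; last by rewrite mulr0.
case: (leP (cost e * cap e) t) => // H; have [->|c0] := eqVneq (cost e) 0; first by rewrite mul0r.
by rewrite mulrC divfK.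
Qed.

Lemma shift_max Q t x e : admissible x -> cost e * x e <= t ->
  (e \in P a b) == (e \in Q) -> x e <= shift Q t e.
Proof.
move=> [xb xn] xt eQ; rewrite /shift eQ.
have /andP[_ xc] : 0 <= x e <= cap e by rewrite cap_admissible xb xn.
case: (leP (cost e * cap e) t) => // H.
have cp : 0 < cost e.
  rewrite lt_def cost_ge0 andbT; apply: contraTneq H => c0.
  by rewrite -leNgt c0 mul0r; rewrite c0 mul0r in xt.
by rewrite ler_pdivlMr // mulrC.
Qed.

(** In [d r g - d r u] the coefficient of an edge is 0 or 1 on P(r, g) and 0 or -1 elsewhere, for
    every [u]. So the shift makes each summand at least as large as any other admissible
    modification within the threshold does. *)
Lemma reaches_max r g x t : admissible x -> (forall e, cost e * x e <= t) -> 0 <= t ->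
  far (new_len x) r g -> reaches r g t.
Proof.
move=> adm xt t0 fx u; have [xb xn] := adm.
have [_ sn] := shift_admissible (P r g) t0.
have := fx u; rewrite !(dist_sum valid_I) // -subr_ge0 -sumrB => /le_trans H.
rewrite -subr_ge0 -sumrB; apply: H; apply: ler_sum => e _.
rewrite -!mulrBl /new_len.
have := shift_max (Q := P r g) (t := t) (x := x) (e := e) adm (xt e).
have /andP[x0 _] := xb e.
have s0 : 0 <= shift (P r g) t e by have /andP[] := shift_bounds (P r g) e t0.
rewrite /shift; case: (e \in P r g); case: (e \in P a b) => /= H;
  case: (e \in P r u); rewrite /= ?subr0 ?subrr ?sub0r ?mul1r ?mulN1r ?mul0r //.
all: by first [have {}H := H isT; lra | lra].
Qed.

Lemma reaches_mono r g t t' : 0 <= t -> t <= t' -> reaches r g t -> reaches r g t'.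
Proof.
move=> t0 tt'; apply: reaches_max; first exact: shift_admissible.
  by move=> e; apply: le_trans tt'; apply: shift_cost.
exact: le_trans tt'.
Qed.

(** * Intervals without breakpoints *)

Section Interval.
Variables (r g : V) (lo hi : R).
Hypotheses (lo_ge0 : 0 <= lo) (lohi : lo <= hi)
  (no_break : forall e, cost e * cap e <= lo \/ hi <= cost e * cap e).
Local Notation L t := (new_len (shift (P r g) t)).

(** Interpolation is stated without a quotient so that it includes [lo = hi]. *)
Lemma shift_affine Q t e : lo <= t -> t <= hi ->
  (hi - lo) * shift Q t e = (hi - t) * shift Q lo e + (t - lo) * shift Q hi e.
Proof.
move=> lt th; rewrite /shift; case: ifP => _; last by rewrite !mulr0 addr0.
have [H|H] := leP (cost e * cap e) lo.
  by rewrite (le_trans H lt) (le_trans H lohi); ring.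
have [/(lt_le_trans H)|Hh] := no_break e; first by rewrite ltxx.
have cp : cost e != 0.
  by apply: contraTneq H => ->; rewrite mul0r -leNgt.
(* The two branches agree at the breakpoint itself, so the linear formula remains valid up to and
   including [hi]. *)
have at_s s : s <= hi -> (if cost e * cap e <= s then cap e else s / cost e) = s / cost e.
  move=> sh; case: (leP (cost e * cap e) s) => // Hs; apply: (mulfI cp); rewrite mulrCA divff // mulr1.
  by apply/eqP; rewrite eq_le Hs (le_trans sh).
by rewrite !at_s //; field.
Qed.

Lemma dist_affine t u v : lo <= t -> t <= hi ->
  (hi - lo) * dist (L t) u v = (hi - t) * dist (L lo) u v + (t - lo) * dist (L hi) u v.
Proof.
move=> lt th.
have n0 s : lo <= s -> forall e, 0 <= L s e.
  by move=> ls; have [] := shift_admissible (P r g) (le_trans lo_ge0 ls).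
rewrite !(dist_sum valid_I); try exact: n0.
rewrite !mulr_sumr -big_split; apply: eq_bigr => e _ /=; rewrite /new_len.
case: (e \in P u v); last by rewrite !mul0r !mulr0 addr0.
by rewrite !mul1r; have := shift_affine (P r g) e lt th; case: ifP => _ H; lra.
Qed.

Definition slack t u := dist (L t) r g - dist (L t) r u.

(** The zero of the affine function through the slacks at [lo] and [hi], or [lo] if nothing is
    missing there. *)
Definition crossing u :=
  if slack lo u < 0 then lo + (hi - lo) * (- slack lo u) / (slack hi u - slack lo u)
  else lo.

Lemma reachesP t : reaches r g t <-> forall u, 0 <= slack t u.
Proof. by split=> H u; have := H u; rewrite /slack subr_ge0. Qed.

Lemma crossingP t u : 0 <= slack hi u -> lo <= t -> t <= hi ->
  (0 <= slack t u) = (crossing u <= t).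
Proof.
move=> h0 lt th.
have aff : (hi - lo) * slack t u = (hi - t) * slack lo u + (t - lo) * slack hi u.
  by rewrite /slack !mulrBr !dist_affine //; ring.
rewrite /crossing; have [l0|l0] := ltP (slack lo u) 0; last first.
  rewrite lt; have [E|lh] := eqVneq lo hi.
    by rewrite (_ : t = lo) //; apply/eqP; rewrite eq_le lt E th.
  have p : 0 < hi - lo by rewrite subr_gt0 lt_neqAle lh.
  by rewrite -(pmulr_rge0 _ p) aff addr_ge0 // mulr_ge0 // subr_ge0.
have lh : lo < hi.
  by rewrite lt_neqAle lohi andbT; apply: contraTneq l0 => ->; rewrite -leNgt.
have p : 0 < hi - lo by rewrite subr_gt0.
have q : 0 < slack hi u - slack lo u by lra.
rewrite -(pmulr_rge0 _ p) aff -lerBrDl ler_pdivrMr //.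
by apply/idP/idP => H; lra.
Qed.

Hypothesis reaches_hi : reaches r g hi.
Let slack_hi u : 0 <= slack hi u.
Proof. by have /reachesP := reaches_hi; apply. Qed.

Lemma crossing_bounds u : lo <= crossing u <= hi.
Proof.
rewrite -(crossingP (slack_hi u) lohi) // slack_hi andbT.
rewrite /crossing; case: ltP => // l0; rewrite lerDl divr_ge0 //.
  by rewrite mulr_ge0 ?subr_ge0 // oppr_ge0 ltW.
by have := slack_hi u; lra.
Qed.

Lemma reaches_crossing t : lo <= t -> t <= hi ->
  reaches r g t <-> forall u, crossing u <= t.
Proof.
move=> lt th; rewrite reachesP; split=> H u; have := H u; by rewrite crossingP.
Qed.

End Interval.
End Criterion.

(** * Rooting the tree by cutting off leaves *)

Local Notation IVar A := (IGet A (ICst 0)).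
Local Notation RVar A := (RGet A (ICst 0)).
Definition IEq e1 e2 := BAnd (ILe e1 e2) (ILe e2 e1).

Lemma beval_IEq (R : realFieldType) (s : store R) e1 e2 :
  beval s (IEq e1 e2) = (ieval s e1 == ieval s e2).
Proof. by rewrite /= eqn_leq. Qed.

Fixpoint PSeqs (ps : seq prog) : prog :=
  match ps with
  | [::] => PSkip
  | [:: p] => p
  | p :: ps => PSeq p (PSeqs ps)
  end.

Definition push (e : iexp) :=
  PSeq (PI ORD (IVar QT) e) (PI QT (ICst 0) (IAdd (IVar QT) (ICst 1))).

Definition is_free_leaf (e : iexp) :=
  BAnd (IEq (IGet DEG e) (ICst 1)) (BNot (IEq e (IVar ROOT))).

Definition p_clear : prog :=
  PFor CTR 0 (PSeqs [:: PI DEG (IVar CTR) (ICst 0);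
                        PI PAR (IVar CTR) (ICst 0);
                        PI PE (IVar CTR) (ICst 0)]).

Definition p_add_neighbour (u v : iexp) : prog :=
  PSeqs [:: PI DEG u (IAdd (IGet DEG u) (ICst 1));
            PI PAR u (IAdd (IGet PAR u) v);
            PI PE u (IAdd (IGet PE u) (IVar CTR))].

Definition p_neighbour_step : prog :=
  PSeq (p_add_neighbour (IGet SRC (IVar CTR)) (IGet DST (IVar CTR)))
       (p_add_neighbour (IGet DST (IVar CTR)) (IGet SRC (IVar CTR))).

Definition p_neighbours : prog := PFor CTR 1 p_neighbour_step.

Definition p_leaves : prog :=
  PSeq (PI QT (ICst 0) (ICst 0))
       (PFor CTR 0 (PIf (is_free_leaf (IVar CTR)) (push (IVar CTR)) PSkip)).

Definition p_detach : prog :=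
  PSeqs [:: PI TV (ICst 0) (IGet ORD (IVar CTR));
            PI TP (ICst 0) (IGet PAR (IVar TV));
            PI DEG (IVar TP) (ISub (IGet DEG (IVar TP)) (ICst 1));
            PI PAR (IVar TP) (ISub (IGet PAR (IVar TP)) (IVar TV));
            PI PE (IVar TP) (ISub (IGet PE (IVar TP)) (IGet PE (IVar TV)))].

Definition p_peel_step : prog :=
  PSeq p_detach (PIf (is_free_leaf (IVar TP)) (push (IVar TP)) PSkip).

(* A leaf knows its only neighbour and its only edge as the sums of the indices
   of its neighbours and of its edges. *)
Definition p_root : prog :=
  PSeqs [:: p_clear; p_neighbours; p_leaves; PFor CTR 2 p_peel_step].

Arguments run : simpl never.
Arguments beval : simpl never.

Lemma run_seq (R : realFieldType) p q (s : store R) :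
  run (PSeq p q) s = run q (run p s).
Proof. by []. Qed.

Lemma run_if (R : realFieldType) b p q (s : store R) :
  run (PIf b p q) s = if beval s b then run p s else run q s.
Proof. by []. Qed.

Lemma run_skip (R : realFieldType) (s : store R) : run PSkip s = s.
Proof. by []. Qed.

(** One write seen inside a single array. The effect of a short straight piece of program, written
    with [put], holds by conversion. *)
Definition put (T : Type) (f : nat -> T) (i : nat) (z : T) (j : nat) : T :=
  if j == i then z else f j.

Lemma putE (T : Type) (f : nat -> T) i z j :
  put f i z j = if j == i then z else f j.
Proof. by []. Qed.

Lemma sum_ltnS n (F : 'I_n -> nat) i (ltin : i < n) :
  \sum_(j : 'I_n | j < i.+1) F j = \sum_(j : 'I_n | j < i) F j + F (Ordinal ltin).
Proof.
rewrite (bigD1 (Ordinal ltin)) //= addnC; congr (_ + _); apply: eq_bigl => j.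
by rewrite ltnS ltn_neqAle andbC -val_eqE.
Qed.

Section Rooting.
Variables (R : realFieldType) (I : problem R).
Hypothesis valid_I : valid I.
Local Notation V := 'I_(nv I).
Local Notation E := 'I_(ne I).

(** Cell 4 of [CONST] exceeds the number of edges by one because the breakpoint 0 is sorted together
    with those of the edges. *)
Record std (s : store R) : Prop := Std {
  std_src : forall e : E, ints s 1 e = src e;
  std_dst : forall e : E, ints s 2 e = dst e;
  std_nv : ints s 4 0 = nv I;
  std_ne : ints s 4 1 = ne I;
  std_pred : ints s 4 2 = (nv I).-1;
  std_log : nv I <= 2 ^ ints s 4 3;
  std_breaks : ints s 4 4 = (ne I).+1;
  std_weight : forall v : V, nums s 0 v = weight v;
  std_len : forall e : E, nums s 1 e = len e;
  std_bound : forall e : E, nums s 2 e = bound e;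
  std_cost : forall e : E, nums s 3 e = cost e }.

Lemma std_eq (s s' : store R) :
  (forall B j, B \in [:: 1; 2; 4] -> ints s' B j = ints s B j) ->
  (forall B j, B \in [:: 0; 1; 2; 3] -> nums s' B j = nums s B j) ->
  std s -> std s'.
Proof. by move=> Hi Hn []; split=> *; rewrite ?Hi ?Hn. Qed.

Variables (r : V) (T : rooted r).

Definition child (c v : V) := (c != r) && (par T c == v).

(* The neighbours of [v] that are still there once [K] has been cut off are its
   parent and its children outside [K]. *)
Definition around (K : seq V) (F : V -> E -> nat) v :=
  \sum_(c | child c v && (c \notin K)) F c (pe T c) + (v != r) * F (par T v) (pe T v).

Definition neighbour_sums (K : seq V) (s : store R) := forall v : V,
  [/\ ints s DEG v = around K (fun _ _ => 1) v,
      ints s PAR v = around K (fun u _ => u) v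
    & ints s PE v = around K (fun _ e => e) v].

Lemma pe_image : [set: E] = pe T @: [set c | c != r].
Proof.
apply/setP => e; rewrite inE; apply/esym/imsetP.
by have [c cr <-] := pe_surj T e; exists c; rewrite // inE.
Qed.

Lemma ne_lt_nv : ne I < nv I.
Proof.
have := leq_imset_card (pe T) [set c | c != r].
rewrite -pe_image cardsT card_ord => /leq_ltn_trans; apply.
have := cardsC1 r; rewrite card_ord.
have -> : [set~ r] = [set c | c != r] by apply/setP => c; rewrite !inE.
by move=> ->; rewrite prednK // (leq_ltn_trans (leq0n r)).
Qed.

(** Indexed by its lower end [c], an edge contributes [c] to the sums at the parent, and the parent
    to the sums at [c]. *)
Lemma around_edges (F : V -> E -> nat) v :
  \sum_e ((src e == v) * F (dst e) e + (dst e == v) * F (src e) e) = around [::] F v.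
Proof.
rewrite (eq_bigl (mem [set: E])); last by move=> e; rewrite !inE.
rewrite pe_image big_imset /=; last first.
  by move=> c d; rewrite !inE; apply: pe_inj.
have H c : c \in [set c | c != r] ->
   (src (pe T c) == v) * F (dst (pe T c)) (pe T c) +
   (dst (pe T c) == v) * F (src (pe T c)) (pe T c) =
   (c == v) * F (par T c) (pe T c) + (par T c == v) * F c (pe T c).
  by rewrite inE => cr; case/orP: (pe_ends T cr) => /eqP[-> ->] //; rewrite addnC.
rewrite (eq_bigr _ H) big_split /= /around addnC; congr (_ + _).
  rewrite [RHS](eq_bigl (fun c => (c \in [set c | c != r]) && (par T c == v))).
    by rewrite big_mkcondr; apply: eq_bigr => c _; case: ifP; rewrite ?mul1n ?mul0n.
  by move=> c; rewrite /child !inE andbT.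
have [->|vr] := eqVneq v r.
  by rewrite big1 // => c; rewrite inE => /negbTE->.
rewrite (bigD1 v) ?inE //= eqxx !mul1n big1 ?addn0 // => c /andP[_ /negbTE->].
by rewrite mul0n.
Qed.

Lemma run_neighbours s : std s -> neighbour_sums [::] (run (PSeq p_clear p_neighbours) s).
Proof.
move=> Hs; rewrite run_seq.
set s1 := run p_clear s.
have Hs1 : std s1.
  by apply: std_eq Hs => B j; rewrite !inE => HB; rewrite ?ints_run ?nums_run //;
    case/or3P: HB => /eqP->.
have Z : forall v : V, [/\ ints s1 DEG v = 0, ints s1 PAR v = 0 & ints s1 PE v = 0].
  have : forall v : V, v < ints s 4 0 -> [/\ ints s1 DEG v = 0, ints s1 PAR v = 0 & ints s1 PE v = 0].
    apply: (run_for (Inv := fun i s => forall v : V, v < i ->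
      [/\ ints s DEG v = 0, ints s PAR v = 0 & ints s PE v = 0])) => //.
    move=> i s' s2 Hi Ei _ _ Inv E v; rewrite ltnS leq_eqVlt => Hv.
    have E1 : ints s2 DEG v = put (ints s' DEG) (ints s' CTR 0) 0 v by rewrite E.
    have E2 : ints s2 PAR v = put (ints s' PAR) (ints s' CTR 0) 0 v by rewrite E.
    have E3 : ints s2 PE v = put (ints s' PE) (ints s' CTR 0) 0 v by rewrite E.
    rewrite /= /upd /= E1 E2 E3 Ei !putE.
    by case: eqP Hv => //= _ Hv; apply: Inv.
  by move=> H v; apply: H; rewrite (std_nv Hs).
pose part i F (v : V) := \sum_(e : E | e < i)
  ((src e == v) * F (dst e) e + (dst e == v) * F (src e) e).
pose Inv i (s : store R) := forall v : V,
    [/\ ints s DEG v = part i (fun _ _ => 1) v,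
      ints s PAR v = part i (fun u _ => u) v
    & ints s PE v = part i (fun _ e => e) v].
have partE F v : part (ne I) F v = around [::] F v.
  by rewrite -around_edges; apply: eq_bigl => e; rewrite ltn_ord.
have H : Inv (ints s1 4 1) (run p_neighbours s1).
  apply: (run_for (Inv := Inv)) => //.
    by move=> v; have [] := Z v; split; rewrite /part big_pred0.
  move=> i s' s2 Hi Ei F1 F2 IH E v.
  rewrite (std_ne Hs1) in Hi.
  rewrite /part !(sum_ltnS _ Hi) /=.
  have Es : ints s' SRC i = src (Ordinal Hi) by rewrite F1 // (std_src Hs1 (Ordinal Hi)).
  have Ed : ints s' DST i = dst (Ordinal Hi) by rewrite F1 // (std_dst Hs1 (Ordinal Hi)).
  have [[loopless _ _ _] _ _ _] := valid_I.
  have xy := loopless (Ordinal Hi).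
  pose add A z := let f := put (ints s' A) (ints s' SRC (ints s' CTR 0))
     (ints s' A (ints s' SRC (ints s' CTR 0)) + z (ints s' DST (ints s' CTR 0))) in
     put f (ints s' DST (ints s' CTR 0))
      (f (ints s' DST (ints s' CTR 0)) + z (ints s' SRC (ints s' CTR 0))) v.
  have E1 : ints s2 DEG v = add DEG (fun _ => 1) by rewrite E.
  have E2 : ints s2 PAR v = add PAR (fun u => u) by rewrite E.
  have E3 : ints s2 PE v = add PE (fun _ => ints s' CTR 0) by rewrite E.
  rewrite /= /upd /= E1 E2 E3 /add Ei Es Ed !putE /= {E E1 E2 E3}.
  move: (src (Ordinal Hi)) (dst (Ordinal Hi)) xy => x y.
  have [I1 I2 I3] := IH v.
  have [I4 I5 I6] := IH x; have [I7 I8 I9] := IH y.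
  rewrite !(inj_eq val_inj) ![_ == v]eq_sym [y == x]eq_sym => xy.
  case: (v =P y) xy => [<-|_] => [/negbTE|_].
    by rewrite eq_sym I1 I2 I3 => ->; rewrite /= !mul0n !mul1n !add0n.
  case: (v =P x) => [<-|_].
    by rewrite I1 I2 I3 /= !mul0n !mul1n !addn0.
  by rewrite I1 I2 I3 !mul0n !addn0.
by move: H; rewrite (std_ne Hs1) => H v; have [-> -> ->] := H v; rewrite !partE.
Qed.

Lemma beval_free_leaf (s : store R) e :
  beval s (is_free_leaf e) =
  (ints s DEG (ieval s e) == 1) && (ieval s e != ints s ROOT 0).
Proof.
by rewrite -[LHS]/(beval s (IEq _ _) && ~~ beval s (IEq _ _)) !beval_IEq.
Qed.

Lemma around_eq1 K v : v != r ->
  (around K (fun _ _ => 1) v == 1) = [forall c, child c v ==> (c \in K)].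
Proof.
move=> vr; rewrite /around vr mul1n addn1 eqSS sum_nat_eq0.
by apply: eq_forallb => c; rewrite eqn0Ngt implybF negb_and negbK implybE.
Qed.

(* The first [k] vertices of the queue [os] have been cut off. *)
Definition peeling k (s : store R) (os : seq V) :=
  [/\ [/\ uniq os, size os = ints s QT 0 & k <= size os],
      forall i, i < size os -> ints s ORD i = nth r os i,
      forall v, (v \in os) = (v != r) && [forall c, child c v ==> (c \in take k os)],
      neighbour_sums (take k os) s
    & forall v c, v \in take k os -> child c v -> index c os < index v os].

Lemma run_push (s : store R) (os : seq V) e (v : V) :
  ieval s e = v -> size os = ints s QT 0 ->
  (forall i, i < size os -> ints s ORD i = nth r os i) ->
  size (rcons os v) = ints (run (push e) s) QT 0 /\
  (forall i, i < size (rcons os v) -> ints (run (push e) s) ORD i = nth r (rcons os v) i).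
Proof.
move=> Ev Sz Ho.
have E1 i : ints (run (push e) s) ORD i = put (ints s ORD) (ints s QT 0) (ieval s e) i by [].
have E2 : ints (run (push e) s) QT 0 = ints s QT 0 + 1 by [].
split=> [|i]; first by rewrite size_rcons E2 addn1 Sz.
rewrite size_rcons ltnS leq_eqVlt nth_rcons E1 putE -Sz Ev.
by case: eqP => [->|_ /= Hi]; rewrite ?ltnn // Hi Ho.
Qed.

Lemma run_leaves s : std s -> ints s ROOT 0 = r -> neighbour_sums [::] s ->
  exists os, peeling 0 (run p_leaves s) os.
Proof.
move=> Hs Hr Hn.
rewrite /p_leaves run_seq.
set p := PFor _ _ _; set s1 := run (PI _ _ _) s.
pose Inv i (s' : store R) := exists os : seq V,
  [/\ uniq os, size os = ints s' QT 0,
      forall i, i < size os -> ints s' ORD i = nth r os i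
    & forall v : V, (v \in os) = [&& v < i, v != r & ints s DEG v == 1]].
have [] : Inv (ints s1 4 0) (run p s1).
  apply: (run_for (Inv := Inv)) => //.
    by exists [::]; split.
  move=> i s' s2 + Ei F1 F2 [os [Uos Sos Hos Mos]].
  rewrite [ints s1 4 0](std_nv Hs) => Hi.
  rewrite run_if run_skip beval_free_leaf [ieval _ _]Ei !F1 //.
  rewrite [ints s1 11 0]Hr [ints s1 5 i]/(ints s 5 i) => E.
  case: ifP E => [/andP[Hd ir]|Hd] ->.
    have [|] := @run_push s' os (IVar CTR) (Ordinal Hi) _ Sos Hos; first exact: Ei.
    rewrite -[ints (seti _ _ _ _) QT 0]/(ints (run (push (IVar CTR)) s') QT 0).
    move=> H1 H2; exists (rcons os (Ordinal Hi)); split=> //.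
      by rewrite rcons_uniq Uos Mos ltnn.
    move=> v; rewrite mem_rcons inE Mos ltnS [v <= i]leq_eqVlt -val_eqE /=.
    by case: (nat_of_ord v =P i) => // Ev; rewrite -val_eqE /= Ev ir Hd.
  exists os; split=> // v; rewrite Mos ltnS [v <= i]leq_eqVlt.
  case: (nat_of_ord v =P i) => //= Ev; rewrite Ev ltnn /=.
  by rewrite -val_eqE /= Ev andbC Hd.
move=> os [Uos Sos Hos Mos]; exists os.
split=> //.
- move=> v; rewrite take0 Mos [ints s1 4 0](std_nv Hs) ltn_ord /=.
  case: eqP => //= /eqP vr; have [-> _ _] := Hn v.
  exact: around_eq1.
- by rewrite take0 => v; rewrite !ints_run.
- by move=> v c; rewrite take0.
Qed.

Lemma around_cons v K F : v != r -> v \notin K ->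
  forall u, around K F u = around (v :: K) F u + (par T v == u) * F v (pe T v).
Proof.
move=> vr vK u; rewrite /around addnAC; congr (_ + _).
have [Ep|Ep] := eqVneq; last first.
  rewrite mul0n addn0; apply: eq_bigl => c; rewrite inE negb_or.
  by case: eqP => [->|//]; rewrite /child (negbTE Ep) andbF.
rewrite (bigD1 v) /=; last by rewrite /child vr Ep eqxx.
rewrite mul1n addnC; congr (_ + _); apply: eq_bigl => c.
by rewrite inE negb_or; case: eqP; rewrite /= ?andbF ?andbT.
Qed.

Lemma eq_around K K' F u : K =i K' -> around K F u = around K' F u.
Proof.
by move=> H; congr (_ + _); apply: eq_bigl => c; rewrite H.
Qed.

(** The queue does not run empty early: a vertex of largest rank among the non-root vertices not yet
    cut off has no child left, so it is in the queue. *)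
Lemma peeling_next k s os : peeling k s os -> k < (nv I).-1 -> k < size os.
Proof.
move=> [[Uos _ _] _ Mos _ _] Hk.
have [v vr vk] : exists2 v, v != r & v \notin take k os.
  apply/exists_inP; apply: contraLR Hk => /exists_inPn H.
  have : #|[set~ r]| <= size (take k os).
    rewrite -(card_uniqP (take_uniq k Uos)); apply: subset_leq_card.
    apply/subsetP => v; rewrite !inE => vr; have := H v vr.
    by rewrite negbK.
  rewrite cardsC1 card_ord => /leq_trans H'.
  by rewrite -leqNgt; apply: H'; rewrite size_take; case: ltnP => // /ltnW.
pose A := [pred u | (u != r) && (u \notin take k os)].
have Av : A v by rewrite /A /= vr vk.
case: (@arg_maxnP _ v A (rank T) Av) => u /andP[ur uk] max.
have uos : u \in os.
  rewrite Mos ur; apply/forallP => c; apply/implyP => /andP[cr /eqP Ec].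
  apply: contraT => ck; have := max c; rewrite /= cr ck => /(_ isT).
  by rewrite -Ec leqNgt rank_par.
rewrite ltnNge; apply: contra uk => /take_oversize ->.
by [].
Qed.

(** Cutting off [v] changes the neighbourhood sums of its parent alone, so only the parent can
    become a new leaf. *)
Lemma run_peel_step k s os : ints s ROOT 0 = r -> ints s CTR 0 = k ->
  k < (nv I).-1 -> peeling k s os ->
  exists os', peeling k.+1 (run p_peel_step s) os'.
Proof.
move=> Hr Hc Hk Hp; have ks := peeling_next Hp Hk.
case: Hp => -[Uos Sos _] Hos Mos Sum Ord.
pose v := nth r os k; pose p := par T v.
have vos : v \in os by rewrite mem_nth.
have := vos; rewrite Mos => /andP[vr /forallP vch].
have vk : v \notin take k os.
  by rewrite in_take // index_uniq // ltnn.
have Ek : take k.+1 os =i v :: take k os.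
  by move=> u; rewrite (take_nth r ks) mem_rcons.
rewrite /p_peel_step run_seq run_if run_skip.
set s1 := run p_detach s.
have [Dv Pv Ev] := Sum v.
(* All children of [v] are gone, so its sums have a single term, which comes from the parent. *)
have v0 F : around (take k os) F v = F p (pe T v).
  rewrite /around vr mul1n big1 // => c /andP[cv cK].
  by have := vch c; rewrite cv (negbTE cK).
move: Dv Pv Ev; rewrite !v0 => Dv Pv Ev.
pose sub A z (j : nat) := put (ints s A) (ints s PAR (ints s ORD (ints s CTR 0)))
  (ints s A (ints s PAR (ints s ORD (ints s CTR 0))) - z (ints s ORD (ints s CTR 0))) j.
have E1 j : ints s1 DEG j = sub DEG (fun _ => 1) j by [].
have E2 j : ints s1 PAR j = sub PAR id j by [].
have E3 j : ints s1 PE j = sub PE (ints s PE) j by [].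
have E4 : ints s1 TP 0 = ints s PAR (ints s ORD (ints s CTR 0)) by [].
have E5 : ints s1 ROOT 0 = r by rewrite ints_run.
have E6 : ints s1 QT 0 = size os by rewrite ints_run.
have E7 i : i < size os -> ints s1 ORD i = nth r os i by rewrite ints_run //; exact: Hos.
move: s1 E1 E2 E3 E4 E5 E6 E7 => s1; rewrite /sub Hc Hos // -/v Pv -/p.
move=> E1 E2 E3 E4 E5 E6 E7.
have Sum1 : neighbour_sums (take k.+1 os) s1.
  move=> u; have [S1 S2 S3] := Sum u.
  rewrite !(eq_around _ _ Ek) E1 E2 E3 !putE !(val_eqE u p).
  move: S1 S2 S3; rewrite !(around_cons _ vr vk u) -/p [p == u]eq_sym.
  case: eqP => [->|_]; last by rewrite !mul0n !addn0.
  (* The truncated subtraction is exact because the term of [v] is one of the summands. *)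
  by move=> -> -> ->; rewrite !mul1n Ev !addnK.
have pv u : child v u -> u = p by case/andP=> _ /eqP.
have Mos1 u : u != p -> (u \in os) = (u != r) && [forall c, child c u ==> (c \in take k.+1 os)].
  move=> up; rewrite Mos; congr (_ && _); apply: eq_forallb => c; rewrite Ek inE.
  case: eqP => [->|//]; case/boolP: (child v u) => // /pv Eu.
  by rewrite Eu eqxx in up.
have Ord1 u c : u \in take k.+1 os -> child c u -> index c os < index u os.
  rewrite Ek inE => /orP[/eqP->|]; last exact: Ord.
  move=> cv; have ck : c \in take k os by have := vch c; rewrite cv.
  by move: (ck); rewrite in_take ?(mem_take ck) // [index v os]index_uniq.
have pos : p \notin os.
  rewrite Mos negb_and; apply/orP; right; apply/forallPn; exists v.
  by rewrite /child vr eqxx (negbTE vk).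
have D1 := Sum1 p; case: D1 => D1 _ _.
rewrite beval_free_leaf [ieval _ _]E4 E5 D1.
case: ifP => [/andP[free pr]|notfree].
  have {}pr : p != r by [].
  have [||H1 H2] := @run_push s1 os (IVar TP) p E4 _ _; [by rewrite E6|exact: E7|].
  exists (rcons os p).
  have Et : take k.+1 (rcons os p) = take k.+1 os.
    by rewrite -cats1 takel_cat.
  split=> //.
  - split=> //; first by rewrite rcons_uniq pos.
    by rewrite size_rcons; apply: leqW.
  - move=> u; rewrite Et mem_rcons inE; have [->|up] := eqVneq; last exact: Mos1.
    by rewrite pr /= -around_eq1.
  - by rewrite Et => u; rewrite !ints_run.
  - move=> u c; rewrite Et => uk cu; have := Ord1 u c uk cu.
    have uos : u \in os by apply: mem_take uk.
    rewrite -cats1 !index_cat uos => H; case: ifP => // /negP; case.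
    by rewrite -index_mem (ltn_trans H) // index_mem.
exists os; split=> //.
move=> u; have [->|] := eqVneq u p; last exact: Mos1.
rewrite (negbTE pos); apply/esym/negbTE/negP => /andP[pr fr].
by rewrite around_eq1 // fr in notfree; rewrite pr in notfree.
Qed.

Definition rooted_store (s : store R) (os : seq V) :=
  [/\ uniq os, size os = (nv I).-1 /\ (forall v, (v \in os) = (v != r)),
      forall v c, v != r -> c != r -> par T c = v -> index c os < index v os,
      forall i, i < size os -> ints s ORD i = nth r os i
    & forall v, v != r -> ints s PAR v = par T v /\ ints s PE v = pe T v].

Lemma run_root s : std s -> ints s ROOT 0 = r ->
  exists os, rooted_store (run p_root s) os.
Proof.
move=> Hs Hr.
rewrite -[run _ s]/(run (PSeqs [:: PSeq p_clear p_neighbours; p_leaves;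
  PFor CTR 2 p_peel_step]) s) !run_seq -[run _ (run p_clear s)]run_seq.
have Hn := run_neighbours Hs.
set s1 := run (PSeq _ _) s in Hn *.
have Hs1 : std s1.
  by apply: std_eq Hs => B j; rewrite !inE => HB; rewrite ?ints_run ?nums_run //;
    case/or3P: HB => /eqP->.
have Hr1 : ints s1 ROOT 0 = r by rewrite ints_run.
have H0 := run_leaves Hs1 Hr1 Hn.
set s2 := run p_leaves s1 in H0 *.
have E4 : ints s2 4 2 = (nv I).-1 by rewrite ints_run // (std_pred Hs1).
have [os Hp] : exists os, peeling (ints s2 4 2) (run (PFor CTR 2 p_peel_step) s2) os.
  apply: (run_for (Inv := fun k s => exists os, peeling k s os)) => //.
  move=> k s' s3 Hk Ek F1 F2 [os Hos] E.
  have [||os' Hos'] := run_peel_step _ Ek _ Hos.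
  - by rewrite F1 // ints_run.
  - by rewrite -E4.
  by exists os'; rewrite E.
rewrite {}E4 in Hp; case: Hp => -[Uos Sos ks] Hos Mos Sum Ord.
(* The queue now has at least n - 1 distinct non-root vertices, which must be all of them. *)
have sub : {subset os <= enum [pred v | v != r]}.
  by move=> v; rewrite Mos mem_enum inE => /andP[].
have Se : size (enum [pred v | v != r]) = (nv I).-1.
  have := cardsC1 r; rewrite card_ord -cardE => <-.
  by apply: eq_card => v; rewrite !inE.
have Eos : os =i enum [pred v | v != r].
  by have [] := uniq_min_size Uos sub; rewrite Se.
have {}Eos v : (v \in os) = (v != r) by rewrite Eos mem_enum.
have So : size os = (nv I).-1.
  apply/eqP; rewrite eqn_leq ks andbT -Se; exact: uniq_leq_size.
rewrite -So take_size in Sum Ord Mos.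
exists os; split=> //.
- by move=> v c vr cr Ec; apply: Ord; rewrite ?Eos // /child cr Ec eqxx.
- move=> v vr; have [_ -> ->] := Sum v.
  have a0 F : around os F v = F (par T v) (pe T v).
    by rewrite /around vr mul1n big1 // => c; rewrite /child Eos; case: (c != r); rewrite ?andbF.
  by rewrite !a0.
Qed.

End Rooting.

(** * Subtree sums, paths and lowest common ancestors *)

Definition p_up (A : nat) : prog :=
  PFor CTR 2 (PI A (IGet PAR (IGet ORD (IVar CTR)))
    (IAdd (IGet A (IGet PAR (IGet ORD (IVar CTR)))) (IGet A (IGet ORD (IVar CTR))))).

Definition p_path : prog :=
  PSeqs [:: PFor CTR 0 (PI ONP (IVar CTR) (ICst 0));
            PI ONP (IVar GOAL) (ICst 1);
            p_up ONP].

Definition p_count : prog :=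
  PSeq (PFor CTR 0 (PIf (RLe (RGet WEIGHT (IVar CTR)) (RCst 0))
                        (PI CNT (IVar CTR) (ICst 0)) (PI CNT (IVar CTR) (ICst 1))))
       (p_up CNT).

Definition ord_rev : iexp :=
  IGet ORD (ISub (ISub (IGet CONST (ICst 2)) (ICst 1)) (IVar CTR)).

Definition p_gate_step : prog :=
  PIf (IEq (IGet CNT ord_rev) (IGet CNT (IVar ROOT))) (PI GATE (ICst 0) ord_rev) PSkip.

(* In the reverse order, parents come first, so the last vertex with all positive
   weights below it is their lowest common ancestor. *)
Definition p_gate : prog :=
  PSeqs [:: p_count; PI GATE (ICst 0) (IVar ROOT); PFor CTR 2 p_gate_step].

Definition keeps (li lr : seq nat) p :=
  all (fun A => A \notin iwrites p) li && all (fun A => A \notin rwrites p) lr.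

Section Subtree.
Variables (R : realFieldType) (I : problem R).
Hypothesis valid_I : valid I.
Local Notation V := 'I_(nv I).
Local Notation E := 'I_(ne I).

Lemma std_run p (s : store R) : keeps [:: 1; 2; 4] [:: 0; 1; 2; 3] p ->
  std I s -> std I (run p s).
Proof.
case/andP=> /allP Hi /allP Hr; apply: std_eq => B j HB.
  by rewrite ints_run ?Hi.
by rewrite nums_run ?Hr.
Qed.

Variables (r : V) (T : rooted r).

Lemma rooted_eq (s s' : store R) os :
  (forall B j, B \in [:: PAR; PE; ORD] -> ints s' B j = ints s B j) ->
  rooted_store T s os -> rooted_store T s' os.
Proof.
by move=> H [? ? ? Ho Hp]; split=> // [i /Ho|v /Hp]; rewrite !H.
Qed.

Lemma rooted_run p (s : store R) os : keeps [:: PAR; PE; ORD] [::] p ->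
  rooted_store T s os -> rooted_store T (run p s) os.
Proof.
by case/andP=> /allP Hi _; apply: rooted_eq => B j HB; rewrite ints_run ?Hi.
Qed.

Definition below (f : V -> nat) v := \sum_(u | anc T v u) f u.

(** As an equation of numbers this says at once that a vertex strictly below [x] is below some child
    of [x] and below only one. *)
Lemma anc_child x v :
  (anc T x v : nat) = (v == x) + \sum_(c | child T c x) anc T c v.
Proof.
elim: {v}(rank T v) {-2}v (leqnn (rank T v)) => [|m IHm] v Hv.
  have [->|vr] := eqVneq v r; last first.
    by have := rank_par T vr; move: Hv; rewrite leqn0 => /eqP ->.
  rewrite anc_root big1 ?addn0 1?eq_sym // => c /andP[cr _].
  by rewrite anc_root (negbTE cr).
have [->|vr] := eqVneq v r.
  rewrite anc_root big1 ?addn0 1?eq_sym // => c /andP[cr _].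
  by rewrite anc_root (negbTE cr).
have Hpv : rank T (par T v) <= m.
  by rewrite -ltnS; apply: leq_trans (rank_par T vr) Hv.
have [->|vx] := eqVneq v x.
  rewrite ancxx big1 ?addn0 // => c /andP[cr /eqP Ec].
  apply/eqP; rewrite eqb0; apply/negP => /anc_rank.
  by rewrite -Ec leqNgt rank_par.
rewrite add0n anc_par eq_sym (negbTE vx) /= IHm //.
have H c : child T c x -> (anc T c v : nat) = (c == v) + anc T c (par T v).
  move=> _; rewrite [anc T c v]anc_par; case: eqP => [->|//].
  by rewrite anc_parF.
rewrite (eq_bigr _ H) big_split /=; congr (_ + _).
have [Ep|Ep] := eqVneq.
  rewrite (bigD1 v) /= ?eqxx; last by rewrite /child vr Ep eqxx.
  by rewrite big1 // => c /andP[_ /negbTE->].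
rewrite big1 // => c /andP[_ /eqP Ec]; apply/eqP; rewrite eqb0.
by apply: contraNneq Ep => <-; rewrite Ec.
Qed.

Lemma below_child f x : below f x = f x + \sum_(c | child T c x) below f c.
Proof.
have E v : below f v = \sum_u anc T v u * f u.
  by rewrite /below big_mkcond; apply: eq_bigr => u _; case: ifP; rewrite ?mul1n.
rewrite (eq_bigr _ (fun c _ => E c)) E exchange_big /=.
rewrite [X in X + _](_ : _ = \sum_u (u == x) * f u); last first.
  by rewrite (bigD1 x) //= eqxx mul1n big1 ?addn0 // => u /negbTE->.
rewrite -big_split; apply: eq_bigr => u _ /=.
by rewrite -big_distrl /= -mulnDl -anc_child.
Qed.

Lemma run_up A (s : store R) os f : std I s -> rooted_store T s os ->
  A \notin [:: 4; PAR; ORD; CTR] ->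
  (forall v : V, ints s A v = f v) ->
  forall v : V, ints (run (p_up A) s) A v = below f v.
Proof.
move=> Hs [Uos [Sos Mos] Ord Hos Hpar] HA Hf.
have [A4 A6 A8 A9] : [/\ A != 4, A != PAR, A != ORD & A != CTR].
  by move: HA; rewrite !inE !negb_or => /and4P[].
pose Inv k (s' : store R) := forall v : V,
  ints s' A v = f v + \sum_(c | child T c v && (c \in take k os)) below f c.
have H : Inv (ints s 4 2) (run (p_up A) s).
  apply: (run_for (Inv := Inv)).
  - by rewrite /= !inE eq_sym A9 eq_sym A4.
  - move=> v; rewrite take0 big_pred0 ?addn0; last by move=> c; rewrite andbF.
    by rewrite /= /upd (negbTE A9) Hf.
  move=> k s' s1; rewrite (std_pred Hs) -Sos => Hk Ek F1 _ IH E v.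
  pose x := nth r os k; pose p := par T x.
  have xr : x != r by rewrite -Mos mem_nth.
  have FA B j : B != CTR -> A != B -> ints s' B j = ints s B j.
    by move=> B9 BA; apply: F1; rewrite !inE negb_or B9 eq_sym.
  have Eo : ints s' ORD (ints s' CTR 0) = x by rewrite Ek FA ?Hos.
  have Ep : ints s' PAR x = p.
    by have [<- _] := Hpar x xr; rewrite FA.
  have E1 : ints s1 A v = put (ints s' A) p (ints s' A p + ints s' A x) v.
    by rewrite E /run /= Eo Ep /upd eqxx.
  rewrite /= /upd (negbTE A9) /= E1 putE (val_eqE v p) !IH (take_nth r Hk) -/x.
  (* Children precede [x] in the order, so the value of [x] is complete when it is passed on. *)
  have xx : below f x = f x + \sum_(c | child T c x && (c \in take k os)) below f c.
    rewrite below_child; congr (_ + _); apply: eq_bigl => c.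
    case/boolP: (child T c x) => //= /andP[cr /eqP Ec].
    have := Ord _ _ xr cr Ec; rewrite index_uniq // => Hc.
    by rewrite in_take // -index_mem (ltn_trans Hc).
  have xk : x \notin take k os by rewrite in_take ?mem_nth // index_uniq // ltnn.
  case: eqP => [->|/eqP vp]; last first.
    congr (_ + _); apply: eq_bigl => c; rewrite mem_rcons inE.
    by case: eqP => [->|//]; rewrite /child -/p [p == v]eq_sym (negbTE vp) !andbF.
  rewrite -xx -addnA; congr (_ + _).
  rewrite [RHS](bigD1 x) /=; last by rewrite /child mem_rcons inE eqxx xr -/p eqxx.
  rewrite addnC; congr (_ + _); apply: eq_bigl => c.
  rewrite mem_rcons inE; case: eqP => [->|_]; last by rewrite andbT.
  by rewrite (negbTE xk) !andbF.
move=> v; rewrite H below_child (std_pred Hs) -Sos take_size; congr (_ + _).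
by apply: eq_bigl => c; rewrite Mos /child; case: (c != r); rewrite ?andbF ?andbT.
Qed.

Lemma mem_P_root c g : c != r -> (pe T c \in P r g) = anc T c g.
Proof. by move=> cr; rewrite mem_P // anc_root (negbTE cr). Qed.

(** The subtree sum at [v] of the indicator of [g] is 1 iff [v] is an ancestor of [g], that is, iff
    the parent edge of [v] separates [g] from the root. *)
Lemma run_path (s : store R) os (g : V) : std I s -> rooted_store T s os ->
  ints s GOAL 0 = g ->
  forall v, v != r -> ints (run p_path s) ONP v = (pe T v \in P r g).
Proof.
move=> Hs Hos Hg v vr; rewrite mem_P_root // /p_path !run_seq.
set s1 := run (PFor _ _ _) s; set s2 := run (PI _ _ _) s1.
have Z : forall u : V, ints s1 ONP u = 0.
  have : forall u : V, u < ints s 4 0 -> ints s1 ONP u = 0.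
    apply: (run_for (Inv := fun i s => forall u : V, u < i -> ints s ONP u = 0)) => //.
    move=> i s' s3 Hi Ei F1 F2 IH E u; rewrite ltnS leq_eqVlt.
    have E1 : ints s3 ONP u = put (ints s' ONP) i 0 u by rewrite E -Ei.
    by rewrite /= /upd /= E1 putE; case: eqP => //= _ Hu; apply: IH.
  by move=> H u; apply: H; rewrite (std_nv Hs).
have E2 u : ints s2 ONP u = put (ints s1 ONP) (ints s1 GOAL 0) 1 u by [].
have Hs2 : std I s2 by do 2!apply: std_run => //.
have Hos2 : rooted_store T s2 os by do 2!apply: rooted_run => //.
rewrite (run_up (f := fun u => (u == g : nat)) Hs2 Hos2) //.
  rewrite /below big_mkcond (bigD1 g) //= eqxx big1 ?addn0; first by case: ifP.
  by move=> u /negbTE->; case: ifP.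
move=> u; rewrite E2 putE ints_run // Hg (val_eqE u g) Z.
by case: eqP.
Qed.

Definition all_below c := [forall v : V, (0 < weight v)%R ==> anc T c v].

(** The counts at [v] and at the root differ by the number of vertices of positive weight that are
    not below [v]. *)
Lemma run_count (s : store R) os : std I s -> rooted_store T s os ->
  forall v : V, (ints (run p_count s) CNT v == ints (run p_count s) CNT r) = all_below v.
Proof.
move=> Hs Hos v; rewrite /p_count run_seq.
pose f (u : V) := (0 < weight u)%R : nat.
set p := PFor _ _ _; set s1 := run p s.
have Hf (u : V) : ints s1 CNT u = f u.
  have H : forall u : V, u < ints s 4 0 -> ints s1 CNT u = f u.
    apply: (run_for (Inv := fun i s => forall u : V, u < i -> ints s CNT u = f u)) => //.
    move=> i s' s3 Hi Ei F1 F2 IH E {}u; rewrite ltnS leq_eqVlt.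
    have E1 : ints s3 CNT u =
      (if (nums s' 0 i <= 0)%R then put (ints s' CNT) i 0 u else put (ints s' CNT) i 1 u).
      by rewrite E run_if -[beval _ _]/(nums s' 0 (ints s' CTR 0) <= 0)%R Ei; case: ifP; rewrite -Ei.
    rewrite /= /upd /= {}E1 !putE; case: eqP => [<- _|_ /= /IH->]; last by case: ifP.
    by rewrite F2 // (std_weight Hs) /f ltNge; case: ifP.
  by apply: H; rewrite (std_nv Hs).
have Hs1 : std I s1 by apply: std_run.
have Hos1 : rooted_store T s1 os by apply: rooted_run.
rewrite !(run_up Hs1 Hos1 _ Hf) // /below.
rewrite [X in _ == X](eq_bigl xpredT); last by move=> u; rewrite anc_r.
rewrite [X in _ == X](bigID (anc T v)) /= -[X in X == _]addn0 eqn_add2l eq_sym sum_nat_eq0.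
apply: eq_forallb => u; rewrite /f eqb0.
by case: (anc T v u); rewrite /= ?implybT ?implybF.
Qed.

(** All weighted vertices are below [x], so their paths to the root pass through it. A vertex [u]
    outside the subtree of [x] is reached through [x] from any of them; for [u] below a child [c] of
    [x], a weighted vertex not below [c] does. *)
Lemma gate_of_below x : all_below x ->
  (forall c, child T c x -> ~~ all_below c) -> (exists v : V, 0 < weight v)%R ->
  gate x r.
Proof.
move=> /forallP Hx Hc [v0 wv0].
have {}Hx v : (0 < weight v)%R -> anc T x v by move=> wv; have := Hx v; rewrite wv.
split=> [v wv|u].
  apply/pred0P => e; have [c cr <-] := pe_surj T e.
  rewrite /= !mem_P // anc_root (negbTE cr) addbF.
  case cx : (anc T c x); rewrite ?andbF // addbT andbT.
  by rewrite (anc_trans cx (Hx v wv)).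
have dis v : (0 < weight v)%R ->
    (forall d, d != r -> ~~ anc T d x -> anc T d v -> anc T d u -> False) ->
    [disjoint P v x & P x u].
  move=> wv H; apply/pred0P => e; have [d dr <-] := pe_surj T e.
  rewrite /= !mem_P //; apply/negbTE/negP => /andP[].
  case dx : (anc T d x) => /=; first by rewrite (anc_trans dx (Hx v wv)).
  by rewrite addbF => dv du; apply: (H d); rewrite // dx.
case/boolP: (anc T x u) => xu; last first.
  exists v0 => //; apply: dis => // d dr dx dv du.
  have /orP[xd|] := anc_total (Hx v0 wv0) dv; last by apply/negP.
  by rewrite (anc_trans xd du) in xu.
have [Eux|ux] := eqVneq u x.
  by exists v0 => //; rewrite Eux P_self // disjoint_sym disjoints_subset sub0set.
have [c cx cu] : exists2 c, child T c x & anc T c u.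
  have := anc_child x u; rewrite xu (negbTE ux) add0n => H.
  have : \sum_(c | child T c x) anc T c u != 0 by rewrite -H.
  rewrite sum_nat_eq0 => /forallPn[c]; rewrite negb_imply eqb0 negbK => /andP[? ?].
  by exists c.
have := Hc c cx; rewrite negb_forall => /existsP[v].
rewrite negb_imply => /andP[wv cv]; exists v => //.
have /andP[cr /eqP Ec] := cx.
apply: dis => // d dr dx dv du.
have /orP[cd|] := anc_total cu du; first by rewrite (anc_trans cd dv) in cv.
rewrite anc_par => /orP[/eqP Ed|]; first by rewrite -Ed dv in cv.
by rewrite Ec; apply/negP.
Qed.

Lemma run_gate (s : store R) os : std I s -> rooted_store T s os ->
  ints s ROOT 0 = r ->
  exists2 x : V, ints (run p_gate s) GATE 0 = x &
    (exists v : V, 0 < weight v)%R -> gate x r.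
Proof.
move=> Hs Hos Hr; rewrite /p_gate !run_seq.
have Hc := run_count Hs Hos.
set s1 := run p_count s in Hc *; set s2 := run (PI _ _ _) s1.
have Hs2 : std I s2 by do 2!apply: std_run => //.
have [Uos [Sos Mos] Ord Ho _] : rooted_store T s2 os by do 2!apply: rooted_run => //.
have Hc2 (v : V) : (ints s2 CNT v == ints s2 CNT r) = all_below v.
  by have E2 j : ints s2 CNT j = ints s1 CNT j by []; rewrite !E2 Hc.
have Hr2 : ints s2 ROOT 0 = r by rewrite ints_run // ints_run.
(* After [k] rounds the vertices of index at least [size os - k] have been visited. The candidate is
   the latest suitable one or the root, which is not in [os] and so has index [size os]. *)
pose Inv k (s' : store R) := exists x : V, [/\ ints s' GATE 0 = x, all_below x &
  forall c, c != r -> size os - k <= index c os -> all_below c ->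
     c = x \/ index x os < index c os].
have [x [Ex ax Hx]] : Inv (ints s2 4 2) (run (PFor CTR 2 p_gate_step) s2).
  apply: (run_for (Inv := Inv)) => //.
    exists r; split.
    - by rewrite /= /upd /= -Hr ints_run.
    - by apply/forallP => v; rewrite anc_r implybT.
    - by move=> c cr; rewrite subn0 leqNgt index_mem Mos cr.
  move=> k s' s3; rewrite (std_pred Hs2) -Sos => Hk Ek F1 F2 [x [Ex ax IH]] E.
  pose i := (size os).-1 - k; pose v := nth r os i.
  have Hi : i < size os by rewrite /i; lia.
  have Ei : size os - k.+1 = i by rewrite /i; lia.
  have Eo : ieval s' ord_rev = v.
    rewrite /= F1 // Ek F1 // (std_pred Hs2) -Sos subn1 Ho //.
  have iv : index v os = i by rewrite index_uniq.
  have E1 : beval s' (IEq (IGet CNT ord_rev) (IGet CNT (IVar ROOT))) = all_below v.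
    rewrite beval_IEq -Hc2.
    rewrite -[ieval _ _]/(ints s' CNT (ieval s' ord_rev)) Eo F1 //.
    rewrite -[ieval _ _]/(ints s' CNT (ints s' ROOT 0)).
    by rewrite !F1 // Hr2.
  have E2 : ints s3 GATE 0 = if all_below v then nat_of_ord v else ints s' GATE 0.
    by rewrite E /p_gate_step run_if E1 run_skip -Eo; case: ifP.
  have E3 : ints (seti CTR 0 k.+1 s3) GATE 0 = ints s3 GATE 0 by [].
  have cases c : size os - k.+1 <= index c os ->
      c \in os -> c = v \/ size os - k <= index c os /\ index v os < index c os.
    rewrite Ei leq_eqVlt => /orP[/eqP Ec|Hlt] cos.
      by left; rewrite /v Ec nth_index.
    by right; rewrite iv; split=> //; move: Hlt; rewrite /i; lia.
  case av : (all_below v) in E2.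
    exists v; split=> // c cr Hci ac.
    have cos : c \in os by rewrite Mos.
    by case: (cases c Hci cos) => [->|[_ H]]; [left|right].
  exists x; split=> // [|c cr Hci ac]; first by rewrite E3 E2.
  have cos : c \in os by rewrite Mos.
  by case: (cases c Hci cos) => [Ec|[Hc' _]]; [rewrite -Ec ac in av|apply: IH].
exists x => //; apply: gate_of_below => // c cx; apply/negP => ac.
have /andP[cr /eqP Ec] := cx.
have [|Ecx|Hlt] := Hx c cr _ ac.
- by rewrite (std_pred Hs2) -Sos subnn.
- by have := rank_par T cr; rewrite Ec Ecx ltnn.
have [Exr|xr] := eqVneq x r.
  have rx : r \notin os by rewrite Mos eqxx.
  by move: Hlt; rewrite Exr (memNindex rx) ltnNge ltnW // index_mem Mos.
by have := Ord _ _ xr cr Ec; rewrite ltnNge ltnW.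
Qed.

End Subtree.

(** * Testing a threshold *)

Definition p_shift : prog :=
  let e := IGet PE (IVar TV) in
  PSeq (PR SHIFT (ICst 0) (RCst 0))
    (PIf (IEq (IGet INP e) (IGet ONP (IVar TV)))
       (PIf (RLe (RMul (RGet COST e) (RGet CAP e)) (RVar THR))
          (PR SHIFT (ICst 0) (RGet CAP e))
          (PR SHIFT (ICst 0) (RDiv (RVar THR) (RGet COST e))))
       PSkip).

Definition p_depth_step : prog :=
  let e := IGet PE (IVar TV) in
  let up := RGet DEP (IGet PAR (IVar TV)) in
  PSeqs [:: PI TV (ICst 0) ord_rev; p_shift;
            PIf (IEq (IGet INP e) (ICst 1))
              (PR DEP (IVar TV) (RAdd up (RAdd (RGet LEN e) (RVar SHIFT))))
              (PR DEP (IVar TV) (RAdd up (RSub (RGet LEN e) (RVar SHIFT))))].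

Definition p_depths : prog :=
  PSeq (PR DEP (IVar ROOT) (RCst 0)) (PFor CTR 2 p_depth_step).

Definition p_test : prog :=
  PSeqs [:: p_depths; PI OK (ICst 0) (ICst 1);
            PFor CTR 0 (PIf (RLe (RGet DEP (IVar CTR)) (RGet DEP (IVar GOAL)))
                          PSkip (PI OK (ICst 0) (ICst 0)))].

Section Depths.
Variables (R : realFieldType) (I : problem R).
Hypothesis valid_I : valid I.
Local Notation V := 'I_(nv I).
Local Notation E := 'I_(ne I).
Variables (r g : V) (T : rooted r).

Record ready (os : seq V) (s : store R) : Prop := Ready {
  ready_std : std I s;
  ready_rooted : rooted_store T s os;
  ready_root : ints s ROOT 0 = r;
  ready_goal : ints s GOAL 0 = g;
  ready_on : forall v, v != r -> ints s ONP v = (pe T v \in P r g);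
  ready_in : forall e : E, ints s INP e = (e \in P (leaf_a I) (leaf_b I));
  ready_cap : forall e : E, nums s CAP e = cap e }.

Lemma ready_eq os s s' :
  (forall B j, B \in [:: 1; 2; 4; PAR; PE; ORD; ROOT; GOAL; ONP; INP] ->
     ints s' B j = ints s B j) ->
  (forall B j, B \in [:: 0; 1; 2; 3; CAP] -> nums s' B j = nums s B j) ->
  ready os s -> ready os s'.
Proof.
move=> Hi Hr [Hs HT ? ? Ho Hn Hc]; split.
- apply: (std_eq _ _ Hs) => B j HB; [apply: Hi|apply: Hr];
  by move: HB; rewrite !inE; do ?[case/orP]; move/eqP->.
- apply: (rooted_eq _ HT) => B j HB; apply: Hi.
  by move: HB; rewrite !inE; do ?[case/orP]; move/eqP->.
- by rewrite Hi.
- by rewrite Hi.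
- by move=> v vr; rewrite Hi ?Ho.
- by move=> e; rewrite Hi ?Hn.
- by move=> e; rewrite Hr ?Hc.
Qed.

Lemma ready_run p os s :
  keeps [:: 1; 2; 4; PAR; PE; ORD; ROOT; GOAL; ONP; INP] [:: 0; 1; 2; 3; CAP] p ->
  ready os s -> ready os (run p s).
Proof.
case/andP=> /allP Hi /allP Hr; apply: ready_eq => B j HB.
  by rewrite ints_run ?Hi.
by rewrite nums_run ?Hr.
Qed.

Lemma ready_seti os A i z s :
  A \notin [:: 1; 2; 4; PAR; PE; ORD; ROOT; GOAL; ONP; INP] ->
  ready os s -> ready os (seti A i z s).
Proof.
move=> HA; apply: ready_eq => // B j HB; rewrite /= /upd.
by case: eqP => // BA; rewrite -BA HB in HA.
Qed.

Lemma run_shift os s v : ready os s -> v != r -> ints s TV 0 = v ->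
  nums (run p_shift s) SHIFT 0 = shift (P r g) (nums s THR 0) (pe T v).
Proof.
move=> Hs vr Ev; have [_ _ _ _ Hp] := ready_rooted Hs.
have {Hp} [_ Hp] := Hp v vr.
rewrite /p_shift run_seq; set e := IGet PE _; set s1 := run _ s.
have Ee : ieval s1 e = pe T v by rewrite -Hp -Ev.
have E0 : nums s1 SHIFT 0 = 0%R by [].
have E1 : nums (run (PR SHIFT (ICst 0) (RGet CAP e)) s1) SHIFT 0 = cap (pe T v).
  by rewrite -(ready_cap Hs) -Ee.
have E2 : nums (run (PR SHIFT (ICst 0) (RDiv (RVar THR) (RGet COST e))) s1) SHIFT 0 =
    (nums s THR 0 / cost (pe T v))%R.
  by rewrite -(std_cost (ready_std Hs)) -Ee.
rewrite run_if beval_IEq.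
rewrite -[ieval s1 (IGet INP e)]/(ints s INP (ieval s1 e)).
rewrite -[ieval s1 (IGet ONP _)]/(ints s ONP (ints s TV 0)).
rewrite Ee Ev (ready_in Hs) (ready_on Hs) // run_if run_skip.
rewrite -[beval s1 _]/(nums s 3 (ieval s1 e) * nums s CAP (ieval s1 e) <= nums s THR 0)%R.
rewrite Ee (std_cost (ready_std Hs)) (ready_cap Hs) /shift.
case: (_ \in P (leaf_a I) _); case: (_ \in P r g) => //=; rewrite ?E0 //;
  by case: ifP; rewrite ?E1 ?E2.
Qed.

Local Notation L t := (new_len (shift (P r g) t)).

Lemma run_depths os s : ready os s -> (0 <= nums s THR 0)%R ->
  forall v : V, nums (run p_depths s) DEP v = dist (L (nums s THR 0%N)) r v.
Proof.
move=> Hs t0; have Hg := ready_std Hs; have [Uos [Sos Mos] Ord Ho Hp] := ready_rooted Hs.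
have L0 : forall e, (0 <= L (nums s THR 0%N) e)%R.
  by have [] := shift_admissible valid_I (P r g) t0.
rewrite /p_depths run_seq; set s1 := run _ s.
pose Inv k (s' : store R) := forall v : V, v = r \/ size os - k <= index v os < size os ->
  nums s' DEP v = dist (L (nums s THR 0%N)) r v.
have H : Inv (ints s1 4 2) (run (PFor CTR 2 p_depth_step) s1).
  apply: (run_for (Inv := Inv)) => //.
    move=> v [->|]; last by rewrite subn0; case: leqP.
    have -> : nums (seti CTR 0 0 s1) DEP r = put (nums s DEP) (ints s ROOT 0) 0%R r by [].
    by rewrite putE (ready_root Hs) eqxx dist_self.
  move=> k s' s3; rewrite [ints s1 4 2](std_pred Hg) -Sos => Hk Ek F1 F2 IH E v Hv.
  pose i := (size os).-1 - k; pose x := nth r os i.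
  have Hi : i < size os by rewrite /i; lia.
  have xos : x \in os by rewrite mem_nth.
  have xr : x != r by rewrite -Mos.
  have ix : index x os = i by rewrite index_uniq.
  have Hs' : ready os s'.
    apply: (ready_eq _ _ Hs) => B j HB; [rewrite F1|rewrite F2].
    - by rewrite ints_run //; move: HB; rewrite !inE; do ?[case/orP]; move/eqP->.
    - by move: HB; rewrite !inE; do ?[case/orP]; move/eqP->.
    - by rewrite nums_run //; move: HB; rewrite !inE; do ?[case/orP]; move/eqP->.
    - by move: HB; rewrite !inE; do ?[case/orP]; move/eqP->.
  have Et : nums s' THR 0 = nums s THR 0 by rewrite F2.
  have {E} : s3 = run (PSeqs [:: PI TV (ICst 0) ord_rev; p_shift; _]) s' := E.
  rewrite 2!run_seq; set s4 := run _ s'.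
  have Hs4 : ready os s4 by apply: ready_run.
  have Tx : ints s4 TV 0 = x.
    rewrite -[LHS]/(ieval s' ord_rev) /= Ek (std_pred (ready_std Hs')) -Sos subn1.
    by have [_ _ _ -> //] := ready_rooted Hs'.
  have := run_shift Hs4 xr Tx; rewrite [nums s4 THR 0]Et.
  have : ready os (run p_shift s4) by apply: ready_run.
  have : ints (run p_shift s4) TV 0 = x by rewrite ints_run.
  have : forall j, nums (run p_shift s4) DEP j = nums s' DEP j.
    by move=> j; rewrite nums_run.
  move: (run p_shift s4) => s5 Ed {}Tx Hs5 Ex; rewrite run_if beval_IEq.
  have [_ _ _ _ Hp5] := ready_rooted Hs5; have [Ep Ee] := Hp5 x xr.
  rewrite -[ieval s5 _]/(ints s5 INP (ints s5 PE (ints s5 TV 0))).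
  rewrite Tx Ee (ready_in Hs5).
  pose up (z : R) := put (nums s5 DEP) (ints s5 TV 0)
    (nums s5 DEP (ints s5 PAR (ints s5 TV 0)) + z)%R v.
  move=> E.
  have {E} E : nums s3 DEP v = if pe T x \in P (leaf_a I) (leaf_b I)
     then up (nums s5 1 (ints s5 PE (ints s5 TV 0)) + nums s5 SHIFT 0)%R
     else up (nums s5 1 (ints s5 PE (ints s5 TV 0)) - nums s5 SHIFT 0)%R.
    by rewrite E; case: (_ \in _).
  have {}E : nums s3 DEP v = put (nums s' DEP) x
      (nums s' DEP (par T x) + L (nums s THR 0%N) (pe T x))%R v.
    rewrite E /up !putE Tx Ep Ee !Ed Ex (std_len (ready_std Hs5)) /new_len.
    by case: ifP.
  rewrite -[nums _ _ _]/(nums s3 DEP v) E putE (val_eqE v x).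
  case: eqP => [->|/eqP vx].
    rewrite (dist_par valid_I L0 T xr) IH //.
    have [->|pr] := eqVneq (par T x) r; [by left|right].
    have := Ord _ _ pr xr erefl; rewrite ix index_mem Mos pr andbT /i; lia.
  apply: IH; case: Hv => [->|/andP[v1 v2]]; [by left|right; rewrite v2 andbT].
  have : index v os != i.
    by apply: contra_neq vx => Ev; rewrite /x -Ev nth_index // -index_mem.
  by move: v1; rewrite /i; lia.
move=> v; apply: H; have [->|vr] := eqVneq v r; [by left|right].
by rewrite [ints s1 4 2](std_pred Hg) -Sos subnn index_mem Mos.
Qed.

Lemma run_test os s : ready os s -> (0 <= nums s THR 0)%R ->
  (forall v : V, nums (run p_test s) DEP v = dist (L (nums s THR 0%N)) r v) /\
  ints (run p_test s) OK 0 =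
    [forall u, dist (L (nums s THR 0%N)) r u <= dist (L (nums s THR 0%N)) r g]%R.
Proof.
move=> Hs t0; have D := run_depths Hs t0.
have Hg : ready os (run p_depths s) by apply: ready_run.
rewrite /p_test 2!run_seq; set s1 := run p_depths s in D Hg *.
set s2 := run _ s1; set d := dist _ in D *.
have Hg2 : ready os s2 by apply: ready_run.
split=> [v|]; first by rewrite nums_run // -D.
pose Inv k (s' : store R) :=
  ints s' OK 0 = [forall u : V, (u < k) ==> (d r u <= d r g)%R].
have H : Inv (ints s2 4 0) (run (PFor CTR 0 (PIf (RLe (RGet DEP (IVar CTR)) (RGet DEP (IVar GOAL)))
                          PSkip (PI OK (ICst 0) (ICst 0)))) s2).
  apply: (run_for (Inv := Inv)) => //.
    rewrite /Inv (_ : [forall u : V, _] = true) //.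
    by apply/forallP => u.
  move=> k s' s3; rewrite (std_nv (ready_std Hg2)) => Hk Ek F1 F2 IH E.
  pose x : V := Ordinal Hk.
  have E1 : ints s3 OK 0 = if (d r x <= d r g)%R then ints s' OK 0 else 0.
    rewrite E run_if run_skip.
    rewrite -[beval s' _]/(nums s' DEP (ints s' CTR 0) <= nums s' DEP (ints s' GOAL 0))%R.
    rewrite Ek F1 // (ready_goal Hg2) !F2 // [nums s2 _ _](D x) [nums s2 _ _](D g).
    by case: ifP.
  rewrite /Inv -[ints (seti _ _ _ _) _ _]/(ints s3 OK 0) E1 IH.
  case: ifP => dx; last first.
    suff -> : [forall u : V, (u < k.+1) ==> (d r u <= d r g)%R] = false by [].
    by apply/negbTE/forallPn; exists x; rewrite ltnSn /= dx.
  congr (nat_of_bool _); apply: eq_forallb => u; rewrite ltnS [u <= k]leq_eqVlt.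
  have [Eu|//] := eqVneq (nat_of_ord u) k.
  by rewrite (_ : u = x) ?dx ?implybT //; apply: val_inj.
rewrite H (std_nv (ready_std Hg2)); congr (nat_of_bool _).
by apply: eq_forallb => u; rewrite ltn_ord.
Qed.

End Depths.

(** * Merge sort *)

(** Truncated subtraction turns this into the minimum. *)
Definition IMin e1 e2 := ISub e1 (ISub e1 e2).

Definition p_next_runs : prog :=
  PSeqs [:: PI LEFT (ICst 0) (IVar STOP);
            PI MID (ICst 0) (IMin (IAdd (IVar LEFT) (IVar WIDTH)) (IGet CONST (ICst 4)));
            PI RIGHT (ICst 0) (IVar MID);
            PI STOP (ICst 0) (IMin (IAdd (IVar MID) (IVar WIDTH)) (IGet CONST (ICst 4)))].

Definition take_left : bexp :=
  BAnd (BNot (ILe (IVar MID) (IVar LEFT)))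
       (BNot (BAnd (BNot (ILe (IVar STOP) (IVar RIGHT)))
                   (BNot (RLe (RGet XS (IVar LEFT)) (RGet XS (IVar RIGHT)))))).

Definition p_take (A : nat) : prog :=
  PSeq (PR YS (IVar CTR) (RGet XS (IVar A))) (PI A (ICst 0) (IAdd (IVar A) (ICst 1))).

(** Every round writes exactly one position of the output and fetches the next pair of runs itself
    when both are exhausted. So a whole pass is a single linear loop. *)
Definition p_merge_step : prog :=
  PSeq (PIf (BAnd (IEq (IVar LEFT) (IVar MID)) (IEq (IVar RIGHT) (IVar STOP)))
          p_next_runs PSkip)
       (PIf take_left (p_take LEFT) (p_take RIGHT)).

Definition p_merge : prog :=
  PSeqs [:: PI STOP (ICst 0) (ICst 0); p_next_runs; PFor CTR 4 p_merge_step].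

Definition p_copy : prog := PFor CTR 4 (PR XS (IVar CTR) (RGet YS (IVar CTR))).

Definition p_sort : prog :=
  PSeq (PI WIDTH (ICst 0) (ICst 1))
       (PFor CTR2 3 (PSeqs [:: p_merge; p_copy;
          PI WIDTH (ICst 0) (IAdd (IVar WIDTH) (IVar WIDTH))])).

Section Sort.
Variable R : realFieldType.

(** A descent is allowed only between blocks of length [w], which start at the multiples of [w]. *)
Definition run_sorted (w m : nat) (X : nat -> R) :=
  forall i, i.+1 < m -> ~~ (w %| i.+1) -> (X i <= X i.+1)%R.

(** Only the set of values matters for breakpoints, so multiplicities are not tracked. *)
Definition covers (m : nat) (X Y : nat -> R) := forall i, i < m -> exists2 j, j < m & Y j = X i.

Lemma ndvdn_between w b x : w %| b -> b < x -> x < b + w -> ~~ (w %| x).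
Proof.
move=> wb bx xw; rewrite -(subnKC (ltnW bx)) dvdn_addr // gtnNdvd //; lia.
Qed.

(* Writing position [k] while merging the runs [base, mid) and [mid, stop),
   of which [i, mid) and [j, stop) remain. *)
Record merging (w m : nat) (X Y : nat -> R) (k i mid j stop base : nat) : Prop :=
  Merging {
  mg_base : w + w %| base;
  mg_mid : mid = minn (base + w) m;
  mg_stop : stop = minn (mid + w) m;
  mg_order : [/\ base <= i, i <= mid, mid <= j & j <= stop];
  mg_pos : i + j = k + mid;
  mg_left : base < k -> i < mid -> (Y k.-1 <= X i)%R;
  mg_right : base < k -> j < stop -> (Y k.-1 <= X j)%R;
  mg_values : forall t, t < k -> exists2 u, u < m & Y t = X u;
  mg_cover : forall u, u < m ->
    [\/ exists2 t, t < k & Y t = X u, i <= u < mid | j <= u];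
  mg_sorted : run_sorted (w + w) k Y }.

Variables (w m : nat) (X : nat -> R).
Hypotheses (w_gt0 : 0 < w) (X_sorted : run_sorted w m X).

Lemma merging_next Y k mid stop base :
  merging w m X Y k mid mid stop stop base -> k < m ->
  merging w m X Y k stop (minn (stop + w) m) (minn (stop + w) m)
    (minn (minn (stop + w) m + w) m) stop.
Proof.
case=> Hb Em Es [? ? ? ?] Hp _ _ Hv Hc Hs km.
(* Both runs are exhausted, so exactly the positions before [stop] have been written; as [k < m],
   neither run was cut short by the end of the array. *)
have Ek : stop = k by lia.
have Ekb : k = base + (w + w) by lia.
split=> //.
- by rewrite Ek Ekb dvdn_addr.
- by split=> //; lia.
- lia.
- by rewrite Ek ltnn.
- by rewrite Ek ltnn.
move=> u um; case: (Hc u um) => [?|?|?]; [by constructor 1|lia|].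
by have [?|?] := ltnP u (minn (stop + w) m); [constructor 2; lia|constructor 3; lia].
Qed.

Lemma merging_take Y Y' k i mid j stop base i' j' x :
  merging w m X Y k i mid j stop base ->
  Y' =1 put Y k (X x) ->
  (x = i /\ i' = i.+1 /\ j' = j /\ i < mid /\ (j < stop -> (X i <= X j)%R)) \/
  (x = j /\ i' = i /\ j' = j.+1 /\ j < stop /\ (i < mid -> (X j <= X i)%R)) ->
  merging w m X Y' k.+1 i' mid j' stop base.
Proof.
case=> Hb Em Es [H1 H2 H3 H4] Hp Hl Hr Hv Hc Hs EY Hx.
have wb : w %| base by apply: dvdn_trans Hb; rewrite dvdn_addr.
have Yk : Y' k = X x by rewrite EY putE eqxx.
have Yt t : t < k -> Y' t = Y t by move=> tk; rewrite EY putE ltn_eqF.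
have bk : base <= k by lia.
split=> //=.
- by case: Hx => -[Ex [Ei [Ej [? _]]]]; split; lia.
- by case: Hx => -[Ex [Ei [Ej [? _]]]]; lia.
- move=> _; rewrite Yk; case: Hx => -[-> [-> [_ [lt H]]]] i1; last exact: H.
  by apply: X_sorted; [lia|apply: (ndvdn_between wb); lia].
- move=> _; rewrite Yk; case: Hx => -[-> [_ [-> [lt H]]]] j1; first exact: H.
  have bw : w %| base + w by rewrite dvdn_addr.
  by apply: X_sorted; [lia|apply: (ndvdn_between bw); lia].
- move=> t; rewrite ltnS leq_eqVlt => /orP[/eqP->|tk].
    by exists x => //; case: Hx => -[-> [_ [_ [? _]]]]; lia.
  by rewrite Yt //; apply: Hv.
- move=> u um; case: (Hc u um) => [[t tk Et]|/andP[u1 u2]|ju].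
  + by constructor 1; exists t; rewrite ?Yt // ltnW.
  + have [Eu|/eqP xu] := eqVneq u x; first by constructor 1; exists k; rewrite // Yk Eu.
    by constructor 2; case: Hx => -[Ex [Ei [Ej [? _]]]]; lia.
  have [Eu|/eqP xu] := eqVneq u x; first by constructor 1; exists k; rewrite // Yk Eu.
  by constructor 3; case: Hx => -[Ex [Ei [Ej [? _]]]]; lia.
move=> t; rewrite ltnS leq_eqVlt => /orP[/eqP Et|tk] nd; last first.
  by rewrite !Yt ?(ltnW tk) //; apply: Hs.
have tk : t < k by rewrite -Et.
rewrite Et in nd *; rewrite Yk Yt //.
(* The new neighbours lie within one block of length [w + w], whereas [base] starts a block. *)
have Ebk : base < k.
  by rewrite ltn_neqAle bk andbT; apply: contraNneq nd => <-.
have -> : t = k.-1 by rewrite -Et.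
by case: Hx => -[-> [_ [_ [lt _]]]]; [apply: Hl|apply: Hr].
Qed.

Lemma run_next_runs (s : store R) : ints s WIDTH 0 = w -> ints s 4 4 = m ->
  let s' := run p_next_runs s in let mid := minn (ints s STOP 0 + w) m in
  [/\ ints s' LEFT 0 = ints s STOP 0, ints s' MID 0 = mid, ints s' RIGHT 0 = mid
    & ints s' STOP 0 = minn (mid + w) m].
Proof. by move=> <- <- s' mid; rewrite /mid !minnE; split; reflexivity. Qed.

Lemma beval_take_left (s : store R) : beval s take_left =
  (ints s LEFT 0 < ints s MID 0) &&
  ((ints s STOP 0 <= ints s RIGHT 0) ||
   (nums s XS (ints s LEFT 0%N) <= nums s XS (ints s RIGHT 0%N))%R).
Proof.
rewrite -[LHS]/(~~ (ints s MID 0 <= ints s LEFT 0) &&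
  ~~ (~~ (ints s STOP 0 <= ints s RIGHT 0) &&
      ~~ (nums s XS (ints s LEFT 0%N) <= nums s XS (ints s RIGHT 0%N))%R)).
by rewrite -ltnNge negb_and !negbK.
Qed.

Definition merging_store (k : nat) (s : store R) (base : nat) :=
  merging w m X (nums s YS) k (ints s LEFT 0) (ints s MID 0)
    (ints s RIGHT 0) (ints s STOP 0) base.

Lemma run_merge_step k (s : store R) base :
  ints s WIDTH 0 = w -> ints s 4 4 = m -> (forall i, nums s XS i = X i) ->
  ints s CTR 0 = k -> k < m -> merging_store k s base ->
  exists base', merging_store k.+1 (run p_merge_step s) base'.
Proof.
move=> Hw Hm HX Hk km M; rewrite /p_merge_step run_seq [run (PIf _ _ PSkip) s]run_if run_skip.
set b := BAnd _ _; set s1 := if _ then _ else _.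
have bE : beval s b = (ints s LEFT 0 == ints s MID 0) && (ints s RIGHT 0 == ints s STOP 0).
  by rewrite -[LHS]/(beval s (IEq _ _) && beval s (IEq _ _)) !beval_IEq.
have [base1 M1 NE] : exists2 base1, merging_store k s1 base1 &
   (ints s1 LEFT 0 < ints s1 MID 0) || (ints s1 RIGHT 0 < ints s1 STOP 0).
  rewrite /s1 bE; case: ifP => [/andP[/eqP E1 /eqP E2]|NE].
    have [F1 F2 F3 F4] := run_next_runs Hw Hm.
    move: M; rewrite /merging_store E1 E2 => M.
    have M1 := merging_next M km; exists (ints s STOP 0).
      by rewrite /merging_store F1 F2 F3 F4.
    by rewrite F1 F2; have := mg_pos M1; lia.
  exists base => //; have [_ H1 _ H2] := mg_order M.
  by move: NE; rewrite ltn_neqAle [X in _ || X]ltn_neqAle H1 H2 !andbT -negb_and => ->.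
have K1 : ints s1 CTR 0 = k by rewrite /s1; case: ifP; rewrite ?ints_run.
have X1 i : nums s1 XS i = X i by rewrite /s1; case: ifP; rewrite ?nums_run.
move: s1 M1 NE K1 X1 => s1 M1 NE K1 X1; exists base1.
rewrite run_if beval_take_left !X1.
case: ifP => [/andP[lt H]|H].
  apply: (merging_take M1 (x := ints s1 LEFT 0)).
    by move=> t; rewrite -K1 -X1.
  left; split=> //; split; first by rewrite -[RHS]addn1.
  do 2!split=> //.
  by rewrite ltnNge => /negbTE E; rewrite E in H.
apply: (merging_take M1 (x := ints s1 RIGHT 0)).
  by move=> t; rewrite -K1 -X1.
right; do 2!split=> //; split; first by rewrite -[RHS]addn1.
split.
  by case/orP: NE => // lt; move: H; rewrite lt /= => /negbT; rewrite negb_or -ltnNge => /andP[].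
move=> lt; move: H; rewrite lt /= => /negbT; rewrite negb_or => /andP[_].
by rewrite -ltNge => /ltW.
Qed.

Lemma run_merge (s : store R) :
  ints s WIDTH 0 = w -> ints s 4 4 = m -> (forall i, nums s XS i = X i) ->
  let Y := nums (run p_merge s) YS in
  [/\ run_sorted (w + w) m Y, covers m X Y & covers m Y X].
Proof.
move=> Hw Hm HX; rewrite /p_merge 2!run_seq.
set s1 := run (PI _ _ _) s.
have S0 : ints s1 STOP 0 = 0 by [].
have := @run_next_runs s1 Hw Hm; rewrite S0 add0n.
have : ints (run p_next_runs s1) WIDTH 0 = w by rewrite ints_run.
have : ints (run p_next_runs s1) 4 4 = m by rewrite ints_run.
have : forall i, nums (run p_next_runs s1) XS i = X i.
  by move=> i; rewrite nums_run //; apply: HX.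
move: (run p_next_runs s1) => s2 {}HX {}Hm {}Hw [F1 F2 F3 F4].
have M0 : merging_store 0 (seti CTR 0 0 s2) 0.
  rewrite /merging_store -[nums (seti _ _ _ _) _]/(nums s2 YS).
  rewrite -[ints (seti _ _ _ _) LEFT 0]/(ints s2 LEFT 0).
  rewrite -[ints (seti _ _ _ _) MID 0]/(ints s2 MID 0).
  rewrite -[ints (seti _ _ _ _) RIGHT 0]/(ints s2 RIGHT 0).
  rewrite -[ints (seti _ _ _ _) STOP 0]/(ints s2 STOP 0) F1 F2 F3 F4.
  split=> //.
  - by split=> //; lia.
  - by move=> u um; have [?|?] := ltnP u (minn w m); [constructor 2|constructor 3].
have : exists base, merging_store (ints s2 4 4) (run (PFor CTR 4 p_merge_step) s2) base.
  apply: (run_for (Inv := fun k s => exists base, merging_store k s base)) => //.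
    by exists 0.
  move=> k s' s3 Hk Ek E1 E2 [base M] E.
  have [||||base' M'] := run_merge_step _ _ _ Ek _ M.
  - by rewrite E1.
  - by rewrite E1.
  - by move=> i; rewrite E2.
  - by rewrite -Hm.
  by exists base'; rewrite E.
rewrite Hm => -[base M].
have [H1 H2 H3 H4] := mg_order M.
have Em := mg_mid M; have Es := mg_stop M; have Ep := mg_pos M.
split.
- exact: mg_sorted M.
(* At the end the two read positions add up to [m] plus the middle, which leaves nothing unread in
   either run. *)
- by move=> u um; case: (mg_cover M um) => [//|?|?]; lia.
- by move=> t /(mg_values M)[u um Eu]; exists u.
Qed.

End Sort.

Section SortProgram.
Variables (R : realFieldType) (m : nat).

Lemma covers_trans (X Y Z : nat -> R) : covers m X Y -> covers m Y Z -> covers m X Z.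
Proof.
by move=> H1 H2 i /H1[j jm <-]; have [k km <-] := H2 j jm; exists k.
Qed.

Lemma run_copy (s : store R) i : ints s 4 4 = m -> i < m ->
  nums (run p_copy s) XS i = nums s YS i.
Proof.
move=> Hm; rewrite -Hm.
apply: (run_for (Inv := fun k s' => i < k -> nums s' XS i = nums s YS i)) => //.
move=> k s' s1 _ Ek F1 F2 IH E; rewrite ltnS leq_eqVlt => H.
rewrite -[LHS]/(nums s1 XS i).
have -> : nums s1 XS i = put (nums s' XS) (ints s' CTR 0) (nums s' YS (ints s' CTR 0)) i.
  by rewrite E.
by rewrite Ek putE; case: eqP H => [-> _|_ /= /IH //]; rewrite F2.
Qed.

Lemma run_sort (s : store R) : ints s 4 4 = m -> m <= 2 ^ ints s 4 3 ->
  let X := nums s XS in let Y := nums (run p_sort s) XS in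
  [/\ forall i j, i <= j -> j < m -> (Y i <= Y j)%R, covers m X Y & covers m Y X].
Proof.
move=> Hm Hlog X Y.
pose Inv t (s' : store R) := [/\ ints s' WIDTH 0 = 2 ^ t,
  run_sorted (2 ^ t) m (nums s' XS), covers m X (nums s' XS) & covers m (nums s' XS) X].
rewrite /Y /p_sort run_seq; set s1 := run (PI _ _ _) s.
have [_ H1 H2 H3] : Inv (ints s1 4 3) (run (PFor CTR2 3 (PSeqs [:: p_merge; p_copy;
          PI WIDTH (ICst 0) (IAdd (IVar WIDTH) (IVar WIDTH))])) s1).
  apply: (run_for (Inv := Inv)) => //.
    split=> //.
    - by move=> i _; rewrite dvd1n.
    - by move=> i im; exists i.
    - by move=> i im; exists i.
  move=> t s' s2 _ _ F1 F2 [Hw Hs C1 C2].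
  have Hm' : ints s' 4 4 = m by rewrite F1.
  have w0 : 0 < 2 ^ t by rewrite expn_gt0.
  have [G1 G2 G3] := run_merge w0 Hs Hw Hm' (fun i => erefl).
  have Hw2 : ints (run p_merge s') WIDTH 0 = 2 ^ t by rewrite ints_run.
  have Hm2 : ints (run p_merge s') 4 4 = m by rewrite ints_run.
  rewrite 2!run_seq; move: (run p_merge s') G1 G2 G3 Hw2 Hm2 => s3 G1 G2 G3 Hw2 Hm2.
  have Hw3 : ints (run p_copy s3) WIDTH 0 = 2 ^ t by rewrite ints_run.
  move: (run p_copy s3) (fun i => @run_copy s3 i Hm2) Hw3 => s4 cp Hw3 E.
  have Xs i : i < m -> nums (seti CTR2 0 t.+1 s2) XS i = nums s3 YS i.
    by move=> im; rewrite -(cp i im) E.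
  split.
  - rewrite -[LHS]/(ints s2 WIDTH 0) expnS mul2n -addnn -Hw3 E; reflexivity.
  - move=> i im; rewrite expnS mul2n -addnn !Xs //; first exact: G1.
    exact: ltnW.
  - apply: (covers_trans C1) => i im; have [j jm Ej] := G2 i im.
    by exists j; rewrite ?Xs.
  - apply: (covers_trans _ C2) => i im; rewrite Xs //; exact: G3.
split=> // i j ij jm.
(* After the last pass one block covers all [m] entries, so no block boundary remains where a
   descent could occur. *)
have step k : k.+1 < m -> (nums (run (PFor CTR2 3 (PSeqs [:: p_merge; p_copy;
          PI WIDTH (ICst 0) (IAdd (IVar WIDTH) (IVar WIDTH))])) s1) XS k <=
   nums (run (PFor CTR2 3 (PSeqs [:: p_merge; p_copy;
          PI WIDTH (ICst 0) (IAdd (IVar WIDTH) (IVar WIDTH))])) s1) XS k.+1)%R.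
  move=> km; apply: H1 => //; rewrite gtnNdvd //.
  exact: leq_trans km Hlog.
elim: j ij jm => [|j IH]; first by rewrite leqn0 => /eqP->.
rewrite leq_eqVlt => /orP[/eqP->//|]; rewrite ltnS => ij jm.
exact: le_trans (IH ij (ltnW jm)) (step j jm).
Qed.

End SortProgram.

(** * The least sufficient threshold *)

Definition p_try (i : iexp) : prog := PSeq (PR THR (ICst 0) (RGet XS i)) p_test.

Definition p_bisect_step : prog :=
  PIf (BNot (ILe (IVar HI) (IVar LO)))
    (PSeqs [:: PI HALF (ICst 0) (IHalf (IAdd (IVar LO) (IVar HI)));
               p_try (IVar HALF);
               PIf (IEq (IVar OK) (ICst 1))
                 (PI HI (ICst 0) (IVar HALF))
                 (PI LO (ICst 0) (IAdd (IVar HALF) (ICst 1)))])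
    PSkip.

Definition p_bisect : prog :=
  PSeqs [:: PI LO (ICst 0) (ICst 0); PI HI (ICst 0) (IGet CONST (ICst 1));
            p_try (IVar HI); PI FLAG (ICst 0) (IVar OK);
            PFor CTR2 3 p_bisect_step].

Definition slack_lo : rexp := RSub (RGet DEPLO (IVar GOAL)) (RGet DEPLO (IVar CTR)).
Definition slack_hi : rexp := RSub (RGet DEP (IVar GOAL)) (RGet DEP (IVar CTR)).

Definition p_cross_step : prog :=
  PIf (BNot (RLe (RCst 0) slack_lo))
    (PSeq (PR CAND (ICst 0)
            (RAdd (RVar TLO) (RDiv (RMul (RSub (RVar THI) (RVar TLO)) (RSub (RCst 0) slack_lo))
                                   (RSub slack_hi slack_lo))))
          (PIf (RLe (RVar THR) (RVar CAND)) (PR THR (ICst 0) (RVar CAND)) PSkip))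
    PSkip.

(* If [HI] is 0, both ends of the interval are breakpoint 0. *)
Definition p_interpolate : prog :=
  PSeqs [:: p_try (ISub (IVar HI) (ICst 1));
            PR TLO (ICst 0) (RVar THR);
            PFor CTR 0 (PR DEPLO (IVar CTR) (RGet DEP (IVar CTR)));
            p_try (IVar HI);
            PR THI (ICst 0) (RVar THR);
            PR THR (ICst 0) (RVar TLO);
            PFor CTR 0 p_cross_step].

Definition p_search : prog := PSeq p_bisect p_interpolate.

Section Search.
Variables (R : realFieldType) (I : problem R).
Hypothesis valid_I : valid I.
Local Notation V := 'I_(nv I).
Local Notation E := 'I_(ne I).
Variables (r g : V) (T : rooted r).

(** With 0 included, the intervals between consecutive entries cover every threshold from 0 up to
    the largest breakpoint. *)
Definition breakpoints (X : nat -> R) :=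
  [/\ forall i j, i <= j -> j <= ne I -> (X i <= X j)%R, X 0 = 0%R &
      forall e : E, exists2 i, i <= ne I & X i = (cost e * cap e)%R].

Definition reachesb (t : R) : bool :=
  [forall u : V, dist (new_len (shift (P r g) t)) r u <= dist (new_len (shift (P r g) t)) r g]%R.

Lemma reachesbP t : reflect (reaches r g t) (reachesb t).
Proof. exact: forallP. Qed.

Lemma run_try os (s : store R) i : ready g T os s -> (0 <= nums s XS (ieval s i))%R ->
  let t := nums s XS (ieval s i) in
  [/\ ready g T os (run (p_try i) s), nums (run (p_try i) s) THR 0 = t,
      forall v : V, nums (run (p_try i) s) DEP v = dist (new_len (shift (P r g) t)) r v
    & ints (run (p_try i) s) OK 0 = reachesb t].
Proof.
move=> Hs t0 t; rewrite /p_try run_seq; set s1 := run _ s.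
have Hs1 : ready g T os s1 by apply: ready_run.
have [D O] := run_test valid_I Hs1 t0.
split=> //; first exact: ready_run.
by rewrite nums_run.
Qed.

(** [bi_size] records the halving. [bi_hi] is conditional because the rounds are also carried out
    when even the largest breakpoint fails. *)
Record bisecting os (X : nat -> R) (k : nat) (s : store R) : Prop := Bisecting {
  bi_ready : ready g T os s;
  bi_breaks : forall i, nums s XS i = X i;
  bi_order : ints s LO 0 <= ints s HI 0 <= ne I;
  bi_size : (ints s HI 0 - ints s LO 0) * 2 ^ k <= ne I;
  bi_lo : forall i, i < ints s LO 0 -> ~~ reachesb (X i);
  bi_hi : reachesb (X (ne I)) -> reachesb (X (ints s HI 0)) }.

Lemma run_bisect_step os X k (s : store R) : breakpoints X ->
  bisecting os X k s -> bisecting os X k.+1 (run p_bisect_step s).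
Proof.
case=> Xmon X0 _ [Hs HX /andP[lh hn] Hk Hlo Hhi].
rewrite /p_bisect_step run_if run_skip.
rewrite -[beval s _]/(~~ (ints s HI 0 <= ints s LO 0)) -ltnNge.
case: ltnP => Hlt; last first.
  by split=> //; rewrite ?lh ?hn // (eqP Hlt).
pose h := (ints s LO 0 + ints s HI 0)./2.
have [h1 h2] : ints s LO 0 <= h /\ h < ints s HI 0 by rewrite /h; lia.
have hne : h <= ne I by lia.
rewrite 2!run_seq; set s1 := run _ s.
have Hs1 : ready g T os s1 by apply: ready_run.
have Eh : ieval s1 (IVar HALF) = h by [].
have Eh0 : nums s1 XS (ieval s1 (IVar HALF)) = X h by rewrite Eh -HX.
have t0 : (0 <= nums s1 XS (ieval s1 (IVar HALF)))%R by rewrite Eh0 -X0 Xmon.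
have [Hs2 _ _] := run_try Hs1 t0; rewrite Eh0.
have : forall i, nums (run (p_try (IVar HALF)) s1) XS i = X i.
  by move=> i; rewrite nums_run // -HX.
have : ints (run (p_try (IVar HALF)) s1) LO 0 = ints s LO 0 by rewrite ints_run.
have : ints (run (p_try (IVar HALF)) s1) HI 0 = ints s HI 0 by rewrite ints_run.
have : ints (run (p_try (IVar HALF)) s1) HALF 0 = h by rewrite ints_run.
move: (run (p_try _) s1) Hs2 => s2 Hs2 E1 E2 E3 X2 O2.
rewrite run_if beval_IEq [ieval s2 _]O2 eqb1.
case: ifP => Hr.
  have A1 : ints (run (PI HI (ICst 0) (IVar HALF)) s2) HI 0 = h by rewrite -E1.
  have A2 : ints (run (PI HI (ICst 0) (IVar HALF)) s2) LO 0 = ints s LO 0.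
    by rewrite -E3 ints_run.
  split.
  - exact: ready_run.
  - by move=> i; rewrite nums_run.
  - by rewrite A1 A2 h1 hne.
  - rewrite A1 A2 expnS mulnA; apply: leq_trans Hk.
    by rewrite leq_mul2r; apply/orP; right; rewrite /h; lia.
  - by move=> i; rewrite A2; apply: Hlo.
  - by rewrite A1.
have A1 : ints (run (PI LO (ICst 0) (IAdd (IVar HALF) (ICst 1))) s2) LO 0 = h + 1.
  by rewrite -E1.
have A2 : ints (run (PI LO (ICst 0) (IAdd (IVar HALF) (ICst 1))) s2) HI 0 = ints s HI 0.
  by rewrite -E2 ints_run.
split.
- exact: ready_run.
- by move=> i; rewrite nums_run.
- by rewrite A1 A2 addn1 h2 hn.
- rewrite A1 A2 expnS mulnA; apply: leq_trans Hk.
  by rewrite leq_mul2r; apply/orP; right; rewrite /h; lia.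
- move=> i; rewrite A1 addn1 ltnS => ih.
  apply: contraFN Hr => /reachesbP H; apply/reachesbP; apply: reaches_mono H => //.
    by rewrite -X0 Xmon //; lia.
  by rewrite Xmon.
- by rewrite A2.
Qed.

Lemma run_bisect os X (s : store R) : breakpoints X -> ready g T os s ->
  (forall i, nums s XS i = X i) ->
  let s' := run p_bisect s in let k := ints s' HI 0 in
  [/\ ready g T os s', forall i, nums s' XS i = X i,
      k <= ne I /\ ints s' FLAG 0 = reachesb (X (ne I)),
      forall i, i < k -> ~~ reachesb (X i) & reachesb (X (ne I)) -> reachesb (X k)].
Proof.
move=> HX Hs Xs; have [Xmon X0 _] := HX.
rewrite /p_bisect 2!run_seq; set s1 := run _ (run _ s).
have Hs1 : ready g T os s1 by do 2!apply: ready_run => //.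
have H1 : ints s1 HI 0 = ne I by rewrite -(std_ne (ready_std Hs)).
have L1 : ints s1 LO 0 = 0 by [].
have X1 : nums s1 XS (ieval s1 (IVar HI)) = X (ne I) by rewrite -H1 -Xs.
have t0 : (0 <= nums s1 XS (ieval s1 (IVar HI)))%R by rewrite X1 -X0 Xmon.
have [Hs2 _ _] := run_try Hs1 t0; rewrite X1.
rewrite run_seq.
have : forall i, nums (run (p_try (IVar HI)) s1) XS i = X i.
  by move=> i; rewrite nums_run // -Xs.
have : ints (run (p_try (IVar HI)) s1) LO 0 = 0 by rewrite ints_run.
have : ints (run (p_try (IVar HI)) s1) HI 0 = ne I by rewrite ints_run.
move: (run (p_try _) s1) Hs2 => s2 Hs2 H2 L2 X2 O2.
rewrite run_seq; set s3 := run _ s2.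
have Hs3 : ready g T os s3 by apply: ready_run.
have F3 : ints s3 FLAG 0 = reachesb (X (ne I)) by rewrite -O2.
have B0 : bisecting os X 0 s3.
  split=> //.
  - by rewrite [ints s3 LO 0]L2 [ints s3 HI 0]H2 leqnn.
  - by rewrite [ints s3 LO 0]L2 [ints s3 HI 0]H2 subn0 expn0 muln1.
  - by rewrite [ints s3 LO 0]L2.
  - by rewrite [ints s3 HI 0]H2.
set s' := run _ s3; set k := ints s' HI 0.
have [Hs' Xs' /andP[lh hn] Hk Hlo Hhi] : bisecting os X (ints s3 4 3) s'.
  apply: (run_for (Inv := bisecting os X)) => //.
    by case: B0; split=> //; apply: ready_seti.
  move=> j s4 s5 _ _ _ _ B E; rewrite E.
  by case: (run_bisect_step HX B); split=> //; apply: ready_seti.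
have F' : ints s' FLAG 0 = ints s3 FLAG 0 by rewrite /s' ints_run.
(* A nonempty interval would have [2 ^ ints s3 4 3 <= ne I], but this power is at least the number
   of vertices, which exceeds the number of edges. *)
have Elh : ints s' LO 0 = k.
  apply/eqP; rewrite eqn_leq lh /= leqNgt; apply/negP => lt.
  have := std_log (ready_std Hs3); have := ne_lt_nv T.
  move: Hk; have : 0 < 2 ^ ints s3 4 3 by rewrite expn_gt0.
  rewrite -/k in lt *; move: lt; rewrite -subn_gt0.
  move: (k - _) => a a0 p0 Hk Hn Hl; have : 2 ^ ints s3 4 3 <= a * 2 ^ ints s3 4 3.
    by rewrite leq_pmull.
  lia.
split=> //; first by rewrite F'.
by rewrite -Elh.
Qed.

Definition least (t : R) :=
  [/\ 0 <= t, reaches r g t & forall t', 0 <= t' -> reaches r g t' -> t <= t']%R.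

(** The answer is the maximum of [lo] and all crossings, described as an upper bound that is
    attained, which is the form a running maximum provides. *)
Lemma least_crossing lo hi t : (0 <= lo)%R -> (lo <= hi)%R ->
  (forall e : E, cost e * cap e <= lo \/ hi <= cost e * cap e)%R ->
  reaches r g hi -> (forall t', 0 <= t' -> reaches r g t' -> lo <= t')%R ->
  (lo <= t)%R -> (forall u, crossing r g lo hi u <= t)%R ->
  t = lo \/ (exists u, t = crossing r g lo hi u) -> least t.
Proof.
move=> lo0 lohi nb rhi rlo lt ct Et.
have th : (t <= hi)%R.
  case: Et => [->//|[u ->]].
  by have /andP[] := crossing_bounds valid_I lo0 lohi nb rhi u.
have RC t' := reaches_crossing valid_I lo0 lohi nb rhi (t := t').
split; first exact: le_trans lt.
  exact/RC.
move=> t' t'0 rt'; have lt' := rlo t' t'0 rt'.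
have [t'h|/ltW ht'] := leP t' hi; last exact: le_trans ht'.
have /RC H := rt'; case: Et => [->//|[u ->]].
exact: H.
Qed.

Lemma run_interpolate os X (s : store R) (k := ints s HI 0) : breakpoints X ->
  ready g T os s -> (forall i, nums s XS i = X i) -> k <= ne I ->
  (forall i, i < k -> ~~ reachesb (X i)) -> reachesb (X k) ->
  least (nums (run p_interpolate s) THR 0).
Proof.
move=> [Xmon X0 Xcov] Hs Xs kn lok hik.
pose lo := X k.-1; pose hi := X k.
have lo0 : (0 <= lo)%R by rewrite -X0 Xmon //; lia.
have lohi : (lo <= hi)%R by rewrite Xmon // leq_pred.
have hi0 := le_trans lo0 lohi.
rewrite /p_interpolate run_seq.
have E1 : nums s XS (ieval s (ISub (IVar HI) (ICst 1))) = lo.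
  by rewrite Xs -[ieval _ _]/(k - 1) subn1.
have H1 : (0 <= nums s XS (ieval s (ISub (IVar HI) (ICst 1))))%R by rewrite E1.
have [] := run_try Hs H1; rewrite E1.
have : forall i, nums (run (p_try (ISub (IVar HI) (ICst 1))) s) XS i = X i.
  by move=> i; rewrite nums_run.
have : ints (run (p_try (ISub (IVar HI) (ICst 1))) s) HI 0 = k by rewrite ints_run.
move: (run (p_try _) s) => s1 Hk1 X1 Hs1 T1 D1 _.
rewrite run_seq; set s2 := run _ s1.
have Hs2 : ready g T os s2 by apply: ready_run.
have T2 : nums s2 TLO 0 = lo by rewrite -T1.
have D2 (v : V) : nums s2 DEP v = dist (new_len (shift (P r g) lo)) r v.
  by rewrite nums_run.
rewrite run_seq; set s3 := run _ s2.
have Hs3 : ready g T os s3 by apply: ready_run.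
have D3 (v : V) : nums s3 DEPLO v = dist (new_len (shift (P r g) lo)) r v.
  have H : forall v : V, v < ints s2 4 0 -> nums s3 DEPLO v = dist (new_len (shift (P r g) lo)) r v.
    apply: (run_for (Inv := fun i s => forall v : V, v < i ->
       nums s DEPLO v = dist (new_len (shift (P r g) lo)) r v)) => //.
    move=> i s' s4 Hi Ei F1 F2 IH E u; rewrite ltnS leq_eqVlt => Hu.
    have -> : nums (seti CTR 0 i.+1 s4) DEPLO u =
        put (nums s' DEPLO) i (nums s' DEP i) u by rewrite -Ei E.
    by rewrite putE; case: eqP Hu => [<- _|_ /= /IH //]; rewrite F2.
  by apply: H; rewrite (std_nv (ready_std Hs2)).
have T3 : nums s3 TLO 0 = lo by rewrite nums_run.
have X3 i : nums s3 XS i = X i by rewrite !nums_run.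
have Hk3 : ints s3 HI 0 = k by rewrite !ints_run.
move: s3 Hs3 D3 T3 X3 Hk3 => s3 Hs3 D3 T3 X3 Hk3 {s1 Hk1 X1 Hs1 T1 D1 s2 Hs2 T2 D2}.
rewrite run_seq.
have E3 : nums s3 XS (ieval s3 (IVar HI)) = hi by rewrite X3 [ieval _ _]Hk3.
have H3 : (0 <= nums s3 XS (ieval s3 (IVar HI)))%R by rewrite E3.
have [] := run_try Hs3 H3; rewrite E3.
have : nums (run (p_try (IVar HI)) s3) TLO 0 = lo by rewrite nums_run.
have : forall v : V, nums (run (p_try (IVar HI)) s3) DEPLO v =
   dist (new_len (shift (P r g) lo)) r v by move=> v; rewrite nums_run.
move: (run (p_try _) s3) => s4 D4lo T4lo Hs4 T4 D4 _.
rewrite 2!run_seq; set s5 := run _ (run _ s4).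
have Hs5 : ready g T os s5 by do 2!apply: ready_run => //.
have A1 : nums s5 THI 0 = hi by rewrite -T4.
have A2 : nums s5 TLO 0 = lo by rewrite -T4lo.
have A3 : nums s5 THR 0 = lo by rewrite -T4lo.
have A4 (v : V) : nums s5 DEPLO v = dist (new_len (shift (P r g) lo)) r v by rewrite -D4lo.
have A5 (v : V) : nums s5 DEP v = dist (new_len (shift (P r g) hi)) r v by rewrite -D4.
move: s5 Hs5 A1 A2 A3 A4 A5 => s5 Hs5 A1 A2 A3 A4 A5.
pose cr u := crossing r g lo hi u.
pose Inv i (s' : store R) := let t := nums s' THR 0 in
  [/\ (lo <= t)%R, forall u : V, u < i -> (cr u <= t)%R & t = lo \/ exists u, t = cr u].
have [I1 I2 I3] : Inv (ints s5 4 0) (run (PFor CTR 0 p_cross_step) s5).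
  apply: (run_for (Inv := Inv)) => //.
    by rewrite /Inv -[nums _ _ _]/(nums s5 THR 0) A3; split=> //; left.
  move=> i s' s6; rewrite (std_nv (ready_std Hs5)) => Hi Ei F1 F2 [I1 I2 I3] E.
  pose x : V := Ordinal Hi.
  have gl : ints s' GOAL 0 = g by rewrite F1 // (ready_goal Hs5).
  have sl : reval s' slack_lo = slack r g lo x.
    rewrite -[LHS]/(nums s' DEPLO (ints s' GOAL 0) - nums s' DEPLO (ints s' CTR 0))%R.
    by rewrite gl Ei !F2 // A4 (A4 x).
  have sh : reval s' slack_hi = slack r g hi x.
    rewrite -[LHS]/(nums s' DEP (ints s' GOAL 0) - nums s' DEP (ints s' CTR 0))%R.
    by rewrite gl Ei !F2 // A5 (A5 x).
  have E6 : nums s6 THR 0 = Num.max (nums s' THR 0%N) (cr x).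
    rewrite E /p_cross_step run_if run_skip.
    rewrite -[beval s' _]/(~~ (0 <= reval s' slack_lo))%R -ltNge sl /cr /crossing.
    case: ifP => _; last by rewrite max_l.
    rewrite run_seq; set c := RAdd _ _; set s7 := run _ s'.
    have -> : (lo + (hi - lo) * - slack r g lo x / (slack r g hi x - slack r g lo x))%R
        = nums s7 CAND 0.
      rewrite -[RHS]/(nums s' TLO 0%N + (nums s' THI 0%N - nums s' TLO 0%N) *
        (0 - reval s' slack_lo) / (reval s' slack_hi - reval s' slack_lo))%R.
      by rewrite !F2 // A1 A2 sl sh sub0r.
    rewrite run_if run_skip -[beval s7 _]/(nums s' THR 0%N <= nums s7 CAND 0%N)%R.
    by case: leP.
  rewrite /Inv -[nums (seti _ _ _ _) _ _]/(nums s6 THR 0) E6; split.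
  - by rewrite le_max I1.
  - move=> u; rewrite ltnS leq_eqVlt => /orP[/eqP Eu|/I2 H]; rewrite le_max.
      by rewrite (_ : u = x) ?lexx ?orbT //; apply: val_inj.
    by rewrite H.
  - by case: leP => _; [right; exists x|].
apply: (least_crossing lo0 lohi) => //.
- by move=> e; have [i ie <-] := Xcov e; have [ik|ki] := ltnP i k; [left|right];
    apply: Xmon => //; lia.
- exact/reachesbP.
(* For [k = 0] the lower end is 0; otherwise the preceding breakpoint fails, and by monotonicity so
   does every smaller threshold. *)
- move=> t' t'0 rt'; rewrite /lo; case: (posnP k) => [->|k0]; first by rewrite X0.
  rewrite leNgt; apply/negP => lt; have := lok k.-1; rewrite prednK // => /(_ (leqnn _)).
  by move/negP; apply; apply/reachesbP; apply: reaches_mono (ltW lt) rt'.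
- by move=> u; apply: I2; rewrite (std_nv (ready_std Hs5)).
Qed.

(** Beyond the largest breakpoint nothing can improve: every admissible modification already costs
    at most that much on each edge. So failure there means failure for all thresholds. *)
Lemma run_search os X (s : store R) : breakpoints X -> ready g T os s ->
  (forall i, nums s XS i = X i) ->
  let s' := run p_search s in
  if ints s' FLAG 0 == 1 then least (nums s' THR 0)
  else forall t, (0 <= t)%R -> ~ reaches r g t.
Proof.
move=> HX Hs Xs; have [Xmon X0 Xcov] := HX.
have := run_bisect HX Hs Xs; rewrite /p_search run_seq.
move: (run p_bisect s) => s1 /= [Hs1 X1 [kn F1] lok hik].
rewrite ints_run // F1 eqb1; case: ifP => [H|/negbT H].
  exact: (run_interpolate HX Hs1 X1 kn lok (hik H)).
move=> t t0 rt; case/negP: H; apply/reachesbP.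
have [tX|Xt] := leP t (X (ne I)); first exact: reaches_mono tX rt.
have XN : (0 <= X (ne I))%R by rewrite -X0 Xmon.
apply: (reaches_max valid_I _ _ _ rt) => //; first exact: shift_admissible.
move=> e; have [i ie Ei] := Xcov e; apply: le_trans (Xmon i (ne I) ie (leqnn _)).
have [_ _ [_ c0] _] := valid_I.
by rewrite Ei ler_wpM2l //; have /andP[] := shift_bounds valid_I (P r g) e t0.
Qed.

End Search.

(** * Combining the four conditions *)

Definition p_prepare : prog := PSeq p_root p_path.

Definition p_goto (r g : iexp) : prog := PSeq (PI ROOT (ICst 0) r) (PI GOAL (ICst 0) g).

(** [ONP] is indexed by lower end vertices, which change with the root. The marks of P(a, b) are
    transferred to edges so that they survive rerooting. *)
Definition p_mark : prog :=
  PFor CTR 2 (PI INP (IGet PE (IGet ORD (IVar CTR))) (IGet ONP (IGet ORD (IVar CTR)))).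

Definition p_cap_step : prog :=
  PSeq (PIf (IEq (IGet INP (IVar CTR)) (ICst 1))
          (PR CAP (IVar CTR) (RGet BOUND (IVar CTR)))
          (PIf (RLe (RGet BOUND (IVar CTR)) (RGet LEN (IVar CTR)))
             (PR CAP (IVar CTR) (RGet BOUND (IVar CTR)))
             (PR CAP (IVar CTR) (RGet LEN (IVar CTR)))))
       (PR XS (IVar CTR) (RMul (RGet COST (IVar CTR)) (RGet CAP (IVar CTR)))).

Definition p_caps : prog :=
  PSeq (PFor CTR 1 p_cap_step) (PR XS (IGet CONST (ICst 1)) (RCst 0)).

Definition p_setup : prog :=
  PSeqs [:: p_goto LEAFA LEAFB; p_prepare; p_mark; p_caps; p_sort].

Definition p_record (k : nat) : prog :=
  PSeqs [:: PI FLAGS (ICst k) (IVar FLAG); PI GATES (ICst k) (IVar GATE);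
            PR RES (ICst k) (RVar THR)].

Definition p_solve (k : nat) (r g : iexp) : prog :=
  PSeqs [:: p_goto r g; p_prepare; p_gate; p_search; p_record k].

Definition p_best (t : rexp) (r g : iexp) : prog :=
  PSeqs [:: PI FOUND (ICst 0) (ICst 1); PI BROOT (ICst 0) r; PI BGOAL (ICst 0) g;
            PR BEST (ICst 0) t].

(** The initial [p_best] stores proper vertices even if this case fails, because [p_output] roots
    the tree at [BROOT] in any event. *)
Definition p_choose_diameter : prog :=
  PSeqs [:: p_best (RCst 0) LEAFA LEAFB;
    PIf (BAnd (IEq (IGet FLAGS (ICst 0)) (ICst 1)) (IEq (IGet FLAGS (ICst 1)) (ICst 1)))
      (PIf (RLe (RGet RES (ICst 0)) (RGet RES (ICst 1)))
         (p_best (RGet RES (ICst 1)) LEAFA LEAFB)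
         (p_best (RGet RES (ICst 0)) LEAFA LEAFB))
      (PI FOUND (ICst 0) (ICst 0))].

Definition p_offer (k : nat) (r g : iexp) : prog :=
  PIf (BAnd (IEq (IGet FLAGS (ICst k)) (ICst 1))
            (BNot (BAnd (IEq (IVar FOUND) (ICst 1))
                        (BNot (RLe (RGet RES (ICst k)) (RVar BEST))))))
      (p_best (RGet RES (ICst k)) r g) PSkip.

Definition p_scan_weights : prog :=
  PSeq (PI EMPTY (ICst 0) (ICst 1))
    (PFor CTR 0 (PIf (RLe (RGet WEIGHT (IVar CTR)) (RCst 0)) PSkip (PI EMPTY (ICst 0) (ICst 0)))).

(** Without positive weights the gates mean nothing, but then every admissible modification is
    feasible and threshold 0 gives cost 0. *)
Definition p_empty : prog :=
  PSeq p_scan_weights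
    (PIf (IEq (IVar EMPTY) (ICst 1)) (p_best (RCst 0) LEAFA LEAFB) PSkip).

Definition p_output : prog :=
  PSeqs [:: PI ANSWER (ICst 0) (IVar FOUND); p_goto (IVar BROOT) (IVar BGOAL);
    PR THR (ICst 0) (RVar BEST); p_prepare;
    PFor CTR 2 (PSeqs [:: PI TV (ICst 0) (IGet ORD (IVar CTR)); p_shift;
                          PR SOLUTION (IGet PE (IVar TV)) (RVar SHIFT)])].

(** The gate found while the tree is rooted at a leaf is the one towards that leaf, so the first two
    searches supply the start vertices of the other two. *)
Definition p_main : prog :=
  PSeqs [:: p_setup;
    p_solve 0 LEAFA LEAFB; p_solve 1 LEAFB LEAFA;
    p_solve 2 (IGet GATES (ICst 0)) LEAFA; p_solve 3 (IGet GATES (ICst 1)) LEAFB;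
    p_choose_diameter;
    p_offer 2 (IGet GATES (ICst 0)) LEAFA; p_offer 3 (IGet GATES (ICst 1)) LEAFB;
    p_empty; p_output].

Section Main.
Variables (R : realFieldType) (I : problem R).
Hypothesis valid_I : valid I.
Local Notation V := 'I_(nv I).
Local Notation E := 'I_(ne I).
Local Notation a := (leaf_a I).
Local Notation b := (leaf_b I).

Definition std_leaves (s : store R) := std I s /\ (ints s 0 2 = a /\ ints s 0 3 = b).

Lemma std_leaves_run p s : keeps [:: 0; 1; 2; 4] [:: 0; 1; 2; 3] p ->
  std_leaves s -> std_leaves (run p s).
Proof.
case/andP=> /allP Hi Hr [Hs [Ha Hb]]; split.
  apply: std_run Hs; apply/andP; split=> //; apply/allP => A HA; apply: Hi.
  by rewrite inE HA orbT.
by rewrite !ints_run ?Hi.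
Qed.

Record based (X : nat -> R) (s : store R) : Prop := Based {
  based_std : std_leaves s;
  based_in : forall e : E, ints s INP e = (e \in P a b);
  based_cap : forall e : E, nums s CAP e = cap e;
  based_breaks : forall i, nums s XS i = X i }.

Lemma based_run X p s : keeps [:: 0; 1; 2; 4; INP] [:: 0; 1; 2; 3; CAP; XS] p ->
  based X s -> based X (run p s).
Proof.
case/andP=> /allP Hi /allP Hr [Hs Hn Hc Hx]; split.
- apply: std_leaves_run => //; apply/andP; split; apply/allP => A HA; [apply: Hi|apply: Hr];
  by move: HA; rewrite !inE; do ?[case/orP]; move/eqP->.
- by move=> e; rewrite ints_run ?Hi.
- by move=> e; rewrite nums_run ?Hr.
- by move=> i; rewrite nums_run ?Hr.
Qed.

Lemma run_prepare_std s (r g : V) (T : rooted r) : std I s ->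
  ints s ROOT 0 = r -> ints s GOAL 0 = g ->
  exists os, rooted_store T (run p_prepare s) os /\
    forall v, v != r -> ints (run p_prepare s) ONP v = (pe T v \in P r g).
Proof.
move=> Hs Hr Hg; have [os Hos] := run_root valid_I T Hs Hr; exists os.
rewrite /p_prepare run_seq; set s1 := run p_root s in Hos *.
have Hs1 : std I s1 by apply: std_run.
have Hg1 : ints s1 GOAL 0 = g by rewrite ints_run.
by split; [exact: rooted_run|exact: run_path Hs1 Hos Hg1].
Qed.

Lemma run_prepare X s (r g : V) (T : rooted r) : based X s ->
  ints s ROOT 0 = r -> ints s GOAL 0 = g -> exists os, ready g T os (run p_prepare s).
Proof.
move=> Hs Hr Hg; have [[Hstd _] Hn Hc _] := Hs.
have [os [Hos Hon]] := run_prepare_std T Hstd Hr Hg; exists os.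
split=> //; first exact: std_run.
- by rewrite ints_run.
- by rewrite ints_run.
- by move=> e; rewrite ints_run.
- by move=> e; rewrite nums_run.
Qed.

Lemma run_mark (s : store R) (r : V) (T : rooted r) os :
  std I s -> rooted_store T s os ->
  (forall v, v != r -> ints s ONP v = (pe T v \in P a b)) ->
  forall e : E, ints (run p_mark s) INP e = (e \in P a b).
Proof.
move=> Hs [Uos [Sos Mos] _ Ho Hp] Hon e.
pose Inv k (s' : store R) := forall i, i < k -> i < size os ->
  ints s' INP (pe T (nth r os i)) = (pe T (nth r os i) \in P a b).
have H : Inv (ints s 4 2) (run p_mark s).
  apply: (run_for (Inv := Inv)) => //.
  move=> k s' s1; rewrite (std_pred Hs) -Sos => Hk Ek F1 F2 IH E i; rewrite ltnS => ik iS.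
  pose x := nth r os k.
  have xr : x != r by rewrite -Mos mem_nth.
  have Ex : ints s' ORD (ints s' CTR 0) = x by rewrite Ek F1 // Ho.
  have Ee : ints s' PE x = pe T x by have [_ <-] := Hp x xr; rewrite F1.
  have Eo : ints s' ONP x = (pe T x \in P a b) by rewrite F1 // Hon.
  have -> : ints (seti CTR 0 k.+1 s1) INP (pe T (nth r os i)) =
     put (ints s' INP) (ints s' PE (ints s' ORD (ints s' CTR 0)))
       (ints s' ONP (ints s' ORD (ints s' CTR 0))) (pe T (nth r os i)) by rewrite E.
  rewrite putE Ex Ee Eo (val_eqE (pe T _) (pe T x)).
  case: eqP => [->//|ne]; apply: IH => //.
  rewrite ltn_neqAle ik andbT; apply: contra_not_neq ne => ->; reflexivity.
have [c cr <-] := pe_surj T e.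
have cos : c \in os by rewrite Mos.
have := H (index c os); rewrite nth_index //; apply; last by rewrite index_mem.
by rewrite (std_pred Hs) -Sos index_mem.
Qed.

Lemma run_caps (s : store R) : std I s ->
  (forall e : E, ints s INP e = (e \in P a b)) ->
  (forall e : E, nums (run p_caps s) CAP e = cap e) /\
  (forall e : E, nums (run p_caps s) XS e = (cost e * cap e)%R) /\
  nums (run p_caps s) XS (ne I) = 0%R.
Proof.
move=> Hs Hin; rewrite /p_caps run_seq; set s1 := run _ s.
have H : forall e : E, e < ints s 4 1 ->
    nums s1 CAP e = cap e /\ nums s1 XS e = (cost e * cap e)%R.
  apply: (run_for (Inv := fun k s => forall e : E, e < k ->
    nums s CAP e = cap e /\ nums s XS e = (cost e * cap e)%R)) => //.
  move=> k s' s2; rewrite (std_ne Hs) => Hk Ek F1 F2 IH Es e; rewrite ltnS leq_eqVlt => He.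
  pose x : E := Ordinal Hk.
  have [E1 E2] : nums s2 CAP e = put (nums s' CAP) k (cap x) e /\
     nums s2 XS e = put (nums s' XS) k (cost x * cap x)%R e.
    rewrite Es /p_cap_step run_seq run_if beval_IEq run_if.
    rewrite -[ieval s' _]/(ints s' INP (ints s' CTR 0)).
    rewrite -[beval s' _]/(nums s' 2 (ints s' CTR 0%N) <= nums s' 1 (ints s' CTR 0%N))%R.
    have Hx : ints s' INP (ints s' CTR 0) = (x \in P a b) by rewrite Ek F1 // (Hin x).
    rewrite Hx eqb1.
    have Hl : nums s' 1 (ints s' CTR 0) = len x by rewrite Ek F2 // (std_len Hs x).
    have Hb : nums s' 2 (ints s' CTR 0) = bound x by rewrite Ek F2 // (std_bound Hs x).
    have Hc : nums s' 3 (ints s' CTR 0) = cost x by rewrite Ek F2 // (std_cost Hs x).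
    rewrite Hl Hb.
    have store_cap z (s3 := run (PR CAP (IVar CTR) z) s') : reval s' z = cap x ->
      nums (run (PR XS (IVar CTR) (RMul (RGet COST (IVar CTR)) (RGet CAP (IVar CTR)))) s3) CAP e =
         put (nums s' CAP) k (cap x) e /\
      nums (run (PR XS (IVar CTR) (RMul (RGet COST (IVar CTR)) (RGet CAP (IVar CTR)))) s3) XS e =
         put (nums s' XS) k (cost x * cap x)%R e.
      move=> <-; rewrite -Hc -Ek; split=> //.
      rewrite -[LHS]/(put (nums s' XS) (ints s' CTR 0) (nums s' 3 (ints s' CTR 0%N) *
        put (nums s' CAP) (ints s' CTR 0%N) (reval s' z) (ints s' CTR 0%N))%R e).
      by rewrite !putE eqxx.
    rewrite /cap in store_cap *; case: ifP store_cap => _ store_cap; first by apply: store_cap; rewrite -Hb.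
    case: ifP => H; apply: store_cap.
      by rewrite min_l // -Hb.
    by rewrite min_r -?Hl // ltW // ltNge Hl H.
  rewrite -[nums (seti _ _ _ _) CAP _]/(nums s2 CAP e) -[nums (seti _ _ _ _) XS _]/(nums s2 XS e).
  rewrite E1 E2 !putE; case: eqP He => [Ee _|_ /= He]; last exact: IH.
  by rewrite (_ : e = x) //; apply: val_inj.
have E0 i : nums (run (PR XS (IGet CONST (ICst 1)) (RCst 0)) s1) XS i =
   put (nums s1 XS) (ints s1 4 1) 0%R i by [].
have E4 : ints s1 4 1 = ne I by rewrite ints_run // (std_ne Hs).
split=> [e|]; last split=> [e|].
- rewrite nums_run //; have [] // := H e; by rewrite (std_ne Hs).
- rewrite E0 putE E4 ltn_eqF //; have [] // := H e; by rewrite (std_ne Hs).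
- by rewrite E0 putE E4 eqxx.
Qed.

Lemma run_setup (s : store R) : std_leaves s ->
  exists2 X, breakpoints I X & based X (run p_setup s).
Proof.
move=> Hs; have [_ [Ha Hb]] := Hs; have [T] := rooted_exists valid_I a.
have [_ _ [_ cost_ge0] _] := valid_I.
rewrite /p_setup run_seq; set s1 := run _ s.
have Hs1 : std_leaves s1 by apply: std_leaves_run.
have Hr1 : ints s1 ROOT 0 = a by rewrite -Ha.
have Hg1 : ints s1 GOAL 0 = b by rewrite -Hb.
have [os [Hos Hon]] := run_prepare_std T (proj1 Hs1) Hr1 Hg1.
rewrite run_seq; set s2 := run p_prepare s1 in Hos Hon *.
have Hs2 : std_leaves s2 by apply: std_leaves_run.
have Hin := run_mark (proj1 Hs2) Hos Hon.
rewrite run_seq; set s3 := run p_mark s2 in Hin *.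
have Hs3 : std_leaves s3 by apply: std_leaves_run.
have [Hcap [Hx Hx0]] := run_caps (proj1 Hs3) Hin.
rewrite run_seq; set s4 := run p_caps s3 in Hcap Hx Hx0 *.
have Hs4 : std_leaves s4 by apply: std_leaves_run.
have Hin4 (e : E) : ints s4 INP e = (e \in P a b) by rewrite ints_run.
have Hm : ints s4 4 4 = (ne I).+1 by rewrite (std_breaks (proj1 Hs4)).
have Hlog : (ne I).+1 <= 2 ^ ints s4 4 3.
  exact: leq_trans (ne_lt_nv T) (std_log (proj1 Hs4)).
have := run_sort Hm Hlog.
rewrite -[run _ s4]/(run p_sort s4) => -[Ymon C1 C2].
have X_ge0 i : i < (ne I).+1 -> (0 <= nums s4 XS i)%R.
  rewrite ltnS leq_eqVlt => /orP[/eqP->|Hi]; first by rewrite Hx0.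
  by rewrite (Hx (Ordinal Hi)) mulr_ge0 // cap_ge0.
exists (nums (run p_sort s4) XS).
  split=> //.
  (* All breakpoints are non-negative and the appended 0 is one of the sorted values, so it has
     moved to the front. *)
  - apply/eqP; rewrite eq_le; apply/andP; split; last first.
      by have [j jm <-] := C2 0 (ltn0Sn _); apply: X_ge0.
    have [j jm] := C1 (ne I) (ltnSn _); rewrite Hx0 => <-.
    exact: Ymon.
  - move=> e; have [j jm Ej] := C1 e (ltnW (ltn_ord e)).
    by exists j; rewrite // Ej Hx.
split=> //.
- exact: std_leaves_run.
- by move=> e; rewrite ints_run.
- by move=> e; rewrite nums_run.
Qed.

Definition outcome (r g : V) (f : nat) (t : R) : Prop :=
  if f == 1 then least r g t else forall t', (0 <= t')%R -> ~ reaches r g t'.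

(** The expression for the goal is evaluated after [ROOT] has been overwritten, hence in the updated
    store. *)
Lemma run_solve X k er eg (r g : V) s : breakpoints I X -> based X s ->
  ieval s er = r -> ieval (seti ROOT 0 r s) eg = g ->
  let s' := run (p_solve k er eg) s in
  [/\ based X s', outcome r g (ints s' FLAGS k) (nums s' RES k),
      exists2 x : V, ints s' GATES k = x & (exists v : V, 0 < weight v)%R -> gate x r
    & forall j, j != k -> [/\ ints s' FLAGS j = ints s FLAGS j,
        ints s' GATES j = ints s GATES j & nums s' RES j = nums s RES j]].
Proof.
move=> HX Hs Er Eg; have [T] := rooted_exists valid_I r.
rewrite /p_solve run_seq; set s1 := run _ s.
have Hs1 : based X s1 by apply: based_run.
have Hr1 : ints s1 ROOT 0 = r by rewrite -Er.
have Hg1 : ints s1 GOAL 0 = g by rewrite -Eg -Er.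
have [os Hos] := run_prepare T Hs1 Hr1 Hg1.
rewrite run_seq; set s2 := run p_prepare s1 in Hos *.
have Hs2 : based X s2 by apply: based_run.
have [x Hx gx] := run_gate valid_I (ready_std Hos) (ready_rooted Hos) (ready_root Hos).
rewrite run_seq; set s3 := run p_gate s2 in Hx *.
have Hos3 : ready g T os s3 by apply: ready_run.
have Hs3 : based X s3 by apply: based_run.
have := run_search valid_I HX Hos3 (based_breaks Hs3).
have : ints (run p_search s3) GATE 0 = x by rewrite ints_run.
have : based X (run p_search s3) by apply: based_run.
have : forall j, [/\ ints (run p_search s3) FLAGS j = ints s FLAGS j,
        ints (run p_search s3) GATES j = ints s GATES j &
        nums (run p_search s3) RES j = nums s RES j].
  by move=> j; rewrite !ints_run // !nums_run.
rewrite run_seq; move: (run p_search s3) => s4 F4 Hs4 G4 S4.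
set s5 := run _ s4.
have E1 j : ints s5 FLAGS j = put (ints s4 FLAGS) k (ints s4 FLAG 0) j by [].
have E2 j : ints s5 GATES j = put (ints s4 GATES) k (ints s4 GATE 0) j by [].
have E3 j : nums s5 RES j = put (nums s4 RES) k (nums s4 THR 0%N) j by [].
split.
- exact: based_run.
- by rewrite E1 E3 !putE eqxx; exact: S4.
- by exists x => //; rewrite E2 putE eqxx G4.
- move=> j /negbTE jk; have [F5 G5 R5] := F4 j.
  by rewrite E1 E2 E3 !putE jk.
Qed.

Definition case_diameter (y : E -> R) := far (new_len y) a b /\ far (new_len y) b a.
Definition case_target (g : V) (y : E -> R) :=
  forall v, (0 < weight v)%R -> far (new_len y) v g.

Lemma feasibleE y : feasible y <->
  admissible y /\ [\/ case_diameter y, case_target a y | case_target b y].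
Proof.
split=> [[H1 H2]|[[H1 H2] C]].
  by move=> /(maxian_ecc valid_I H2) /(ecc_cases valid_I H2).
by split=> //; apply/(maxian_ecc valid_I H2)/(ecc_cases valid_I H2).
Qed.

Local Notation cheb := (@chebyshev_cost R I).

Lemma chebyshev_ge0 (y : E -> R) : (0 <= cheb y)%R.
Proof. exact: bigmax_ge_id. Qed.

Lemma chebyshev_ge (y : E -> R) e : (cost e * y e <= cheb y)%R.
Proof. exact: le_bigmax. Qed.

Lemma chebyshev_shift Q t : (0 <= t)%R -> (cheb (shift Q t) <= t)%R.
Proof. by move=> t0; apply: bigmax_le => // e _; apply: shift_cost. Qed.

Lemma outcome_le r g f t y : outcome r g f t -> feasible y -> far (new_len y) r g ->
  f = 1 /\ (t <= cheb y)%R.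
Proof.
move=> O [H1 H2 _] fy.
have ry : reaches r g (cheb y).
  apply: (reaches_max valid_I _ _ _ fy) => //; [exact: chebyshev_ge|exact: chebyshev_ge0].
move: O; rewrite /outcome; case: eqP => [->|_] H.
  by have [_ _ ->] := H; rewrite ?chebyshev_ge0.
by case: (H _ (chebyshev_ge0 y)).
Qed.

(* The candidate is the shift along [P r g] by the threshold in [BEST], and it
   exists iff [FOUND] holds 1. *)
Definition best_for (C : (E -> R) -> Prop) (s : store R) (r g : V) :=
  [/\ ints s BROOT 0 = r, ints s BGOAL 0 = g, ints s FOUND 0 <= 1,
      ints s FOUND 0 = 1 -> (0 <= nums s BEST 0%N)%R /\ feasible (shift (P r g) (nums s BEST 0%N))
    & forall y, feasible y -> C y ->
        ints s FOUND 0 = 1 /\ (nums s BEST 0%N <= cheb y)%R].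

(** P(a, b) and P(b, a) have the same edges, so both conditions concern the same family of shifts.
    Being monotone, they hold together from the larger least threshold on. *)
Lemma run_choose_diameter s : std_leaves s ->
  outcome a b (ints s FLAGS 0) (nums s RES 0) ->
  outcome b a (ints s FLAGS 1) (nums s RES 1) ->
  best_for case_diameter (run p_choose_diameter s) a b.
Proof.
move=> [_ [Ha Hb]] O1 O2.
have le1 y : feasible y -> case_diameter y -> [/\ ints s FLAGS 0 = 1, ints s FLAGS 1 = 1,
    (nums s RES 0%N <= cheb y)%R & (nums s RES 1%N <= cheb y)%R].
  move=> fy [f1 f2]; have [-> ->] := outcome_le O1 fy f1.
  by have [-> ->] := outcome_le O2 fy f2.
rewrite /p_choose_diameter run_seq; set s1 := run _ s.
rewrite run_if.
rewrite -[beval s1 _]/(beval s (IEq (IGet FLAGS (ICst 0)) (ICst 1)) &&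
                       beval s (IEq (IGet FLAGS (ICst 1)) (ICst 1))) !beval_IEq.
rewrite -[ieval s (IGet FLAGS (ICst 0))]/(ints s FLAGS 0).
rewrite -[ieval s (IGet FLAGS (ICst 1))]/(ints s FLAGS 1).
rewrite -[ieval s (ICst 1)]/1.
case: ifP => [/andP[/eqP F1 /eqP F2]|F]; last first.
  split=> //.
  move=> y fy dy; have [F1 F2 _ _] := le1 y fy dy.
  by rewrite F1 F2 in F.
move: O1 O2; rewrite /outcome F1 F2 /= => -[t0 r0 _] [t1 r1 _].
rewrite run_if -[beval s1 _]/(nums s RES 0%N <= nums s RES 1%N)%R.
set s2 := if _ then _ else _.
have E2 : nums s2 BEST 0 = Num.max (nums s RES 0%N) (nums s RES 1%N).
  by rewrite /s2; case: leP.
have E3 : ints s2 BROOT 0 = a by rewrite -Ha /s2; case: ifP.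
have E4 : ints s2 BGOAL 0 = b by rewrite -Hb /s2; case: ifP.
have E5 : ints s2 FOUND 0 = 1 by rewrite /s2; case: ifP.
have m0 : (0 <= Num.max (nums s RES 0%N) (nums s RES 1%N))%R by rewrite le_max t0.
split=> //; rewrite ?E5 //.
- move=> _; rewrite E2; split=> //; apply/feasibleE; split; first exact: shift_admissible.
  constructor 1; split.
    by apply: reaches_mono r0 => //; rewrite le_max lexx.
  rewrite (PC valid_I a b).
  by apply: reaches_mono r1 => //; rewrite le_max lexx orbT.
- by move=> y fy dy; have [_ _ H1 H2] := le1 y fy dy; rewrite E2 ge_max H1 H2.
Qed.

(** Each candidate's threshold is a lower bound for the cost in its own case, so the smaller
    threshold is a lower bound for both cases. *)
Lemma run_offer k er eg (C D : (E -> R) -> Prop) s (r g r0 g0 : V) :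
  best_for C s r0 g0 -> outcome r g (ints s FLAGS k) (nums s RES k) ->
  (forall y, admissible y -> D y <-> far (new_len y) r g) ->
  (forall y, D y -> admissible y -> feasible y) ->
  ieval (seti FOUND 0 1 s) er = r -> ieval (seti BROOT 0 r (seti FOUND 0 1 s)) eg = g ->
  exists r1 g1 : V, best_for (fun y => C y \/ D y) (run (p_offer k er eg) s) r1 g1.
Proof.
move=> [B1 B2 B3 B4 B5] O DE Df Er Eg; rewrite /p_offer run_if run_skip.
rewrite -[beval s _]/(beval s (IEq (IGet FLAGS (ICst k)) (ICst 1)) &&
  ~~ (beval s (IEq (IVar FOUND) (ICst 1)) && ~~ (nums s RES k <= nums s BEST 0%N)%R)).
rewrite !beval_IEq -ltNge.
rewrite -[ieval s (IGet FLAGS (ICst k))]/(ints s FLAGS k).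
rewrite -[ieval s (IVar FOUND)]/(ints s FOUND 0) -[ieval s (ICst 1)]/1.
have Dle y : feasible y -> D y ->
    ints s FLAGS k = 1 /\ (nums s RES k <= cheb y)%R.
  move=> fy dy; have /feasibleE[adm _] := fy.
  by apply: (outcome_le O fy); apply (DE y adm).
case: ifP => [/andP[/eqP F1 F2]|F]; last first.
  exists r0, g0; split=> // y fy [Cy|Dy]; first exact: B5.
  have [F1 F2] := Dle y fy Dy; move: F; rewrite F1 /= => /negbFE/andP[/eqP -> lt].
  by split=> //; apply: le_trans (ltW lt) F2.
exists r, g; move: O; rewrite /outcome F1 /= => -[t0 rt _].
set s1 := run _ s.
have E1 : ints s1 FOUND 0 = 1 by [].
have E2 : ints s1 BROOT 0 = r by rewrite -Er.
have E3 : ints s1 BGOAL 0 = g by rewrite -Eg -Er.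
have E4 : nums s1 BEST 0 = nums s RES k by [].
split=> //.
- move=> _; rewrite E4; split=> //.
  have adm := shift_admissible valid_I (P r g) t0.
  by apply: Df => //; apply (DE _ adm).
- move=> y fy [Cy|Dy]; last by have [_ ?] := Dle y fy Dy.
  rewrite E1 E4; split=> //; have [G1 G2] := B5 y fy Cy.
  by move: F2; rewrite G1 eqxx /= -leNgt => /le_trans; apply.
Qed.

Lemma run_empty s : std I s -> run p_empty s =
  if [forall v : V, ~~ (0 < weight v)%R]
  then run (p_best (RCst 0) LEAFA LEAFB) (run p_scan_weights s) else run p_scan_weights s.
Proof.
move=> Hs; rewrite /p_empty run_seq run_if beval_IEq run_skip.
rewrite /p_scan_weights run_seq; set s1 := run _ s; set p := PFor _ _ _.
pose Inv k (s' : store R) := ints s' EMPTY 0 = [forall v : V, (v < k) ==> ~~ (0 < weight v)%R].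
have H : Inv (ints s1 4 0) (run p s1).
  apply: (run_for (Inv := Inv)) => //.
    by rewrite /Inv (_ : [forall v : V, _] = true) //; apply/forallP.
  move=> k s' s2; rewrite [ints s1 4 0](std_nv Hs) => Hk Ek F1 F2 IH Es.
  pose x : V := Ordinal Hk.
  have E1 : ints s2 EMPTY 0 = if (weight x <= 0)%R then ints s' EMPTY 0 else 0.
    rewrite Es run_if run_skip -[beval s' _]/(nums s' 0 (ints s' CTR 0%N) <= 0)%R.
    by rewrite Ek F2 // [nums s1 0 k](std_weight Hs x); case: ifP.
  rewrite /Inv -[ints (seti _ _ _ _) _ _]/(ints s2 EMPTY 0) E1 IH leNgt.
  case: ifP => dx; last first.
    suff -> : [forall v : V, (v < k.+1) ==> ~~ (0 < weight v)%R] = false by [].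
    by apply/negbTE/forallPn; exists x; rewrite ltnSn /= dx.
  congr (nat_of_bool _); apply: eq_forallb => v; rewrite ltnS [v <= k]leq_eqVlt.
  have [Ev|//] := eqVneq (nat_of_ord v) k.
  by rewrite (_ : v = x) ?dx ?implybT //; apply: val_inj.
rewrite [ieval _ (IVar EMPTY)]H [ints s1 4 0](std_nv Hs) -[ieval _ (ICst 1)]/1 eqb1.
rewrite (eq_forallb (P2 := fun v : V => ~~ (0 < weight v)%R)) //.
by move=> v; rewrite ltn_ord.
Qed.

Lemma run_output X s (r g : V) : based X s ->
  ints s BROOT 0 = r -> ints s BGOAL 0 = g ->
  ints (run p_output s) 3 0 = ints s FOUND 0 /\
  forall e : E, nums (run p_output s) 4 e = shift (P r g) (nums s BEST 0%N) e.
Proof.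
move=> Hs Hr Hg; have [T] := rooted_exists valid_I r.
rewrite /p_output run_seq; set s1 := run _ s.
have Hs1 : based X s1 by apply: based_run.
rewrite run_seq; set s2 := run (p_goto _ _) s1.
have Hs2 : based X s2 by apply: based_run.
rewrite run_seq; set s3 := run _ s2.
have Hs3 : based X s3 by apply: based_run.
have F3 : ints s3 3 0 = ints s FOUND 0 by [].
have Hr3 : ints s3 ROOT 0 = r by rewrite -Hr.
have Hg3 : ints s3 GOAL 0 = g by rewrite -Hg.
have T3 : nums s3 THR 0 = nums s BEST 0 by [].
have [os Hos] := run_prepare T Hs3 Hr3 Hg3.
rewrite run_seq; have : ints (run p_prepare s3) 3 0 = ints s FOUND 0 by rewrite ints_run.
have : nums (run p_prepare s3) THR 0 = nums s BEST 0 by rewrite nums_run.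
move: (run p_prepare s3) Hos => s4 Hos T4 F4.
set p := run _ s4; split; first by rewrite ints_run.
have [Uos [Sos Mos] _ Ho Hp] := ready_rooted Hos.
pose Inv k (s' : store R) := forall i, i < k -> i < size os ->
  nums s' 4 (pe T (nth r os i)) = shift (P r g) (nums s BEST 0%N) (pe T (nth r os i)).
have H : Inv (ints s4 4 2) p.
  apply: (run_for (Inv := Inv)) => //.
  move=> k s' s5; rewrite (std_pred (ready_std Hos)) -Sos => Hk Ek F1 F2 IH Es i.
  rewrite ltnS => ik iS; pose x := nth r os k.
  have xr : x != r by rewrite -Mos mem_nth.
  have Hos' : ready g T os s'.
    apply: (ready_eq _ _ Hos) => B j HB; [rewrite F1|rewrite F2] => //;
    by move: HB; rewrite !inE; do ?[case/orP]; move/eqP->.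
  move: Es; rewrite run_seq; set s6 := run _ s'.
  have Hos6 : ready g T os s6 by apply: ready_run.
  have T6 : ints s6 TV 0 = x.
    by rewrite -[LHS]/(ints s' ORD (ints s' CTR 0)) Ek F1 // Ho.
  have S6 := run_shift Hos6 xr T6.
  have : ready g T os (run p_shift s6) by apply: ready_run.
  have : ints (run p_shift s6) TV 0 = x by rewrite ints_run.
  have : forall j, nums (run p_shift s6) 4 j = nums s' 4 j.
    by move=> j; rewrite nums_run.
  rewrite run_seq; move: (run p_shift s6) S6 => s7 S7 X7 T7 Hos7 Es.
  have [_ _ _ _ Hp7] := ready_rooted Hos7; have [_ Ep] := Hp7 x xr.
  have -> : nums (seti CTR 0 k.+1 s5) 4 (pe T (nth r os i)) =
     put (nums s7 4) (ints s7 PE (ints s7 TV 0)) (nums s7 SHIFT 0%N) (pe T (nth r os i)).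
    by rewrite Es.
  have Thr6 : nums s6 THR 0 = nums s BEST 0 by rewrite -T4 -(F2 THR).
  rewrite putE T7 Ep S7 (val_eqE (pe T _) (pe T x)) Thr6 X7.
  case: eqP => [->//|neq]; apply: IH => //.
  by rewrite ltn_neqAle ik andbT; apply: contra_not_neq neq => ->.
move=> e; have [c cr <-] := pe_surj T e.
have cos : c \in os by rewrite Mos.
have := H (index c os); rewrite nth_index //; apply; last by rewrite index_mem.
by rewrite (std_pred (ready_std Hos)) -Sos index_mem.
Qed.

End Main.

(** * Correctness of the whole program *)

Section Correctness.
Variables (R : realFieldType) (I : problem R).
Hypothesis valid_I : valid I.
Local Notation V := 'I_(nv I).
Local Notation E := 'I_(ne I).
Local Notation a := (leaf_a I).
Local Notation b := (leaf_b I).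
Local Notation cheb := (@chebyshev_cost R I).

Lemma dist_ext (l l' : E -> R) u v : l =1 l' -> dist l u v = dist l' u v.
Proof.
move=> H; rewrite /dist (eq_bigr l') => [|e _]; last exact: H.
by apply: eq_bigr => p _; apply: eq_bigr => e _; apply: H.
Qed.

(** The output array agrees with the shift only pointwise, so feasibility has to be transferred
    along this equality. *)
Lemma feasible_ext (x y : E -> R) : x =1 y -> feasible x -> feasible y.
Proof.
move=> xy /(feasibleE valid_I)[[H1 H2] H3].
have L : new_len x =1 new_len y by move=> e; rewrite /new_len !xy.
have F r g : far (new_len x) r g -> far (new_len y) r g.
  by move=> f u; rewrite -!(dist_ext _ _ L).
apply/(feasibleE valid_I); split.
  by split=> e; rewrite -?xy -?L.
case: H3 => [[f1 f2]|f|f]; [constructor 1|constructor 2|constructor 3].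
- by split; apply: F.
- by move=> v wv; apply/F/f.
- by move=> v wv; apply/F/f.
Qed.

Lemma cheb_ext (x y : E -> R) : x =1 y -> cheb x = cheb y.
Proof. by move=> xy; apply: eq_bigr => e _; rewrite xy. Qed.

(** [BEST] bounds the cost of its own shift from above and the cost of every feasible solution from
    below, which makes the shift optimal. *)
Lemma correct_of_best (s s' : store R) (r g : V) :
  best_for (fun y => [\/ case_diameter y, case_target (leaf_a I) y | case_target (leaf_b I) y]) s r g ->
  ints s' 3 0 = ints s FOUND 0 ->
  (forall e : E, nums s' 4 e = shift (P r g) (nums s BEST 0%N) e) ->
  correct_output I s'.
Proof.
move=> [_ _ F1 Ff Fo] E3 E4; have [F|F] : ints s FOUND 0 = 0 \/ ints s FOUND 0 = 1.
  by case: (ints s FOUND 0) F1 => [|[|]]; [left|right|].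
  left; split; first by rewrite E3.
  move=> x fx; have /(feasibleE valid_I)[_ C] := fx.
  by have [] := Fo x fx C; rewrite F.
right; split; first by rewrite E3.
have [t0 fs] := Ff F; split.
  by apply: feasible_ext fs => e; rewrite E4.
move=> y fy; have /(feasibleE valid_I)[_ C] := fy.
have [_ le] := Fo y fy C; apply: le_trans le.
by rewrite (cheb_ext E4); apply: chebyshev_shift.
Qed.

Lemma run_main (s : store R) : std_leaves I s -> correct_output I (run p_main s).
Proof.
move=> Hs; have [X HX Bs] := run_setup valid_I Hs.
rewrite /p_main run_seq; move: (run p_setup s) Bs => s0 B0.
have La s' : based I X s' -> ints s' 0 2 = a by case=> -[_ []].
have Lb s' : based I X s' -> ints s' 0 3 = b by case=> -[_ []].
rewrite run_seq.
have [B1 O1 [xa xaE xaG] _] := run_solve valid_I 0 HX B0 (La _ B0 : ieval s0 LEAFA = a)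
  (Lb _ B0 : ieval (seti ROOT 0 a s0) LEAFB = b).
move: (run (p_solve _ _ _) s0) B1 O1 xaE => s1 B1 O1 xaE.
rewrite run_seq.
have [B2 O2 [xb xbE xbG] K2] := run_solve valid_I 1 HX B1 (Lb _ B1 : ieval s1 LEAFB = b)
  (La _ B1 : ieval (seti ROOT 0 b s1) LEAFA = a).
have [K2a K2b K2c] := K2 0 isT.
rewrite -K2a -K2c in O1; rewrite -K2b in xaE.
move: (run (p_solve _ _ _) s1) B2 O1 O2 xaE xbE {K2 K2a K2b K2c} => s2 B2 O1 O2 xaE xbE.
rewrite run_seq.
have [B3 O3 _ K3] := run_solve valid_I 2 HX B2 (xaE : ieval s2 (IGet GATES (ICst 0)) = xa)
  (La _ B2 : ieval (seti ROOT 0 xa s2) LEAFA = a).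
have [K0a K0b K0c] := K3 0 isT; have [K1a K1b K1c] := K3 1 isT.
rewrite -K0a -K0c in O1; rewrite -K1a -K1c in O2; rewrite -K0b in xaE; rewrite -K1b in xbE.
move: (run (p_solve _ _ _) s2) B3 O1 O2 O3 xaE xbE {K3 K0a K0b K0c K1a K1b K1c}
  => s3 B3 O1 O2 O3 xaE xbE.
rewrite run_seq.
have [B4 O4 _ K4] := run_solve valid_I 3 HX B3 (xbE : ieval s3 (IGet GATES (ICst 1)) = xb)
  (Lb _ B3 : ieval (seti ROOT 0 xb s3) LEAFB = b).
have [K0a K0b K0c] := K4 0 isT; have [K1a K1b K1c] := K4 1 isT; have [K2a _ K2c] := K4 2 isT.
rewrite -K0a -K0c in O1; rewrite -K1a -K1c in O2; rewrite -K2a -K2c in O3.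
rewrite -K0b in xaE; rewrite -K1b in xbE.
move: (run (p_solve _ _ _) s3) B4 O1 O2 O3 O4 xaE xbE {K4 K0a K0b K0c K1a K1b K1c K2a K2c}
  => s4 B4 O1 O2 O3 O4 xaE xbE.
rewrite run_seq.
have B5 : based I X (run p_choose_diameter s4) by apply: based_run.
have D5 := run_choose_diameter valid_I (based_std B4) O1 O2.
have K k : [/\ ints (run p_choose_diameter s4) FLAGS k = ints s4 FLAGS k,
    nums (run p_choose_diameter s4) RES k = nums s4 RES k &
    ints (run p_choose_diameter s4) GATES k = ints s4 GATES k].
  by rewrite !ints_run ?nums_run.
have [K2a K2b _] := K 2; have [K3a K3b _] := K 3; have [_ _ K0c] := K 0; have [_ _ K1c] := K 1.
rewrite -K2a -K2b in O3; rewrite -K3a -K3b in O4; rewrite -K0c in xaE; rewrite -K1c in xbE.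
move: (run p_choose_diameter s4) B5 D5 O3 O4 xaE xbE
  {B0 B1 B2 B3 B4 O1 O2 K K2a K2b K3a K3b K0c K1c}
  => s5 B5 D5 O3 O4 xaE xbE.
have target_far (x g : V) (y : E -> R) : gate x g -> admissible y ->
    case_target g y <-> far (new_len y) x g.
  by move=> Gx [_ y0]; apply: (far_gate valid_I y0 Gx).
have target_feasible g (y : E -> R) : (g = a \/ g = b) -> case_target g y ->
    admissible y -> feasible y.
  move=> gE Hy adm; apply/(feasibleE valid_I); split=> //.
  by case: gE Hy => -> Hy; [constructor 2|constructor 3].
rewrite run_seq; set o2 := p_offer 2 _ _.
have B6 : based I X (run o2 s5) by apply: based_run.
have D6 : (exists v : V, (0 < weight v)%R) -> exists r1 g1 : V,
    best_for (fun y => case_diameter y \/ case_target a y) (run o2 s5) r1 g1.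
  move=> someS; apply: (run_offer (k := 2) (er := IGet GATES (ICst 0)) (eg := LEAFA)
    valid_I D5 O3 _ _ xaE (La _ B5)) => y.
    by move=> adm; apply: target_far adm; apply: xaG.
  by apply: target_feasible; left.
have K2a : ints (run o2 s5) FLAGS 3 = ints s5 FLAGS 3 by rewrite ints_run.
have K2b : nums (run o2 s5) RES 3 = nums s5 RES 3 by rewrite nums_run.
have K2c : ints (run o2 s5) GATES 1 = ints s5 GATES 1 by rewrite ints_run.
rewrite -K2a -K2b in O4; rewrite -K2c in xbE.
move: (run o2 s5) B6 D6 O4 xbE {B5 D5 O3 K2a K2b K2c} => s6 B6 D6 O4 xbE.
rewrite run_seq; set o3 := p_offer 3 _ _.
have B7 : based I X (run o3 s6) by apply: based_run.
have D7 : (exists v : V, (0 < weight v)%R) -> exists r1 g1 : V,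
    best_for (fun y => (case_diameter y \/ case_target a y) \/ case_target b y)
      (run o3 s6) r1 g1.
  move=> someS; have [r6 [g6 D]] := D6 someS.
  apply: (run_offer (k := 3) (er := IGet GATES (ICst 1)) (eg := LEAFB)
    valid_I D O4 _ _ xbE (Lb _ B6)) => y.
    by move=> adm; apply: target_far adm; apply: xbG.
  by apply: target_feasible; right.
move: (run o3 s6) B7 D7 {B6 D6 O4 xbE xaE} => s7 B7 D7.
rewrite run_seq (run_empty (proj1 (based_std B7))).
have B8 : based I X (run p_scan_weights s7) by apply: based_run.
have Ir : ints (run p_scan_weights s7) BROOT 0 = ints s7 BROOT 0 by rewrite ints_run.
have Ig : ints (run p_scan_weights s7) BGOAL 0 = ints s7 BGOAL 0 by rewrite ints_run.
have If : ints (run p_scan_weights s7) FOUND 0 = ints s7 FOUND 0 by rewrite ints_run.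
have It : nums (run p_scan_weights s7) BEST 0 = nums s7 BEST 0 by rewrite nums_run.
move: (run p_scan_weights s7) B8 Ir Ig If It => s8 B8 Ir Ig If It.
case: ifP => [/forallP noS|/negbT someS].
  have B9 : based I X (run (p_best (RCst 0) LEAFA LEAFB) s8) by apply: based_run.
  have Ea : ints (run (p_best (RCst 0) LEAFA LEAFB) s8) BROOT 0 = a by rewrite -(La _ B8).
  have Eb : ints (run (p_best (RCst 0) LEAFA LEAFB) s8) BGOAL 0 = b by rewrite -(Lb _ B8).
  have Ef : ints (run (p_best (RCst 0) LEAFA LEAFB) s8) FOUND 0 = 1 by [].
  have Et : nums (run (p_best (RCst 0) LEAFA LEAFB) s8) BEST 0 = 0%R by [].
  move: (run (p_best _ _ _) s8) B9 Ea Eb Ef Et => s9 B9 Ea Eb Ef Et.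
  have [G1 G2] := run_output valid_I B9 Ea Eb.
  apply: (correct_of_best (s := s9) (r := a) (g := b)) => //.
  split=> //; rewrite ?Ef ?Et //.
  - move=> _; split=> //; apply/(feasibleE valid_I); split; first exact: shift_admissible.
    by constructor 2 => v wv; have := noS v; rewrite wv.
  - by move=> y _ _; split=> //; apply: chebyshev_ge0.
have {someS}/D7[r7 [g7 [E1 E2 E3 E4 E5]]] : exists v : V, (0 < weight v)%R.
  by move: someS => /forallPn[v]; rewrite negbK; exists v.
rewrite -Ir in E1; rewrite -Ig in E2.
have [G1 G2] := run_output valid_I B8 E1 E2.
apply: (correct_of_best (s := s8) (r := r7) (g := g7)) => //.
split=> //; rewrite ?If ?It //.
move=> y fy C; apply: E5 => //.
by case: C; [left; left|left; right|right].
Qed.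

End Correctness.

(** * Computing the loop counts, and the running time *)

Fixpoint loop_free (p : prog) : bool :=
  match p with
  | PSeq p q | PIf _ p q => loop_free p && loop_free q
  | PFor _ _ _ => false
  | _ => true
  end.

(** Needed for the pieces that write [CONST], which the bound for counted loops excludes. *)
Lemma exec_loop_free (R : realFieldType) p (s : store R) : loop_free p ->
  exists2 t, exec (compile p) s t (run p s) & t <= cost_factor p.
Proof.
elim: p s => [B i e|B i e|p IHp q IHq|c p IHp q IHq||B k p IHp] s //=.
- by move=> _; eexists; [exact: ExISet|].
- by move=> _; eexists; [exact: ExRSet|].
- case/andP=> /(IHp s)[t1 e1 T1] /(IHq (run p s))[t2 e2 T2].
  by exists (t1 + t2); [exact: ExSeq e1 e2|exact: leq_add].
- case/andP=> /(IHp s)[t1 e1 T1] /(IHq s)[t2 e2 T2].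
  exists (bcost c + (if beval s c then t1 else t2)).+1.
    by apply: ExIf; rewrite run_if; case: ifP.
  by rewrite ltnS -addnA leq_add2l; case: ifP => _; lia.
- by exists 1; [exact: ExSkip|].
Qed.

Definition p_consts : prog :=
  PSeqs [:: PI CONST (ICst 0) (IGet INPUT (ICst 0)); PI CONST (ICst 1) (IGet INPUT (ICst 1));
            PI CONST (ICst 2) (ISub (IGet INPUT (ICst 0)) (ICst 1));
            PI CONST (ICst 4) (IAdd (IGet INPUT (ICst 1)) (ICst 1));
            PI LOG (ICst 0) (ICst 0); PI WIDTH (ICst 0) (ICst 1)].

Definition p_log : prog :=
  PFor CTR 0 (PIf (BNot (ILe (IGet CONST (ICst 0)) (IVar WIDTH)))
    (PSeq (PI WIDTH (ICst 0) (IAdd (IVar WIDTH) (IVar WIDTH)))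
          (PI LOG (ICst 0) (IAdd (IVar LOG) (ICst 1)))) PSkip).

Definition p_set_log : prog := PI CONST (ICst 3) (IVar LOG).

Definition solver : cmd :=
  Seq (compile p_consts)
    (Seq (compile p_log) (Seq (compile p_set_log) (compile p_main))).

Definition solver_factor : nat :=
  cost_factor p_consts + cost_factor p_log + cost_factor p_set_log + 2 * cost_factor p_main.

(** Doubling stops once the power reaches [n]. The [n] rounds of the loop suffice because n < 2^n,
    and each doubling happens only below [n], which bounds the exponent by the logarithm plus
    one. *)
Lemma run_log (R : realFieldType) (s : store R) (n := ints s 4 0) :
  0 < n -> ints s LOG 0 = 0 -> ints s WIDTH 0 = 1 ->
  n <= 2 ^ ints (run p_log s) LOG 0 /\ ints (run p_log s) LOG 0 <= (trunc_log 2 n).+1.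
Proof.
move=> n0 L0 W0.
pose Inv i (s' : store R) := let l := ints s' LOG 0 in
  [/\ ints s' WIDTH 0 = 2 ^ l, l <= (trunc_log 2 n).+1 & n <= 2 ^ l \/ l = i].
have [_ H1 H2] : Inv (ints s 4 0) (run p_log s).
  apply: (run_for (Inv := Inv)) => //.
    by split; [rewrite [LHS]W0 [ints _ _ _]L0|rewrite [ints _ _ _]L0|right].
  move=> i s' s1 Hi Ei F1 F2 [E1 E2 E3] E.
  have En : ints s' 4 0 = n by rewrite F1.
  have {}E : s1 = if n <= 2 ^ ints s' LOG 0 then s' else
     run (PSeq (PI WIDTH (ICst 0) (IAdd (IVar WIDTH) (IVar WIDTH)))
          (PI LOG (ICst 0) (IAdd (IVar LOG) (ICst 1)))) s'.
    rewrite E run_if run_skip -[beval _ _]/(~~ (ints s' 4 0 <= ints s' WIDTH 0)) En E1.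
    by case: (n <= 2 ^ _).
  have S1 : ints (seti CTR 0 i.+1 s1) LOG 0 = ints s1 LOG 0 by [].
  have S2 : ints (seti CTR 0 i.+1 s1) WIDTH 0 = ints s1 WIDTH 0 by [].
  rewrite /Inv S1 S2; case: (leqP n) E => [le|gt] ->; first by split=> //; left.
  rewrite run_seq; set s2 := run _ _.
  have G1 : ints s2 LOG 0 = (ints s' LOG 0).+1 by rewrite -[RHS]addn1.
  have G2 : ints s2 WIDTH 0 = ints s' WIDTH 0 + ints s' WIDTH 0 by [].
  rewrite G1 G2 E1 expnS mul2n addnn; split=> //.
    by rewrite ltnS trunc_log_max // ltnW.
  by case: E3 => [|->]; [rewrite leqNgt gt|right].
split=> //; case: H2 => // E; rewrite E ltnW //; exact: ltn_expl.
Qed.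

Lemma run_consts (R : realFieldType) (s : store R) k :
  (forall j, ints s 4 j = 0) ->
  ints (run p_consts s) 4 k =
    nth 0 [:: ints s 0 0; ints s 0 1; (ints s 0 0).-1; 0; (ints s 0 1).+1] k.
Proof.
move=> Z.
have -> : ints (run p_consts s) 4 k =
    put (put (put (put (ints s 4) 0 (ints s 0 0)) 1 (ints s 0 1)) 2 (ints s 0 0 - 1))
      4 (ints s 0 1 + 1) k by [].
rewrite !putE !Z addn1 subn1.
by case: k => [|[|[|[|[|k]]]]] //=; rewrite nth_nil.
Qed.

Lemma array_ofE (n : nat) (U : Type) (z : U) (f : 'I_n -> U) (i : 'I_n) :
  array_of z f i = f i.
Proof. by rewrite /array_of valK. Qed.

Lemma run_set_log (R : realFieldType) (s : store R) k :
  ints (run p_set_log s) 4 k = if k == 3 then ints s LOG 0 else ints s 4 k.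
Proof. by []. Qed.

Theorem theorem3 :
  exists (c : cmd) (C : nat), solves_in_time c (fun n => (C * (n * trunc_log 2 n))%N).
Proof.
exists solver, solver_factor => R I valid_I.
have [_ _ _ [_ _ ab]] := valid_I.
have [T] := rooted_exists valid_I (leaf_a I).
(* The two leaves are distinct, so the logarithm is at least 1; the bound has no additive term to
   cover a vanishing one. *)
have n2 : 1 < nv I.
  have := max_card (mem [:: leaf_a I; leaf_b I]); rewrite card_ord.
  by have /card_uniqP -> : uniq [:: leaf_a I; leaf_b I] by rewrite /= inE ab.
have n0 := ltnW n2; have m_lt := ne_lt_nv T.
have l1 : 0 < trunc_log 2 (nv I) by rewrite trunc_log_gt0.
set l := trunc_log 2 (nv I) in l1 *.
have [t1 e1 T1] := exec_loop_free (input I) (isT : loop_free p_consts).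
have C1 k := @run_consts R (input I) k (fun _ => erefl).
have L0 : ints (run p_consts (input I)) LOG 0 = 0 by [].
have W0 : ints (run p_consts (input I)) WIDTH 0 = 1 by [].
have keep1 A j : A \notin [:: 4; LOG; WIDTH] ->
    ints (run p_consts (input I)) A j = ints (input I) A j.
  by move=> HA; rewrite ints_run //; move: HA; rewrite !inE !negb_or => /and3P[-> -> ->].
have nkeep1 A j : nums (run p_consts (input I)) A j = nums (input I) A j.
  by rewrite nums_run.
move: (run p_consts (input I)) e1 C1 L0 W0 keep1 nkeep1 => s1 e1 C1 L0 W0 keep1 nkeep1.
have c0 : ints s1 4 0 = nv I by rewrite C1.
have K1 k : ints s1 4 k <= if k == 3 then l.+1 else nv I.
  rewrite C1; case: k => [|[|[|[|[|k]]]]] //=; rewrite ?nth_nil //.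
  - exact: ltnW.
  - exact: leq_pred.
have n0' : 0 < ints s1 4 0 by rewrite c0.
have [L1 L2] := run_log n0' L0 W0; rewrite c0 -/l in L1 L2.
have [t2 e2 T2] := exec_compile (isT : well_formed p_log) n0 (ltn0Sn l) isT K1.
have keep2 A j : A \notin [:: CTR; LOG; WIDTH] -> ints (run p_log s1) A j = ints s1 A j.
  move=> HA; rewrite ints_run //; move: HA; rewrite !inE !negb_or.
  by case/and3P=> -> -> ->.
have nkeep2 A j : nums (run p_log s1) A j = nums s1 A j by rewrite nums_run.
move: (run p_log s1) e2 L1 L2 keep2 nkeep2 => s2 e2 L1 L2 keep2 nkeep2.
have [t3 e3 T3] := exec_loop_free s2 (isT : loop_free p_set_log).
have S3 := run_set_log s2.
have keep3 A j : A != 4 -> ints (run p_set_log s2) A j = ints s2 A j.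
  by move=> HA; rewrite ints_run // inE.
have nkeep3 A j : nums (run p_set_log s2) A j = nums s2 A j by rewrite nums_run.
move: (run p_set_log s2) e3 S3 keep3 nkeep3 => s3 e3 S3 keep3 nkeep3.
have K3 k : ints s3 4 k <= if k == 3 then l.+1 else nv I.
  by rewrite S3; have := K1 k; case: ifP => //; rewrite keep2.
have ints3 A j : A \notin [:: 4; CTR; LOG; WIDTH] -> ints s3 A j = ints (input I) A j.
  rewrite !inE !negb_or => /and4P[h1 h2 h3 h4].
  by rewrite keep3 // keep2 ?keep1 // !inE !negb_or; apply/and3P.
have nums3 A j : nums s3 A j = nums (input I) A j by rewrite nkeep3 nkeep2.
have Hs3 : std_leaves I s3.
  split; last by rewrite !ints3.
  have C3 k : k != 3 -> ints s3 4 k = ints s1 4 k.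
    by move=> /negbTE k3; rewrite S3 k3 keep2.
  split; try by rewrite C3 ?C1.
  + by move=> e; rewrite ints3 //=; apply: array_ofE.
  + by move=> e; rewrite ints3 //=; apply: array_ofE.
  + by rewrite S3.
  + by move=> v; rewrite nums3; apply: array_ofE.
  + by move=> e; rewrite nums3; apply: array_ofE.
  + by move=> e; rewrite nums3; apply: array_ofE.
  + by move=> e; rewrite nums3; apply: array_ofE.
have wf : well_formed p_main by vm_compute.
have ro : 4 \notin iwrites p_main by vm_compute.
have [t4 e4 T4] := exec_compile wf n0 (ltn0Sn l) ro K3.
(* The syntax shows that linear loops are never nested in each other, nor logarithmic ones, which
   leaves a factor [nv I * l.+1]. *)
have d1 : lin_depth p_main = 1 by vm_compute.
have d2 : log_depth p_main = 1 by vm_compute.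
have out := run_main valid_I Hs3.
exists (t1 + (t2 + (t3 + t4))), (run p_main s3).
split; [exact: ExSeq e1 (ExSeq e2 (ExSeq e3 e4))|exact: out|].
rewrite d1 d2 !expn1 in T4.
have T2' : t2 <= cost_factor p_log * nv I.
  by apply: leq_trans T2 _; rewrite expn1 expn0 muln1.
move: T1 T2' T3 T4; rewrite /solver_factor.
move: (cost_factor p_consts) (cost_factor p_log) (cost_factor p_set_log)
  (cost_factor p_main) => k1 k2 k3 k4 T1 T2' T3 T4.
have N_gt0 : 0 < nv I * l by rewrite muln_gt0 n0.
have n_le : nv I <= nv I * l by rewrite leq_pmulr.
(* Rounding the logarithm up costs at most a factor of 2, the one in [solver_factor]. *)
have H4 : nv I * l.+1 <= 2 * (nv I * l) by rewrite mulnS; lia.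
have H1 : k1 <= k1 * (nv I * l) by rewrite leq_pmulr.
have H2 : k2 * nv I <= k2 * (nv I * l) by rewrite leq_mul2l n_le orbT.
have H3 : k3 <= k3 * (nv I * l) by rewrite leq_pmulr.
have H5 : k4 * (nv I * l.+1) <= k4 * (2 * (nv I * l)) by rewrite leq_mul2l H4 orbT.
have -> : (k1 + k2 + k3 + 2 * k4) * (nv I * l) =
  k1 * (nv I * l) + k2 * (nv I * l) + k3 * (nv I * l) + k4 * (2 * (nv I * l)) by ring.
by move: T1 T2' T3 T4 H1 H2 H3 H5; lia.
Qed.
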